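(* Assume $G^\star=Z^\star (Z^\star)^\top$ with $Z^\star\in\mathbb R^{n\times k}_0$, where $(Z^\star,\alpha^\star)$ satisfies Condition A (stated in the context). Let $(\hat G,\hat\alpha)$ be the solution of the convex problem $$\max_{G,\alpha}\ l(G,\alpha)-\lambda_{n,T}\|G\|_*\quad\text{subject to } G\in\mathbb S_+^n,\ G1_n=0_n,\ |G_{ij}|\le M_{Z,1}\ (1\le i,j\le n),$$ with $\alpha$ ranging over $\mathbb R^{n\times T}$. Suppose $\lambda_{n,T}\asymp\sqrt{nT}\log(nT)$. Then for any constant $s>0$ there exists a constant $C_s>0$ such that, when $n/\log(T)$ is sufficiently large, $$\Pr\Big\{\|\hat G-G^\star\|_F^2/n>\frac1T\times C_s\,r'_{n,T}\Big\}=O(n^{-s}),\qquad r'_{n,T}=\max\Big\{1,\frac Tn\Big\}\log^2(nT).$$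
   Context: Model. There are $n$ nodes, $T$ time points and a fixed latent dimension $k\ge1$. The observed counts $A_{t,ij}=A_{t,ji}$ ($1\le t\le T$, $1\le i\le j\le n$) are independent Poisson random variables with means $\exp(\Theta^\star_{t,ij})$, $\Theta^\star_{t,ij}=\alpha^\star_{it}+\alpha^\star_{jt}+(z_i^\star)^\top z_j^\star$, where $Z^\star=(z^\star_1,\dots,z^\star_n)^\top\in\mathbb R^{n\times k}$ and $\alpha^\star=(\alpha^\star_{it})\in\mathbb R^{n\times T}$ are the true parameters. Notation. $\mathbb R_0^{n\times k}=\{Z\in\mathbb R^{n\times k}:1_n^\top Z=0,\ \det(Z^\top Z)\ne0\}$; $\mathbb S_+^n$ is the set of $n\times n$ symmetric positive semidefinite matrices; $1_n,0_n\in\mathbb R^n$ are the all-ones and zero vectors; $\|\cdot\|_*$ is the nuclear norm, $\|\cdot\|_F$ the Frobenius norm; and $$l(G,\alpha)=\sum_{t=1}^T\sum_{1\le i\le j\le n}\big[A_{t,ij}(\alpha_{it}+\alpha_{jt}+G_{ij})-\exp(\alpha_{it}+\alpha_{jt}+G_{ij})\big].$$ $f\asymp h$ means $c_2h\le f\le c_1h$ for some constants $c_1,c_2>0$. Condition A. (i) There are positive constants $M_{Z,1},M_\alpha,M_{\Theta,1}$ such that $\|z_i^\star\|_2^2\le M_{Z,1}$, $|\alpha_{it}^\star|\le M_\alpha$, $\Theta^\star_{t,ij}\le-M_{\Theta,1}$ for all $1\le i,j\le n$, $1\le t\le T$. (ii) There is a positive constant $M_{Z,2}$ with $\sigma_{\min}[(Z^\star)^\top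 Z^\star/n]\ge M_{Z,2}$ ($\sigma_{\min}$ = minimum eigenvalue). (iii) $1_n^\top Z^\star=0$. The constant $M_{Z,1}$ in the optimization problem is the one in Condition A. Asymptotic convention: $k$ and the constants $M_{Z,1},M_{Z,2},M_\alpha,M_{\Theta,1}$ are fixed; $C_s$, the implied constant in $O(\cdot)$ and the threshold in ''sufficiently large'' may depend on these (and on the constants in $\asymp$) and on $s$ but not on $n,T$. *)

(* Defs.v *)
From HB Require Import structures.
From mathcomp Require Export all_boot all_order all_algebra.
From mathcomp Require Export all_classical all_reals all_analysis.
From mathcomp.real_closed Require Export polyrcf.

Set Implicit Arguments.
Unset Strict Implicit.
Unset Printing Implicit Defensive.

Export Order.TTheory GRing.Theory Num.Theory numFieldNormedType.Exports.

Local Open Scope classical_set_scope.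
Local Open Scope ring_scope.

Definition frobenius_norm (R : realType) (m n : nat) (A : 'M[R]_(m, n)) : R :=
  Num.sqrt (\sum_(i < m) \sum_(j < n) A i j ^+ 2).

(* Sum of the singular values, i.e. of the square roots of the eigenvalues of
   A^T A. [rootsR p] lists each real root of [p] once, so the multiplicity
   [mup x p] is put back by hand; all roots of this characteristic polynomial
   are real and nonnegative, since A^T A is positive semidefinite. *)
Definition nuclear_norm (R : realType) (m n : nat) (A : 'M[R]_(m, n)) : R :=
  let p := char_poly (A^T *m A) in
  \sum_(x <- rootsR p) Num.sqrt x *+ mup x p.

(* Meant for a symmetric matrix of positive size, whose set of real eigenvalues
   is finite and nonempty, so that the infimum is a minimum. *)
Definition min_eigenvalue (R : realType) (m : nat) (A : 'M[R]_m) : R :=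
  inf [set a : R | eigenvalue A a].

Definition pos_semidef (R : realType) (n : nat) (G : 'M[R]_n) : Prop :=
  G^T = G /\ forall x : 'cV[R]_n, 0 <= (x^T *m G *m x) 0 0.

Definition ones (R : realType) (n : nat) : 'cV[R]_n := const_mx 1.

(* The set R_0^{n x k} of centered matrices with full column rank. *)
Definition centered_full_rank (R : realType) (n k : nat) (Z : 'M[R]_(n, k)) :
  Prop := (ones R n)^T *m Z = 0 /\ \det (Z^T *m Z) != 0.

(* Mutual independence of the variables X_i, i in D: the product rule for every
   subfamily J of D. *)
Definition mutually_independent (R : realType) (d d' : measure_display)
    (Omega : measurableType d) (E : measurableType d')
    (P : probability Omega R) (I : finType) (D : {set I})
    (X : I -> {RV P >-> E}) : Prop :=
  forall (J : {set I}) (B : I -> set E),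
    J \subset D -> (forall i, measurable (B i)) ->
    P (\bigcap_(i in [set` J]) (X i @^-1` B i)) =
      (\prod_(i in J) P (X i @^-1` B i))%E.

Definition has_poisson_law (R : realType) (d : measure_display)
    (Omega : measurableType d) (P : probability Omega R)
    (X : {RV P >-> nat}) (rate : R) : Prop :=
  forall m : nat, P (X @^-1` [set m]) = (poisson_pmf rate m)%:E.

(* Time-t, (i,j) log-mean. For the true parameters, G = Z Z^T, so that
   G i j is the inner product of rows i and j of Z. *)
Definition log_mean (R : realType) (n T : nat) (G : 'M[R]_n)
    (alpha : 'M[R]_(n, T)) (t : 'I_T) (i j : 'I_n) : R :=
  alpha i t + alpha j t + G i j.

Definition conditionA (R : realType) (k n T : nat) (MZ1 MZ2 Ma MTh1 : R)
    (Z : 'M[R]_(n, k)) (alpha : 'M[R]_(n, T)) : Prop :=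
  [/\ (forall i, frobenius_norm (row i Z) ^+ 2 <= MZ1),
      (forall i t, `|alpha i t| <= Ma),
      (forall t i j, log_mean (Z *m Z^T) alpha t i j <= - MTh1),
      MZ2 <= min_eigenvalue (n%:R^-1 *: (Z^T *m Z)) &
      (ones R n)^T *m Z = 0].

Definition poisson_model (R : realType) (d : measure_display)
    (Omega : measurableType d) (P : probability Omega R) (k n T : nat)
    (Z : 'M[R]_(n, k)) (alpha : 'M[R]_(n, T))
    (A : 'I_T -> 'I_n -> 'I_n -> {RV P >-> nat}) : Prop :=
  [/\ (forall t i j w, A t i j w = A t j i w),
      (forall t i j, has_poisson_law (A t i j)
         (expR (log_mean (Z *m Z^T) alpha t i j))) &
      mutually_independent
        [set x : 'I_T * 'I_n * 'I_n | (x.1.2 <= x.2)%N]%SET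
        (fun x => A x.1.1 x.1.2 x.2)].

(* Values of the observed array: one count matrix per time point. *)
Definition counts (n T : nat) := {ffun 'I_T -> 'M[nat]_n}.

Definition observed (R : realType) (d : measure_display)
    (Omega : measurableType d) (P : probability Omega R) (n T : nat)
    (A : 'I_T -> 'I_n -> 'I_n -> {RV P >-> nat}) (w : Omega) : counts n T :=
  [ffun t => \matrix_(i, j) A t i j w].

Definition loglik (R : realType) (n T : nat) (a : counts n T) (G : 'M[R]_n)
    (alpha : 'M[R]_(n, T)) : R :=
  \sum_(t < T) \sum_(i < n) \sum_(j < n | (i <= j)%N)
    ((a t i j)%:R * log_mean G alpha t i j - expR (log_mean G alpha t i j)).

Definition objective (R : realType) (n T : nat) (lam : R) (a : counts n T)
    (G : 'M[R]_n) (alpha : 'M[R]_(n, T)) : R :=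
  loglik a G alpha - lam * nuclear_norm G.

Definition feasible (R : realType) (n : nat) (MZ1 : R) (G : 'M[R]_n) : Prop :=
  [/\ pos_semidef G, G *m ones R n = 0 & forall i j, `|G i j| <= MZ1].

Definition is_solution (R : realType) (n T : nat) (MZ1 lam : R)
    (a : counts n T) (G : 'M[R]_n) (alpha : 'M[R]_(n, T)) : Prop :=
  feasible MZ1 G /\
  forall (G' : 'M[R]_n) (alpha' : 'M[R]_(n, T)),
    feasible MZ1 G' -> objective lam a G' alpha' <= objective lam a G alpha.

(* The maximum is not attained for every count array: if some node has only
   zero counts at some time t, its alpha_it escapes to -oo. The estimator is
   the solution wherever there is one, and is otherwise unconstrained. *)
Definition is_estimator (R : realType) (n T : nat) (MZ1 lam : R)
    (hG : counts n T -> 'M[R]_n) (halpha : counts n T -> 'M[R]_(n, T)) : Prop :=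
  forall a : counts n T,
    (exists (G : 'M[R]_n) (alpha : 'M[R]_(n, T)), is_solution MZ1 lam a G alpha) ->
    is_solution MZ1 lam a (hG a) (halpha a).

Definition rate' (R : realType) (n T : nat) : R :=
  Num.max 1 (T%:R / n%:R) * ln (n * T)%:R ^+ 2.

(* Main.v *)
(* Let E be the centred counts, l = log (n T), and d the Frobenius norm of the error of the
   estimator. The estimator is compared with the point (G*, alpha* + delta), where delta_t is one
   Newton step of the likelihood in alpha_t at the truth. At that point the gradient in alpha
   vanishes up to terms of order delta^2, so the noise in the n T nuisance parameters drops out;
   the gradient in G consists of the pooled noise sum_t E_t, a correction linear in E and
   with entries of order sqrt (T / n), and a quadratic remainder with entries of order T l / n.

   The degree equations of the likelihood keep the estimated alpha bounded once all node degrees are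
   of order n, so the log-likelihood is strongly concave along the segment, with modulus of order
   T d^2. The operator norm of the pooled noise is below lambda: Poisson tails allow truncation at a
   small multiple of l, and a net of integer vectors handles the truncated noise. Off the
   column space of Z* the error is positive semidefinite, so there the penalty absorbs the noise;
   what remains has rank at most 2 k and costs lambda sqrt k d. Altogether
   T d^2 <= C (sqrt (n T) l d + T l^2), hence d^2 <= C (n / T + 1) l^2. *)

Require Import Defs.
From mathcomp.real_closed Require Import complex.
From mathcomp Require Import spectral sesquilinear.
From mathcomp Require Import ring lra.

Set Implicit Arguments.
Unset Strict Implicit.
Unset Printing Implicit Defensive.

Local Open Scope classical_set_scope.
Local Open Scope ring_scope.

(** * Positive semidefinite matrices *)

(** Expansion at the truth itself would not do: the score in [alpha] has n T entries of size sqrt n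
    against a curvature of order n, so it would contribute n T and give only d^2 / n = O(1). The
    Newton shift removes this linear term; its remainder has total square of order T n^2 |delta|^4,
    and |delta| of order sqrt (l / n) turns this into T l^2.

    A second obstacle is that lambda may be a small multiple of sqrt (n T) l, so the operator norm
    bound is needed with an arbitrarily small constant [c2]. Truncation at about eps l with eps
    proportional to [c2] achieves this: the Poisson tail bound exp (exp b - b L) holds for every b
    >= 0, so a small eps is paid for by a large b, hence by a constant factor only.

    Degrees of order n also secure the existence of the maximum. All events are predicates of
    finitely many counts, and Markov's inequality is proved with finite sums, so no integral occurs.
    Largeness of n / log T gives |delta| <= 1/2 and pays for the factor T in the union bound over
    the degrees; bounded n is absorbed into the constant [K]. *)

Lemma sum_rootsR_prod_XsubC (R : rcfType) (F : R -> R) (s : seq R) :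
  \sum_(x <- rootsR (\prod_(y <- s) ('X - y%:P)))
     F x *+ mup x (\prod_(y <- s) ('X - y%:P)) = \sum_(x <- s) F x.
Proof.
set p := \prod_(y <- s) _.
have p_neq0 : p != 0 by rewrite monic_neq0 // monic_prod_XsubC.
have E : perm_eq (rootsR p) (undup s).
  apply: uniq_perm; [exact: uniq_roots|exact: undup_uniq|].
  move=> x; rewrite mem_undup.
  have /(_ x) := roots_on_rootsR p_neq0.
  by rewrite !inE /= root_prod_XsubC.
rewrite (perm_big _ E) /= -[RHS](big_undup_iterop_count _ s xpredT).
by apply: eq_bigr => x _; rewrite mu_prod_XsubC -/(GRing.natmul _ _).
Qed.

Lemma Re_sum (R : rcfType) (I : Type) (r : seq I) (P : pred I) (F : I -> R[i]) :
  complex.Re (\sum_(i <- r | P i) F i) = \sum_(i <- r | P i) complex.Re (F i).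
Proof. exact: raddf_sum. Qed.

(** The spectral theorem is applied to the complexification of [G], which is Hermitian. An
    eigenvalue is the Hermitian form at a row of [Q], and its real part is the sum of the real
    quadratic forms at the real and imaginary parts of that row, hence nonnegative. *)
Lemma psd_spectral (R : rcfType) (n : nat) (G : 'M[R]_n) :
  G^T = G -> (forall x : 'cV[R]_n, 0 <= (x^T *m G *m x) 0 0) ->
  exists (Q : 'M[R[i]]_n) (l : 'rV[R]_n),
    [/\ Q \is unitarymx, forall j, 0 <= l 0 j &
        map_mx (real_complex R) G =
          invmx Q *m diag_mx (map_mx (real_complex R) l) *m Q].
Proof.
move=> Gs Gp; set A := map_mx (real_complex R) G.
have Ah : A \is hermsymmx.
  apply/is_hermitianmxP; rewrite expr0 scale1r; apply/matrixP => i j.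
  rewrite !mxE -[G in LHS]Gs mxE.
  by apply/eqP; rewrite eq_complex /= oppr0 !eqxx.
have /orthomx_spectralP AE := hermitian_normalmx Ah.
have dr := hermitian_spectral_diag_real Ah.
set Q := spectralmx A in AE; set sp := spectral_diag A in AE dr.
have Qu : Q \is unitarymx := spectral_unitarymx A.
have spE : sp = map_mx (real_complex R) (map_mx (@complex.Re R) sp).
  apply/matrixP => i j; rewrite !mxE RRe_real //.
  by have /mxOverP := dr; apply.
exists Q, (map_mx (@complex.Re R) sp); split; [exact: Qu| |by rewrite -spE].
move=> j; rewrite mxE.
have -> : sp 0 j = (Q *m A *m invmx Q) j j.
  rewrite AE !mulmxA mulmxV ?mul1mx ?unitarymx_unit //.
  by rewrite mulmxK ?unitarymx_unit // mxE eqxx mulr1n.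
rewrite invmx_unitary //.
pose x : 'cV[R]_n := \col_a complex.Re (Q j a).
pose y : 'cV[R]_n := \col_a complex.Im (Q j a).
have -> : complex.Re ((Q *m A *m (Q ^t*)%sesqui) j j) =
   (x^T *m G *m x) 0 0 + (y^T *m G *m y) 0 0.
  rewrite !mxE Re_sum -big_split /=; apply: eq_bigr => b _.
  rewrite !mxE !big_distrl /= Re_sum -big_split /=; apply: eq_bigr => a _.
  rewrite !mxE /=; case: (Q j a) => a1 a2; case: (Q j b) => b1 b2 /=.
  by rewrite /= ; ring.
by rewrite addr_ge0.
Qed.

(** The unitary eigenvectors are complex; stacking their real and imaginary parts, scaled by the
    roots of the eigenvalues, gives a real factor with twice as many rows. *)
Lemma psd_gram (R : rcfType) (n : nat) (G : 'M[R]_n) :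
  G^T = G -> (forall x : 'cV[R]_n, 0 <= (x^T *m G *m x) 0 0) ->
  exists B : 'M[R]_(n + n, n), G = B^T *m B.
Proof.
move=> Gs Gp; have [Q [l [Qu l0 E]]] := psd_spectral Gs Gp.
exists (col_mx (\matrix_(a, j) (Num.sqrt (l 0 a) * complex.Re (Q a j)))
               (\matrix_(a, j) (Num.sqrt (l 0 a) * complex.Im (Q a j)))).
rewrite tr_col_mx mul_row_col; apply/matrixP => i j.
have -> : G i j = complex.Re ((map_mx (real_complex R) G) i j) by rewrite mxE.
rewrite E invmx_unitary // mul_mx_diag !mxE Re_sum -big_split /=.
apply: eq_bigr => a _; rewrite !mxE /=.
have := sqr_sqrtr (l0 a); move: (Num.sqrt (l 0 a)) => t <-.
by case: (Q a i) => a1 a2; case: (Q a j) => b1 b2 /=; ring.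
Qed.

Lemma char_poly_similar (R : comUnitRingType) (n : nat) (Q A : 'M[R]_n) :
  Q \in unitmx -> char_poly (invmx Q *m A *m Q) = char_poly A.
Proof.
move=> Qu; rewrite /char_poly /char_poly_mx.
set Qi := map_mx polyC (invmx Q); set Qm := map_mx polyC Q.
have QiQ : Qi *m Qm = 1%:M by rewrite -map_mxM /= mulVmx // map_mx1.
have -> : 'X%:M - map_mx polyC (invmx Q *m A *m Q) =
   Qi *m ('X%:M - map_mx polyC A) *m Qm.
  rewrite mulmxBr mulmxBl scalar_mxC -(mulmxA _ Qi) QiQ mulmx1.
  by rewrite !map_mxM.
by rewrite !det_mulmx mulrAC -det_mulmx QiQ det1 mul1r.
Qed.

(** The eigenvalues of [G^T *m G] are the squares of those of [G], and these are nonnegative, so the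
    square roots give them back. On feasible matrices the penalty is therefore linear. *)
Lemma nuclear_norm_psd (R : realType) (n : nat) (G : 'M[R]_n) :
  pos_semidef G -> nuclear_norm G = \tr G.
Proof.
move=> [Gs Gp]; have [Q [l [Qu l0 E]]] := psd_spectral Gs Gp.
have Qi := unitarymx_unit Qu.
have inj := fmorph_inj (real_complex R).
have cp : char_poly (G^T *m G) =
    \prod_(x <- [seq l 0 j ^+ 2 | j <- enum 'I_n]) ('X - x%:P).
  apply: (map_poly_inj (real_complex R)).
  rewrite map_char_poly Gs map_mxM /= E.
  have -> : invmx Q *m diag_mx (map_mx (real_complex R) l) *m Q *m
      (invmx Q *m diag_mx (map_mx (real_complex R) l) *m Q) =
      invmx Q *m diag_mx (\row_j (real_complex R (l 0 j ^+ 2))) *m Q.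
    rewrite -!mulmxA (mulmxA Q) mulmxV // mul1mx; congr (_ *m _).
    rewrite !mulmxA; congr (_ *m _); rewrite mul_diag_mx.
    apply/matrixP => i j; rewrite !mxE; case: eqP => [->|]; last by rewrite !mulr0n mulr0.
    by rewrite !mulr1n -rmorphM.
  rewrite char_poly_similar // char_poly_trig ?diag_mx_is_trig //.
  rewrite big_map big_enum /= rmorph_prod /=; apply: eq_bigr => j _.
  by rewrite !mxE eqxx mulr1n rmorphB /= map_polyX map_polyC.
rewrite /nuclear_norm cp sum_rootsR_prod_XsubC big_map big_enum /=.
apply: inj; rewrite -trace_map_mx E.
rewrite -mulmxA mxtrace_mulC mulmxK // mxtrace_diag rmorph_sum /=.
by apply: eq_bigr => j _; rewrite mxE sqrtr_sqr ger0_norm.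
Qed.

(** * Product Markov inequality and Poisson tails *)

(** The finite family takes countably many values, so the event is a countable union of finite
    intersections of fibres, for an arbitrary predicate [Q]. *)
Lemma measurable_fin_family (R : realType) (d : measure_display)
    (Omega : measurableType d) (P : probability Omega R) (I : finType)
    (X : I -> {RV P >-> nat}) (Q : (I -> nat) -> Prop) :
  measurable [set w | Q (fun i => X i w)].
Proof.
have -> : [set w | Q (fun i => X i w)] =
    \bigcup_(g : {ffun I -> nat})
      (if asbool (Q g) then \bigcap_(i in [set: I]) (X i @^-1` [set g i]) else set0).
  apply/seteqP; split => w /=.
    move=> Qw; exists [ffun i => X i w] => //; rewrite asboolT // => [i _ /=|].
      by rewrite ffunE.
    by rewrite (_ : _ [ffun i => X i w] = fun i => X i w) //; apply/funext => i; rewrite ffunE.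
  case=> g _; case: asboolP => // Qg H.
  suff -> : (fun i => X i w) = g by [].
  by apply/funext => i; exact: (H i).
apply: countable_bigcupT_measurable; first exact: countableP.
move=> g; case: asboolP => // _; apply: fin_bigcap_measurable => // i _.
by rewrite -[X in measurable X]setTI; apply: measurable_funPT.
Qed.

Lemma measure_exists_le (R : realType) (d : measure_display)
    (Omega : measurableType d) (P : probability Omega R) (J : finType)
    (E : set Omega) (F : J -> set Omega) (r : J -> R) :
  measurable E -> (forall j, measurable (F j)) ->
  (forall w, E w -> exists j, F j w) ->
  (forall j, (P (F j) <= (r j)%:E)%E) ->
  (P E <= (\sum_j r j)%:E)%E.
Proof.
move=> mE mF EF le.
apply: (@le_trans _ _ (\sum_(i \in [set: J]) P (F i))%E).
  apply: content_sub_fsum => //; first exact: finite_finset.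
  by move=> w /EF[j Fj]; exists j.
rewrite -sumEFin (@fsbigE _ _ _ _ _ (enum J)) ?enum_uniq //; last first.
  by move=> i _; rewrite mem_enum.
rewrite (eq_bigl xpredT) => [|i]; last by rewrite in_setT.
rewrite big_enum /=.
by apply: lee_sum => j _.
Qed.

(** Only partial sums of the moments enter. [N0] lets a caller bound just the partial sums that
    reach past a truncation level, as [truncated_poisson_mgf] requires. *)
Lemma product_markov (R : realType) (d : measure_display)
    (Omega : measurableType d) (P : probability Omega R) (I : finType)
    (X : I -> {RV P >-> nat}) (D : {set I}) (f : I -> nat -> R) (F : I -> R)
    (N0 : nat) (c : R) :
  mutually_independent D X -> (forall i m, 0 <= f i m) ->
  (forall i N, i \in D -> (N0 <= N)%N ->
     \sum_(m < N) fine (P (X i @^-1` [set val m])) * f i m <= F i) ->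
  0 < c ->
  (P [set w | (c <= \prod_(i in D) f i (X i w))%R] <=
    (c^-1 * \prod_(i in D) F i)%:E)%E.
Proof.
move=> ind f0 fF c0.
have mX := measurable_fin_family X.
have mX1 i (m : nat) : measurable (X i @^-1` [set m]).
  by rewrite -[X in measurable X]setTI; apply: measurable_funPT.
pose p i m := fine (P (X i @^-1` [set m])).
have pE i m : P (X i @^-1` [set m]) = (p i m)%:E.
  by rewrite fineK // fin_num_measure.
have p0 i m : 0 <= p i m by rewrite fine_ge0.
(* With all variables below [N] the expectation of the product is a finite sum, which factors
   by distributivity. *)
pose EN (N : nat) := [set w | c <= \prod_(i in D) f i (X i w) /\
  forall i, i \in D -> (X i w < N)%N].
have mEN N : measurable (EN N).
  exact: (mX (fun g => c <= \prod_(i in D) f i (g i) /\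
    forall i, i \in D -> (g i < N)%N)).
have mE : measurable [set w | c <= \prod_(i in D) f i (X i w)].
  exact: (mX (fun g => c <= \prod_(i in D) f i (g i))).
have EE : [set w | c <= \prod_(i in D) f i (X i w)] = \bigcup_N EN N.
  apply/seteqP; split => w /=; last by case=> N _ [].
  move=> cw; exists (\max_(i in D) X i w).+1 => //; split => // i iD.
  by rewrite ltnS (leq_bigmax_cond i).
have bnd N : (N0 <= N)%N -> (0 < N)%N ->
    (P (EN N) <= (c^-1 * \prod_(i in D) F i)%:E)%E.
  case: N => // N leN _.
  (* Cells are indexed by functions pinned to [ord0] off [D], which is the index set that the
     distributive law [big_distr_big_dep] produces. *)
  pose fam (g : {ffun I -> 'I_N.+1}) := g \in pfamily ord0 (mem D) (fun=> predT).
  pose Fg (g : {ffun I -> 'I_N.+1}) := [set w |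
    [/\ fam g, c <= \prod_(i in D) f i (g i) & forall i, i \in D -> X i w = g i]].
  pose r (g : {ffun I -> 'I_N.+1}) :=
    if fam g then c^-1 * \prod_(i in D) (p i (g i) * f i (g i)) else 0.
  have r0 g : 0 <= r g.
    rewrite /r; case: ifP => // _; rewrite mulr_ge0 ?invr_ge0 ?(ltW c0) //.
    by apply: prodr_ge0 => i _; rewrite mulr_ge0.
  apply: (@le_trans _ _ (\sum_g r g)%:E).
    apply: (measure_exists_le (F := Fg)) => //.
    - move=> g; exact: (mX (fun h => [/\ fam g, c <= \prod_(i in D) f i (g i) &
        forall i, i \in D -> h i = g i])).
    - move=> w [cw lt]; exists [ffun i => if i \in D then inord (X i w) else ord0].
      split.
      + apply/pfamilyP; split => //; apply/supportP => i iD.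
        by rewrite ffunE (negbTE iD).
      + rewrite (eq_bigr (fun i => f i (X i w))) // => i iD.
        by rewrite ffunE iD inordK // lt.
      + by move=> i iD; rewrite ffunE iD inordK // lt.
    - move=> g.
      have [fg|fg] := boolP (fam g); last first.
        rewrite (_ : Fg g = set0) ?measure0 ?lee_fin //.
        by apply/seteqP; split => w // -[]; rewrite (negbTE fg).
      have [cg|cg] := boolP (c <= \prod_(i in D) f i (g i)); last first.
        rewrite (_ : Fg g = set0) ?measure0 ?lee_fin //.
        by apply/seteqP; split => w // -[]; rewrite (negbTE cg).
      have -> : Fg g = \bigcap_(i in [set` D]) (X i @^-1` [set nat_of_ord (g i)]).
        by apply/seteqP; split => w /=; [case=> _ _ H i iD; exact: H|move=> H; split].
      rewrite (ind D (fun i => [set nat_of_ord (g i)])) //.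
      rewrite (eq_bigr (fun i => (p i (g i))%:E)) // prodEFin lee_fin /r fg.
      rewrite big_split /= mulrCA ler_peMr //; first exact: prodr_ge0.
      by rewrite mulrC ler_pdivlMr // mul1r.
  rewrite lee_fin /r -big_mkcond /= -big_distrr /=.
  rewrite ler_pM2l ?invr_gt0 //.
  rewrite -(big_distr_big_dep ord0 (mem D) (fun=> predT)
    (fun i (j : 'I_N.+1) => p i j * f i j)) /=.
  apply: ler_prod => i iD; rewrite fF // andbT.
  by apply: sumr_ge0 => j _; rewrite mulr_ge0.
have cv : P \o EN @ \oo --> P (\bigcup_N EN N).
  apply: nondecreasing_cvg_mu => //; first by rewrite -EE.
  move=> a b ab; apply/subsetPset => w [cw lt]; split => // i iD.
  exact: leq_trans (lt _ iD) ab.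
rewrite EE -(cvg_lim _ cv) //; apply: lime_le; first by apply/cvg_ex; eexists; exact: cv.
exists (maxn N0 1) => // N /=; rewrite geq_max => /andP[? ?]; exact: bnd.
Qed.

Lemma partial_expR_le (R : realType) (x : R) (N : nat) : 0 <= x ->
  \sum_(m < N) x ^+ m / m`!%:R <= expR x.
Proof.
move=> x0.
have -> : \sum_(m < N) x ^+ m / m`!%:R = series (exp_coeff x) N.
  by rewrite seriesEord.
rewrite /expR; apply: nondecreasing_cvgn_le; last exact: is_cvg_series_exp_coeff.
apply/nondecreasing_seqP => n; rewrite !seriesEnat /= big_nat_recr //= lerDl.
exact: exp_coeff_ge0.
Qed.

Lemma poisson_partial_mgf (R : realType) (mu a : R) (N : nat) : 0 < mu ->
  \sum_(m < N) poisson_pmf mu m * expR (a * m%:R) <= expR (mu * (expR a - 1)).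
Proof.
move=> mu0.
rewrite (eq_bigr (fun m : 'I_N => expR (- mu) * ((mu * expR a) ^+ m / m`!%:R))); last first.
  move=> m _; rewrite /poisson_pmf mu0 exprMn mulrC mulrA -expRM_natr.
  by rewrite [_ / _]mulrC; ring.
rewrite -big_distrr /= mulrBr mulr1 addrC expRD ler_pM2l ?expR_gt0 //.
by apply: partial_expR_le; rewrite mulr_ge0 ?expR_ge0 ?ltW.
Qed.

(** Squaring exp (x/2) <= 1 / (1 - x/2) reduces the claim to a polynomial inequality, whose
    difference factors as x^2 (1 - x) (5/2 - x) / 2. No lower bound on [x] is imposed, so Chernoff
    weights need only be bounded from above. *)
Lemma expR_le_quad (R : realType) (x : R) : x <= 1 -> expR x <= 1 + x + 2 * x ^+ 2.
Proof.
move=> x1; have h : expR x = (expR (x / 2)) ^+ 2.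
  by rewrite -expRM_natl; congr expR; field.
have p : 0 < 1 - x / 2 by lra.
have : expR (x / 2) <= (1 - x / 2)^-1.
  rewrite -[expR _]invrK -expRN lef_pV2 ?posrE ?expR_gt0 //.
  by apply: le_trans (expR_ge1Dx _); lra.
move=> le; rewrite h.
apply: (@le_trans _ _ ((1 - x / 2)^-1 ^+ 2)).
  by rewrite ler_pXn2r ?nnegrE ?invr_ge0 ?expR_ge0 ?(ltW p).
rewrite exprVn -[leLHS]mul1r ler_pdivrMr ?exprn_gt0 //.
rewrite -subr_ge0.
have -> : (1 + x + 2 * x ^+ 2) * (1 - x / 2) ^+ 2 - 1 =
   x ^+ 2 * ((1 - x) * (5/2 - x) / 2) by field.
by rewrite mulr_ge0 ?sqr_ge0 // divr_ge0 // mulr_ge0; lra.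
Qed.

Lemma poisson_chernoff (R : realType) (d : measure_display)
    (Omega : measurableType d) (P : probability Omega R) (I : finType)
    (X : I -> {RV P >-> nat}) (D : {set I}) (mu w : I -> R) (tau x : R) :
  mutually_independent D X -> (forall i, has_poisson_law (X i) (mu i)) ->
  (forall i, 0 < mu i) -> (forall i, tau * w i <= 1) -> 0 <= tau ->
  (P [set u | (x <= \sum_(i in D) w i * ((X i u)%:R - mu i))%R] <=
    (expR (2 * tau ^+ 2 * (\sum_(i in D) w i ^+ 2 * mu i) - tau * x))%:E)%E.
Proof.
move=> ind law mu0 tw tau0.
pose f i (m : nat) := expR (tau * w i * (m%:R - mu i)).
pose F i := expR (2 * tau ^+ 2 * (w i ^+ 2 * mu i)).
apply: (@le_trans _ _ ((expR (tau * x))^-1 * \prod_(i in D) F i)%:E); last first.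
  rewrite lee_fin -expRN /F -expR_sum -expRD ler_expR -big_distrr /=.
  by rewrite addrC.
apply: (@le_trans _ _ (P [set u | (expR (tau * x) <= \prod_(i in D) f i (X i u))%R])).
  apply: le_measure; rewrite ?inE.
  - exact: (measurable_fin_family X (fun g => x <= \sum_(i in D) w i * ((g i)%:R - mu i))).
  - exact: (measurable_fin_family X (fun g => expR (tau * x) <= \prod_(i in D) f i (g i))).
  move=> u /= H; rewrite /f -expR_sum ler_expR.
  rewrite (eq_bigr (fun i => tau * (w i * ((X i u)%:R - mu i)))); last by move=> *; rewrite mulrA.
  by rewrite -big_distrr /= ler_wpM2l.
apply: (product_markov (N0 := 0)) => //; last exact: expR_gt0.
  by move=> *; exact: expR_ge0.
move=> i N iD _; rewrite /f /F.
rewrite (eq_bigr (fun m : 'I_N => expR (- (tau * w i * mu i)) *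
   (poisson_pmf (mu i) m * expR (tau * w i * m%:R)))); last first.
  by move=> m _; rewrite law /= mulrBr expRD; ring.
rewrite -big_distrr /=.
apply: le_trans (ler_wpM2l (expR_ge0 _) (poisson_partial_mgf _ _ (mu0 i))) _.
rewrite -expRD ler_expR.
have := expR_le_quad (tw i); have := mu0 i; move: (expR _) => e mui le.
have : mu i * (e - 1 - tau * w i) <= mu i * (2 * (tau * w i) ^+ 2).
  by rewrite ler_pM2l //; lra.
by lra.
Qed.

(** * The penalized noise term *)

(** Lagrange's identity: the sum of the squares of [f i * g j - f j * g i] is twice the defect. *)
Lemma cauchy_schwarz_sum (R : realFieldType) (I : finType) (P : pred I) (f g : I -> R) :
  (\sum_(i | P i) f i * g i) ^+ 2 <=
    (\sum_(i | P i) f i ^+ 2) * (\sum_(i | P i) g i ^+ 2).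
Proof.
have h : 0 <= \sum_(i | P i) \sum_(j | P j) (f i * g j - f j * g i) ^+ 2.
  by apply: sumr_ge0 => i _; apply: sumr_ge0 => j _; exact: sqr_ge0.
have E : \sum_(i | P i) \sum_(j | P j) (f i * g j - f j * g i) ^+ 2 =
   2 * ((\sum_(i | P i) f i ^+ 2) * (\sum_(i | P i) g i ^+ 2)
        - (\sum_(i | P i) f i * g i) ^+ 2).
  have E1 : \sum_(i | P i) \sum_(j | P j) f i ^+ 2 * g j ^+ 2 =
    (\sum_(i | P i) f i ^+ 2) * (\sum_(i | P i) g i ^+ 2).
    by rewrite big_distrl /=; apply: eq_bigr => i _; rewrite big_distrr.
  have E2 : \sum_(i | P i) \sum_(j | P j) f j ^+ 2 * g i ^+ 2 =
    (\sum_(i | P i) f i ^+ 2) * (\sum_(i | P i) g i ^+ 2).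
    by rewrite exchange_big.
  have E3 : \sum_(i | P i) \sum_(j | P j) (f i * g i) * (f j * g j) =
    (\sum_(i | P i) f i * g i) ^+ 2.
    by rewrite expr2 big_distrl /=; apply: eq_bigr => i _; rewrite big_distrr.
  transitivity (\sum_(i | P i) \sum_(j | P j) f i ^+ 2 * g j ^+ 2 +
    \sum_(i | P i) \sum_(j | P j) f j ^+ 2 * g i ^+ 2 -
    2 * \sum_(i | P i) \sum_(j | P j) (f i * g i) * (f j * g j)).
    rewrite !big_distrr /= -big_split /= -sumrB; apply: eq_bigr => i _.
    rewrite !big_distrr /= -big_split /= -sumrB; apply: eq_bigr => j _; ring.
  by rewrite E1 E2 E3; ring.
by move: h; rewrite E pmulr_rge0 // subr_ge0.
Qed.

Lemma mxtrace_mulT (R : comNzRingType) (m n : nat) (A B : 'M[R]_(m, n)) :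
  \tr (A *m B^T) = \sum_i \sum_j A i j * B i j.
Proof. by apply: eq_bigr => i _; rewrite mxE; apply: eq_bigr => j _; rewrite mxE. Qed.

Lemma mxtrace_mulT_ge0 (R : realFieldType) (m n : nat) (A : 'M[R]_(m, n)) :
  0 <= \tr (A *m A^T).
Proof.
rewrite mxtrace_mulT; apply: sumr_ge0 => i _; apply: sumr_ge0 => j _.
by rewrite -expr2 sqr_ge0.
Qed.

Lemma frobenius_norm_sqr (R : realType) (m n : nat) (A : 'M[R]_(m, n)) :
  frobenius_norm A ^+ 2 = \tr (A *m A^T).
Proof.
rewrite mxtrace_mulT sqr_sqrtr //.
by apply: sumr_ge0 => i _; apply: sumr_ge0 => j _; rewrite sqr_ge0.
Qed.

Lemma cauchy_schwarz_mx (R : realFieldType) (m n : nat) (A B : 'M[R]_(m, n)) :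
  (\tr (A *m B^T)) ^+ 2 <= \tr (A *m A^T) * \tr (B *m B^T).
Proof.
rewrite !mxtrace_mulT !pair_bigA /=.
by apply: cauchy_schwarz_sum.
Qed.

Lemma tr_le_frobenius (R : realType) (m n : nat) (A B : 'M[R]_(m, n)) (c : R) :
  0 <= c -> \tr (A *m A^T) <= c ^+ 2 ->
  `|\tr (A *m B^T)| <= c * frobenius_norm B.
Proof.
move=> c0 le; rewrite -(@ler_pXn2r _ 2) ?nnegrE ?mulr_ge0 ?sqrtr_ge0 //.
rewrite real_normK ?num_real // exprMn frobenius_norm_sqr.
apply: le_trans (cauchy_schwarz_mx _ _) _.
by rewrite ler_wpM2r // mxtrace_mulT_ge0.
Qed.

(** The operator norm through the bilinear form: this suits a triangular, non-symmetric noise matrix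
    and a net for each of the two vectors. No absolute value is taken, since [x] may be replaced by
    its opposite. *)
Definition opnorm_le (R : realType) (n : nat) (U : 'M[R]_n) (lam : R) :=
  forall x y : 'rV[R]_n,
    (x *m U *m y^T) 0 0 <= lam * (frobenius_norm x * frobenius_norm y).

(** Test the form at [y = x *m U] and divide by the norm of [y]. *)
Lemma opnorm_le_row (R : realType) (n : nat) (U : 'M[R]_n) (lam : R) (x : 'rV[R]_n) :
  0 <= lam -> opnorm_le U lam -> \tr (x *m U *m (x *m U)^T) <= lam ^+ 2 * \tr (x *m x^T).
Proof.
move=> l0 op; have := op x (x *m U).
have -> : (x *m U *m (x *m U)^T) 0 0 = \tr (x *m U *m (x *m U)^T).
  by rewrite /mxtrace big_ord1.
rewrite -!frobenius_norm_sqr.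
have := sqrtr_ge0 (\sum_(i < 1) \sum_(j < n) (x *m U) i j ^+ 2).
rewrite -/(frobenius_norm _); move: (frobenius_norm (x *m U)) => b.
have := sqrtr_ge0 (\sum_(i < 1) \sum_(j < n) x i j ^+ 2).
rewrite -/(frobenius_norm _); move: (frobenius_norm x) => a a0 b0 le.
have [->|bn] := eqVneq b 0; first by rewrite expr0n /= mulr_ge0 ?sqr_ge0.
have bp : 0 < b by rewrite lt_neqAle eq_sym bn.
have {le} : b <= lam * a by rewrite -(ler_pM2r bp) -expr2 -mulrA.
by move=> le; rewrite -exprMn ler_pXn2r ?nnegrE ?mulr_ge0.
Qed.

Lemma mxtrace_row (R : realType) (m n : nat) (A B : 'M[R]_(m, n)) :
  \tr (A *m B^T) = \sum_i \tr (row i A *m (row i B)^T).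
Proof.
rewrite mxtrace_mulT; apply: eq_bigr => i _; rewrite mxtrace_mulT big_ord1.
by apply: eq_bigr => j _; rewrite !mxE.
Qed.

Lemma opnorm_le_frobenius (R : realType) (m n : nat) (A : 'M[R]_(m, n)) (U : 'M[R]_n)
    (lam : R) :
  0 <= lam -> opnorm_le U lam ->
  \tr ((A *m U) *m (A *m U)^T) <= lam ^+ 2 * \tr (A *m A^T).
Proof.
move=> l0 op; rewrite (mxtrace_row (A *m U)) (mxtrace_row A A) big_distrr /=.
by apply: ler_sum => i _; rewrite row_mul opnorm_le_row.
Qed.

Lemma opnorm_le_tr (R : realType) (n : nat) (U : 'M[R]_n) (lam : R) :
  opnorm_le U lam -> opnorm_le U^T lam.
Proof.
move=> op x y; rewrite [_ * frobenius_norm y]mulrC; apply: le_trans (op y x).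
by rewrite -[y *m U *m x^T]trmxK [in leRHS]mxE !trmx_mul trmxK mulmxA.
Qed.

(** The trace is the sum of the form at (c, c) over the rows c of [C]. This is the duality of
    operator and nuclear norm on positive semidefinite matrices. *)
Lemma opnorm_le_gram (R : realType) (m n : nat) (C : 'M[R]_(m, n)) (U : 'M[R]_n)
    (lam : R) :
  opnorm_le U lam -> \tr (U *m (C^T *m C)) <= lam * \tr (C^T *m C).
Proof.
move=> op; rewrite mulmxA mxtrace_mulC mulmxA.
rewrite [X in _ <= _ * X]mxtrace_mulC mxtrace_row (mxtrace_row C C) big_distrr /=.
apply: ler_sum => i _; rewrite row_mul -frobenius_norm_sqr expr2.
by apply: le_trans (op _ _); rewrite /mxtrace big_ord1.
Qed.

(* The component of [D] outside the column space of [Z] is that of the positive semidefinite [G], so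
   there the penalty [lam * tr] dominates the noise [U]; the rest has rank at most [2 k]. *)
Lemma penalized_noise_le (R : realType) (n k : nat) (Z : 'M[R]_(n, k)) (G U : 'M[R]_n)
    (lam : R) :
  0 <= lam -> pos_semidef G -> \det (Z^T *m Z) != 0 -> opnorm_le U lam ->
  \tr (U^T *m (G - Z *m Z^T)) - lam * \tr (G - Z *m Z^T) <=
    3 * lam * Num.sqrt k%:R * frobenius_norm (G - Z *m Z^T).
Proof.
move=> l0 [Gs Gp] dZ op; set D := G - Z *m Z^T.
have ZZu : Z^T *m Z \in unitmx by rewrite unitmxE unitfE.
pose Pi := Z *m invmx (Z^T *m Z) *m Z^T.
have PiT : Pi^T = Pi.
  by rewrite /Pi !trmx_mul trmxK trmx_inv trmx_mul trmxK mulmxA.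
have PiZ : Pi *m Z = Z by rewrite /Pi -!mulmxA mulVmx // mulmx1.
have PiPi : Pi *m Pi = Pi by rewrite {2}/Pi !mulmxA PiZ.
have trPi : \tr Pi = k%:R.
  by rewrite /Pi -mulmxA mxtrace_mulC -mulmxA mulVmx // mxtrace1.
clearbody Pi; pose Q := 1%:M - Pi.
have QT : Q^T = Q by rewrite /Q linearB /= trmx1 PiT.
have PiQ : Pi *m Q = 0 by rewrite mulmxBr mulmx1 PiPi subrr.
have QZ : Q *m Z = 0 by rewrite mulmxBl mul1mx PiZ subrr.
have QQ : Q *m Q = Q by rewrite {1}/Q mulmxBl mul1mx PiQ subr0.
have DT : D^T = D by rewrite /D linearB /= Gs trmx_mul trmxK.
(* [Pi] projects onto the column space of [Z] and [Q] onto its complement. The first two terms have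
   rank at most k; the last is positive semidefinite, because [Q] annihilates [Z] and so sees only
   [G]. *)
have Ddec : D = Pi *m D + Q *m D *m Pi + Q *m G *m Q.
  have -> : Q *m G *m Q = Q *m D *m Q.
    by rewrite /D (mulmxBr Q G) (mulmxBl (Q *m G)) !mulmxA QZ !mul0mx subr0.
  rewrite -addrA -mulmxDr /Q [Pi + _]addrC subrK mulmx1 mulmxBl mul1mx.
  by rewrite addrC subrK.
clearbody D; have [B GB] := psd_gram Gs Gp.
have QGQ : Q *m G *m Q = (B *m Q)^T *m (B *m Q).
  by rewrite GB trmx_mul QT !mulmxA.
have opT := opnorm_le_tr op.
have h3 := opnorm_le_gram (B *m Q) opT.
have k0 : 0 <= Num.sqrt k%:R :> R by rewrite sqrtr_ge0.
have PiF : \tr (Pi *m Pi^T) <= (Num.sqrt k%:R) ^+ 2.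
  by rewrite PiT PiPi trPi sqr_sqrtr.
have lk : 0 <= lam * Num.sqrt k%:R by rewrite mulr_ge0.
have h1 : `|\tr ((Pi *m U) *m D^T)| <= lam * Num.sqrt k%:R * frobenius_norm D.
  apply: tr_le_frobenius => //; rewrite exprMn.
  apply: le_trans (opnorm_le_frobenius _ l0 op) _.
  by rewrite ler_wpM2l ?sqr_ge0.
have h2 : `|\tr ((Pi *m U^T *m Q) *m D^T)| <= lam * Num.sqrt k%:R * frobenius_norm D.
  apply: tr_le_frobenius => //; rewrite exprMn.
  apply: le_trans (_ : _ <= \tr ((Pi *m U^T) *m (Pi *m U^T)^T)) _; last first.
    apply: le_trans (opnorm_le_frobenius _ l0 opT) _.
    by rewrite ler_wpM2l ?sqr_ge0.
  move: (Pi *m U^T) => A.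
  (* Pythagoras: multiplication by the projection [Q] cannot increase the Frobenius norm. *)
  have -> : \tr (A *m A^T) = \tr ((A *m Q) *m (A *m Q)^T) + \tr ((A *m Pi) *m (A *m Pi)^T).
    rewrite -linearD /= !trmx_mul QT PiT !mulmxA -!(mulmxA A) QQ PiPi.
    by rewrite -mulmxDr -mulmxDl /Q subrK mul1mx.
  by rewrite lerDl mxtrace_mulT_ge0.
(* The penalty also acts on the low-rank part. Together with [h1] and [h2] this accounts for the
   factor 3. *)
have h4 : `|\tr (Pi *m D^T)| <= Num.sqrt k%:R * frobenius_norm D.
  exact: tr_le_frobenius.
clearbody Q; have e1 : \tr (U^T *m (Pi *m D)) = \tr ((Pi *m U) *m D^T).
  by rewrite -[LHS]mxtrace_tr !trmx_mul trmxK PiT DT -mulmxA mxtrace_mulC.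
have e2 : \tr (U^T *m (Q *m D *m Pi)) = \tr ((Pi *m U^T *m Q) *m D^T).
  by rewrite DT !mulmxA mxtrace_mulC !mulmxA.
have e4 : \tr (Q *m D *m Pi) = 0 by rewrite mxtrace_mulC mulmxA PiQ mul0mx linear0.
have e5 : \tr (U^T *m D) = \tr ((Pi *m U) *m D^T) + \tr ((Pi *m U^T *m Q) *m D^T) +
   \tr (U^T *m ((B *m Q)^T *m (B *m Q))).
  by rewrite {1}Ddec !mulmxDr !mxtraceD e1 e2 QGQ.
have e6 : \tr D = \tr (Pi *m D^T) + \tr ((B *m Q)^T *m (B *m Q)).
  by rewrite {1}Ddec !mxtraceD e4 addr0 QGQ DT.
move: h1 h2 h4; rewrite !ler_norml => /andP[_ h1] /andP[_ h2] /andP[h4 _].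
have h5 := ler_wpM2l l0 h4.
rewrite e5 e6; lra.
Qed.

(** * Sums over pairs and the Newton step *)

Definition upper (n : nat) (p : 'I_n * 'I_n) := (p.1 <= p.2)%N.

(** A loop (i, i) counts twice, since the diagonal log-mean contains [alpha i t] twice. With this
    convention [degree] is the derivative in the i-th node parameter. *)
Definition inc (R : nzRingType) (n : nat) (i : 'I_n) (p : 'I_n * 'I_n) : R :=
  (p.1 == i)%:R + (p.2 == i)%:R.

Definition degree (R : nzRingType) (n : nat) (F : 'I_n * 'I_n -> R) (i : 'I_n) : R :=
  \sum_(p | upper p) F p * inc R i p.

Lemma sum_upper (V : nmodType) (n : nat) (F : 'I_n -> 'I_n -> V) :
  \sum_(i < n) \sum_(j < n | (i <= j)%N) F i j = \sum_(p | upper p) F p.1 p.2.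
Proof. by rewrite pair_big_dep. Qed.

Lemma sum_inc (R : comNzRingType) (n : nat) (v : 'I_n -> R) (p : 'I_n * 'I_n) :
  \sum_i v i * inc R i p = v p.1 + v p.2.
Proof.
rewrite /inc (eq_bigr (fun i => v i * (p.1 == i)%:R + v i * (p.2 == i)%:R)); last first.
  by move=> i _; rewrite mulrDr.
rewrite big_split /= (bigD1 p.1) //= eqxx mulr1 big1 ?addr0; last first.
  by move=> i /negbTE; rewrite eq_sym => ->; rewrite mulr0.
rewrite (bigD1 p.2) //= eqxx mulr1 big1 ?addr0 //.
by move=> i /negbTE; rewrite eq_sym => ->; rewrite mulr0.
Qed.

(** [degree] is adjoint to the map from v to v_i + v_j; a residual with zero degrees is thus
    invisible to every change of [alpha]. *)
Lemma sum_upper_degree (R : comNzRingType) (n : nat) (F : 'I_n * 'I_n -> R) (v : 'I_n -> R) :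
  \sum_(p | upper p) F p * (v p.1 + v p.2) = \sum_i v i * degree F i.
Proof.
rewrite (eq_bigr (fun p => \sum_i v i * (F p * inc R i p))); last first.
  by move=> p _; rewrite -sum_inc big_distrr /=; apply: eq_bigr => i _; rewrite mulrCA.
by rewrite exchange_big /=; apply: eq_bigr => i _; rewrite -big_distrr.
Qed.

Lemma inc_ge0 (R : realFieldType) (n : nat) (i : 'I_n) (p : 'I_n * 'I_n) : 0 <= inc R i p.
Proof. by rewrite addr_ge0. Qed.

Lemma inc_le2 (R : realFieldType) (n : nat) (i : 'I_n) (p : 'I_n * 'I_n) : inc R i p <= 2.
Proof. by rewrite /inc; case: eqP; case: eqP; rewrite ?mulr1n ?mulr0n; lra. Qed.

Lemma degree_sym (R : comNzRingType) (n : nat) (F : 'I_n * 'I_n -> R) (i : 'I_n) :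
  (forall a b, F (a, b) = F (b, a)) ->
  degree F i = \sum_j F (i, j) * (1 + (i == j)%:R).
Proof.
move=> Fs; rewrite /degree.
rewrite (eq_bigr (fun p => F p * (p.1 == i)%:R + F p * (p.2 == i)%:R)); last first.
  by move=> p _; rewrite mulrDr.
rewrite big_split /=.
have -> : \sum_(p | upper p) F p * (p.1 == i)%:R = \sum_(j < n | (i <= j)%N) F (i, j).
  transitivity (\sum_(a < n) \sum_(b < n | (a <= b)%N) F (a, b) * (a == i)%:R).
    by rewrite sum_upper; apply: eq_bigr => -[].
  rewrite (bigD1 i) //=.
  rewrite [X in _ + X]big1 ?addr0; last first.
    by move=> a /negbTE ->; rewrite big1 // => b _; rewrite mulr0.
  by apply: eq_bigr => b _; rewrite eqxx mulr1.
have -> : \sum_(p | upper p) F p * (p.2 == i)%:R = \sum_(j < n | (j <= i)%N) F (i, j).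
  transitivity (\sum_(a < n) \sum_(b < n | (a <= b)%N) F (a, b) * (b == i)%:R).
    by rewrite sum_upper; apply: eq_bigr => -[].
  rewrite (exchange_big_dep xpredT) //= (bigD1 i) //=.
  rewrite [X in _ + X]big1 ?addr0; last first.
    by move=> a /negbTE ->; rewrite big1 // => b _; rewrite mulr0.
  by apply: eq_bigr => b _; rewrite eqxx mulr1 Fs.
rewrite big_mkcond /= [X in _ + X]big_mkcond /= -big_split /=.
apply: eq_bigr => j _; have [->|ij] := eqVneq i j.
  by rewrite leqnn mulrDr mulr1.
rewrite addr0 mulr1; case: (ltngtP i j) => //= h; rewrite ?addr0 ?add0r //.
by move/eqP: ij; case; apply: val_inj.
Qed.

Lemma sum_upper_le (R : realFieldType) (n : nat) (F : 'I_n * 'I_n -> R) :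
  (forall p, 0 <= F p) -> \sum_(p | upper p) F p <= \sum_p F p.
Proof.
move=> F0; rewrite [leRHS](bigID (@upper n)) /= lerDl.
by apply: sumr_ge0.
Qed.

Lemma sum_le_upper (R : realFieldType) (n : nat) (F : 'I_n * 'I_n -> R) :
  (forall p, 0 <= F p) -> (forall a b, F (a, b) = F (b, a)) ->
  \sum_p F p <= 2 * \sum_(p | upper p) F p.
Proof.
move=> F0 Fs; rewrite [leLHS](bigID (@upper n)) /= mulr_natl mulr2n lerD2l.
rewrite (reindex_inj (h := fun p => (p.2, p.1))) /=; last first.
  by move=> [a b] [c e] [-> ->].
rewrite [leLHS]big_mkcond [leRHS]big_mkcond /=; apply: ler_sum => -[a b] _.
rewrite /upper /= Fs -ltnNge.
by case: ltnP => h; [rewrite (ltnW h)|case: ifP].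
Qed.

(** Over all ordered pairs the squares (v_i + v_j)^2 sum to 2 n |v|^2 + 2 (sum v)^2, and the pairs
    with i <= j carry at least half of this. *)
Lemma edge_form_ge (R : realFieldType) (n : nat) (mu : 'I_n * 'I_n -> R) (c : R)
    (v : 'I_n -> R) :
  0 <= c -> (forall p, c <= mu p) ->
  c * n%:R * (\sum_i v i ^+ 2) <= \sum_(p | upper p) mu p * (v p.1 + v p.2) ^+ 2.
Proof.
move=> c0 cmu.
apply: (@le_trans _ _ (c * \sum_(p | upper p) (v p.1 + v p.2) ^+ 2)); last first.
  by rewrite big_distrr /=; apply: ler_sum => p _; rewrite ler_wpM2r ?sqr_ge0.
rewrite -mulrA ler_wpM2l //.
have := @sum_le_upper R n (fun p => (v p.1 + v p.2) ^+ 2).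
move=> /(_ (fun p => sqr_ge0 _)) /(_ (fun a b => congr1 (fun x => x ^+ 2) (addrC _ _))).
have -> : \sum_p (v p.1 + v p.2) ^+ 2 =
    2 * (n%:R * \sum_i v i ^+ 2) + 2 * (\sum_i v i) ^+ 2.
  rewrite -(pair_bigA _ (fun i j => (v i + v j) ^+ 2)) /=.
  transitivity (\sum_i (n%:R * v i ^+ 2 + \sum_j v j ^+ 2 + 2 * (v i * \sum_j v j))).
    apply: eq_bigr => i _.
    have -> : n%:R * v i ^+ 2 = \sum_(j < n) v i ^+ 2.
      by rewrite sumr_const card_ord mulr_natl.
    rewrite !big_distrr /= -!big_split /=; apply: eq_bigr => j _; ring.
  rewrite !big_split /= -!big_distrr /= sumr_const card_ord -big_distrl /=.
  by rewrite -[X in _ + X + _]mulr_natl; ring.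
move=> h; have := sqr_ge0 (\sum_i v i); lra.
Qed.

(* [W] is the inverse of the Hessian in [alpha] of the log-likelihood at one time point. *)
Lemma newton_step (R : realFieldType) (n : nat) (mu : 'I_n * 'I_n -> R) (c : R) :
  0 < c -> (forall p, c <= mu p) -> (0 < n)%N ->
  exists W : 'M[R]_n,
    (forall g : 'I_n -> R, let delta i := \sum_l W i l * g l in
       forall i, degree (fun p => mu p * (delta p.1 + delta p.2)) i = g i) /\
    forall i, \sum_l W i l ^+ 2 <= (c * n%:R)^-1 ^+ 2.
Proof.
move=> c0 cmu n0.
pose H : 'M[R]_n := \matrix_(i, j) \sum_(p | upper p) mu p * inc R i p * inc R j p.
have HE (v : 'I_n -> R) i : \sum_j H i j * v j = degree (fun p => mu p * (v p.1 + v p.2)) i.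
  rewrite /degree; transitivity (\sum_j \sum_(p | upper p) mu p * inc R i p * inc R j p * v j).
    by apply: eq_bigr => j _; rewrite mxE big_distrl.
  rewrite exchange_big /=; apply: eq_bigr => p _; rewrite -sum_inc.
  by rewrite !big_distrr /= big_distrl /=; apply: eq_bigr => j _; ring.
have HT i j : H i j = H j i.
  by rewrite !mxE; apply: eq_bigr => p _; rewrite mulrAC.
have cn : 0 < c * n%:R by rewrite mulr_gt0 // ltr0n.
have pos (v : 'I_n -> R) : c * n%:R * (\sum_i v i ^+ 2) <= \sum_i v i * \sum_j H i j * v j.
  apply: le_trans (edge_form_ge v (ltW c0) cmu) _.
  rewrite le_eqVlt; apply/orP; left; apply/eqP.
  rewrite (eq_bigr (fun i => v i * degree (fun p => mu p * (v p.1 + v p.2)) i)); last first.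
    by move=> i _; rewrite HE.
  by rewrite -sum_upper_degree; apply: eq_bigr => p _; rewrite expr2 mulrA.
have Hu : H \in unitmx.
  rewrite -row_free_unit; apply/row_freeP; apply/row_freeP.
  rewrite -kermx_eq0; apply/rowV0P => u /sub_kermxP uH.
  have := pos (fun i => u 0 i).
  rewrite [X in _ <= X -> _]big1; last first.
    move=> i _; have /matrixP/(_ 0 i) := uH; rewrite !mxE => E.
    by rewrite (eq_bigr (fun j => u 0 j * H j i)) ?E ?mulr0 // => j _; rewrite HT mulrC.
  rewrite pmulr_rle0 // => le.
  have /eqP : \sum_i u 0 i ^+ 2 = 0.
    by apply/eqP; rewrite eq_le le sumr_ge0 // => i _; rewrite sqr_ge0.
  rewrite psumr_eq0; last by move=> i _; rewrite sqr_ge0.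
  move/allP => h; apply/rowP => i; rewrite mxE.
  by apply/eqP; rewrite -sqrf_eq0; apply: h; rewrite mem_index_enum.
exists (invmx H); split.
  move=> g delta i; rewrite -HE /delta.
  have /matrixP/(_ i 0) := mulKVmx Hu (\col_l g l).
  rewrite mxE [in RHS]mxE => <-; apply: eq_bigr => j _; rewrite mxE; congr (_ * _).
  by rewrite [in RHS]mxE; apply: eq_bigr => l _; rewrite [in RHS]mxE.
(* With w the i-th row of the inverse, coercivity reads c n |w|^2 <= w_i <= |w|, hence |w| <= 1 / (c
   n). *)
move=> i; have := pos (fun l => invmx H i l).
have -> : \sum_l invmx H i l * (\sum_j H l j * invmx H i j) = invmx H i i.
  transitivity (\sum_l invmx H i l * (i == l)%:R).
    apply: eq_bigr => l _; congr (_ * _); have /matrixP/(_ i l) := mulVmx Hu.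
    rewrite mxE [in RHS]mxE => <-; apply: eq_bigr => j _.
    by rewrite HT mulrC.
  rewrite (bigD1 i) //= eqxx mulr1 big1 ?addr0 //.
  by move=> j /negbTE; rewrite eq_sym => ->; rewrite mulr0.
set s := \sum_l _ => h.
have s0 : 0 <= s by apply: sumr_ge0 => l _; rewrite sqr_ge0.
have ws : invmx H i i ^+ 2 <= s.
  by rewrite /s (bigD1 i) //= lerDl sumr_ge0 // => l _; rewrite sqr_ge0.
have [sz|sn] := eqVneq s 0; first by rewrite sz sqr_ge0.
have sp : 0 < s by rewrite lt_neqAle eq_sym sn.
rewrite exprVn -[leRHS]mul1r ler_pdivlMr ?exprn_gt0 //.
have h2 : (c * n%:R * s) ^+ 2 <= s.
  apply: le_trans ws; rewrite ler_pXn2r ?nnegrE //; first by rewrite mulr_ge0 // ltW.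
  by apply: le_trans h; rewrite mulr_ge0 // ltW.
rewrite -(ler_pM2r sp) mul1r; apply: le_trans h2.
by rewrite le_eqVlt; apply/orP; left; apply/eqP; ring.
Qed.

(* With [x_i = exp (alpha_i)] and [S] the sum of the [x_j], the degree equations pin [x_i * S]
   between multiples of [n]; summing over [i] pins [S], hence every [x_i]. *)
Lemma degree_bound_alpha (R : realType) (n : nat) (G : 'M[R]_n) (al : 'I_n -> R) (M a b : R) :
  (0 < n)%N -> 0 < a -> 0 < b -> G^T = G -> (forall i j, `|G i j| <= M) ->
  (forall i, a * n%:R <= degree (fun p => expR (al p.1 + al p.2 + G p.1 p.2)) i <= b * n%:R) ->
  forall i, `|al i| <= `|ln (2 * b ^+ 2 * expR (3 * M) / a)| +
                       `|ln (a ^+ 2 / (4 * b * expR (3 * M)))|.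
Proof.
move=> n0 a0 b0 GT GM deg.
set S := \sum_j expR (al j).
have np : 0 < n%:R :> R by rewrite ltr0n.
have S0 : 0 < S.
  have i0 := Ordinal n0.
  rewrite /S (bigD1 i0) //= ltr_pwDl ?expR_gt0 // sumr_ge0 // => *; exact: expR_ge0.
have GTij i j : G i j = G j i by rewrite -{1}GT mxE.
have dE i : degree (fun p => expR (al p.1 + al p.2 + G p.1 p.2)) i =
    expR (al i) * \sum_j expR (al j) * (expR (G i j) * (1 + (i == j)%:R)).
  rewrite degree_sym /=; last by move=> u v; rewrite /= [al u + _]addrC GTij.
  by rewrite big_distrr /=; apply: eq_bigr => j _; rewrite !expRD; ring.
have e0 := expR_gt0 M.
have lo i : expR (al i) * S <= b * n%:R * expR M.
  have /andP[_] := deg i; rewrite dE => h.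
  rewrite -ler_pdivrMr // -expRN; apply: le_trans h.
  rewrite -mulrA ler_pM2l ?expR_gt0 // big_distrl /=.
  apply: ler_sum => j _; rewrite ler_pM2l ?expR_gt0 //.
  apply: (@le_trans _ _ (expR (G i j))).
    by rewrite ler_expR; have := GM i j; rewrite ler_norml => /andP[].
  by rewrite ler_peMr ?expR_ge0 // lerDl.
have hi i : a * n%:R <= 2 * expR M * (expR (al i) * S).
  have /andP[h _] := deg i; apply: le_trans h _; rewrite dE.
  rewrite mulrCA ler_pM2l ?expR_gt0 // big_distrr /=.
  apply: ler_sum => j _; rewrite mulrC ler_pM2r ?expR_gt0 //.
  rewrite [2 * _]mulrC; apply: ler_pM; rewrite ?expR_ge0 //.
  - by rewrite ler_expR; have := GM i j; rewrite ler_norml => /andP[].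
  - by case: eqP; rewrite ?mulr1n ?mulr0n; lra.
have slo : S * S <= b * n%:R * expR M * n%:R.
  rewrite {1}/S big_distrl /= [leRHS](_ : _ = \sum_(i < n) (b * n%:R * expR M)).
    by apply: ler_sum.
  by rewrite sumr_const card_ord mulr_natr.
have shi : a * n%:R * n%:R <= 2 * expR M * (S * S).
  rewrite {1}/S big_distrl /= big_distrr /=.
  rewrite [leLHS](_ : _ = \sum_(i < n) (a * n%:R)); first by apply: ler_sum.
  by rewrite sumr_const card_ord mulr_natr.
have e3 : expR (3 * M) = expR M ^+ 3 by rewrite -expRM_natl.
move=> i; set x := expR (al i).
have x0 : 0 < x by exact: expR_gt0.
have x2 : ln (x ^+ 2) = 2 * al i.
  by rewrite lnXn // expRK mulr_natl.
have loi := lo i; have hii := hi i; rewrite -/x in loi hii.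
have xS : 0 < x * S by rewrite mulr_gt0.
(* Squaring the bound on [x * S] gives two factors exp M, and dividing by the bound on [S * S] gives
   a third, whence [expR (3 * M)]. The lower bound [dn] is obtained in the same way. *)
have up : x ^+ 2 <= 2 * b ^+ 2 * expR (3 * M) / a.
  rewrite ler_pdivlMr // e3 -(ler_pM2r (x := n%:R ^+ 2)) ?exprn_gt0 //.
  have h1 : (x * S) * (x * S) <= (b * n%:R * expR M) * (b * n%:R * expR M).
    by apply: ler_pM => //; rewrite ltW.
  have h2 := ler_wpM2l (sqr_ge0 x) shi.
  have h3 := ler_wpM2l (ltW e0) h1.
  by rewrite !expr2 !exprS !expr0 in h2 h3 *; lra.
have dn : a ^+ 2 / (4 * b * expR (3 * M)) <= x ^+ 2.
  rewrite ler_pdivrMr; last by rewrite !mulr_gt0 ?expR_gt0.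
  rewrite e3 -(ler_pM2r (x := n%:R ^+ 2)) ?exprn_gt0 //.
  have h1 : (a * n%:R) * (a * n%:R) <= (2 * expR M * (x * S)) * (2 * expR M * (x * S)).
    by apply: ler_pM => //; rewrite mulr_ge0 // ltW.
  have h2 := ler_wpM2l (sqr_ge0 (expR M * x)) slo.
  by rewrite !expr2 !exprS !expr0 in h1 h2 *; lra.
have h1 : 2 * al i <= ln (2 * b ^+ 2 * expR (3 * M) / a).
  by rewrite -x2 ler_ln ?posrE ?exprn_gt0 // (lt_le_trans _ up) ?exprn_gt0.
have h2 : ln (a ^+ 2 / (4 * b * expR (3 * M))) <= 2 * al i.
  rewrite -x2 ler_ln ?posrE ?exprn_gt0 //.
  by rewrite divr_gt0 ?exprn_gt0 // !mulr_gt0 ?expR_gt0.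
have := ler_norm (ln (2 * b ^+ 2 * expR (3 * M) / a)).
have := normr_ge0 (ln (2 * b ^+ 2 * expR (3 * M) / a)).
have := ler_norm (- ln (a ^+ 2 / (4 * b * expR (3 * M)))).
have := normr_ge0 (ln (a ^+ 2 / (4 * b * expR (3 * M)))).
rewrite normrN ler_norml; move=> ? ? ? ?; apply/andP; split; lra.
Qed.

(** At h = D / E the hypothesis gives E <= K unless D = 0, and E = 2 (K + |D| + 1) exceeds K while
    keeping |h| <= 1/2. It turns a comparison of values into a first-order condition without
    derivatives. *)
Lemma zero_of_quadratic_bound (R : realFieldType) (D K : R) : 0 <= K ->
  (forall h, `|h| <= 2^-1 -> h * D <= h ^+ 2 * K) -> D = 0.
Proof.
move=> K0 H; apply/eqP; apply: contraT => Dn.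
have D0 : 0 < `|D| by rewrite normr_gt0.
pose E := 2 * (K + `|D| + 1).
have E0 : 0 < E by rewrite /E; lra.
have := H (D / E); rewrite normf_div (gtr0_norm E0) ler_pdivrMr //.
rewrite /E => /(_ ltac:(lra)); rewrite -/E.
have -> : D / E * D = `|D| ^+ 2 / E by rewrite real_normK ?num_real //; field; rewrite gt_eqF.
have -> : (D / E) ^+ 2 * K = `|D| ^+ 2 / E * (K / E).
  by rewrite real_normK ?num_real //; field; rewrite gt_eqF.
rewrite -[leLHS]mulr1 ler_pM2l; last by rewrite divr_gt0 // exprn_gt0.
by rewrite ler_pdivlMr // mul1r /E; lra.
Qed.

(** By [expR_le_quad] a step h in one node parameter changes the sum by h times the difference of
    degrees, up to h^2 K. The bound |h| <= 1/2 keeps [h * inc R i p] at most 1, and 8 is 2 times the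
    square of the largest incidence. *)
Lemma likelihood_stationary (R : realType) (n : nat) (a th : 'I_n * 'I_n -> R) (i : 'I_n) :
  (forall h : R, \sum_(p | upper p) (a p * (th p + h * inc R i p) - expR (th p + h * inc R i p)) <=
     \sum_(p | upper p) (a p * th p - expR (th p))) ->
  degree a i = degree (fun p => expR (th p)) i.
Proof.
move=> H; apply/eqP; rewrite -subr_eq0; apply/eqP.
pose K := \sum_(p | @upper n p) 8 * expR (th p).
apply: (@zero_of_quadratic_bound _ _ K).
  by apply: sumr_ge0 => p _; rewrite mulr_ge0 ?expR_ge0.
move=> h h2; rewrite /degree -sumrB !big_distrr /=.
have Hh := H h; rewrite -subr_ge0 -sumrB in Hh.
rewrite -subr_ge0 -sumrB; apply: le_trans Hh _; apply: ler_sum => p _.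
have hc : h * inc R i p <= 1.
  have := inc_le2 R i p; have := inc_ge0 R i p; move: (inc R i p) => c c0 c2.
  apply: le_trans (ler_norm _) _; rewrite normrM (ger0_norm c0).
  have -> : 1 = 2^-1 * 2 :> R by rewrite mulVf.
  by apply: ler_pM.
have := expR_le_quad hc; rewrite expRD.
have c4 : h ^+ 2 * inc R i p ^+ 2 <= h ^+ 2 * 4.
  rewrite ler_wpM2l ?sqr_ge0 //.
  have -> : 4 = 2 ^+ 2 :> R by rewrite expr2; ring.
  by rewrite ler_pXn2r ?nnegrE ?inc_ge0 ?inc_le2.
move: c4; have := expR_gt0 (th p); move: (expR (th p)) (expR (h * _)) => e f e0 c4 le.
have := ler_wpM2l (ltW e0) le; have := ler_wpM2l (ltW e0) c4.
by rewrite exprMn; lra.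
Qed.

(** * Existence of the estimator *)

Lemma loglik_upper (R : realType) (n T : nat) (a : counts n T) (G : 'M[R]_n)
    (al : 'M[R]_(n, T)) :
  loglik a G al = \sum_t \sum_(p | upper p) ((a t p.1 p.2)%:R * log_mean G al t p.1 p.2 -
     expR (log_mean G al t p.1 p.2)).
Proof. by apply: eq_bigr => t _; rewrite sum_upper. Qed.

Lemma expR_ge_sqr (R : realType) (x : R) : 0 <= x -> x ^+ 2 / 4 <= expR x.
Proof.
move=> x0; have -> : expR x = expR (x / 2) ^+ 2.
  by rewrite -expRM_natl; congr expR; field.
have -> : x ^+ 2 / 4 = (x / 2) ^+ 2 by field.
rewrite ler_pXn2r ?nnegrE ?expR_ge0 ?divr_ge0 //.
by apply: le_trans (expR_ge1Dx _); lra.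
Qed.

Lemma poisson_term_le (R : realType) (a x : R) : 0 <= a -> a * x - expR x <= a ^+ 2.
Proof.
move=> a0; have [x0|x0] := leP x 0.
  have := expR_ge0 x; have := sqr_ge0 a; have : a * x <= 0 by rewrite mulr_ge0_le0.
  by lra.
have := expR_ge_sqr (ltW x0); have : 0 <= (a - x / 2) ^+ 2 by rewrite sqr_ge0.
by rewrite !expr2; lra.
Qed.

Lemma poisson_term_level (R : realType) (a x A : R) : 0 <= a -> a ^+ 2 <= A ->
  - A <= a * x - expR x -> x <= 24 * A + 1.
Proof.
move=> a0 aA le; have [//|x0] := leP x (24 * A + 1).
have A0 : 0 <= A by apply: le_trans aA; rewrite sqr_ge0.
have x1 : 1 <= x by lra.
have h1 := expR_ge_sqr (le_trans ler01 x1).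
have h2 : 0 <= (2 * a - x / 2) ^+ 2 by rewrite sqr_ge0.
have h3 : 0 <= x * (x - 1) by rewrite mulr_ge0; lra.
rewrite !expr2 in h1 h2 aA; lra.
Qed.

(** Every summand is at most the square of its count, so a total above the value at 0 forces each
    single summand above [- A]. The diagonal summand then bounds each [al i t] from above; a
    positive count on a pair containing i bounds the sum of its two parameters from below, and so
    [al i t] from below. *)
Lemma coercive (R : realType) (n T : nat) (a : counts n T) (M : R) :
  (forall t i, 0 < degree (fun p => (a t p.1 p.2)%:R : R) i) ->
  exists B : R, 0 <= B /\ forall (G : 'M[R]_n) (al : 'M[R]_(n, T)),
    (forall i j, `|G i j| <= M) -> loglik a 0 0 <= loglik a G al ->
    forall i t, `|al i t| <= B.
Proof.
move=> deg.
(* In each summand the 1 is the loss [expR 0] at the origin and the square is the upper bound of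
   [poisson_term_le]. *)
pose A : R := \sum_t \sum_(p | @upper n p) (1 + (a t p.1 p.2)%:R ^+ 2).
have A0 : 0 <= A.
  by apply: sumr_ge0 => t _; apply: sumr_ge0 => p _; rewrite addr_ge0 ?sqr_ge0.
have aA t p : upper p -> (a t p.1 p.2)%:R ^+ 2 <= A.
  move=> up; rewrite /A (bigD1 t) //= (bigD1 p) //=.
  rewrite -!addrA addrCA lerDl addr_ge0 // addr_ge0 //.
    by apply: sumr_ge0 => q _; rewrite addr_ge0 ?sqr_ge0.
  by apply: sumr_ge0 => s _; apply: sumr_ge0 => q _; rewrite addr_ge0 ?sqr_ge0.
exists (A + (24 * A + 1) + 2 * `|M|); split; first by rewrite !addr_ge0 ?mulr_ge0.
move=> G al GM; rewrite !loglik_upper => le.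
have term t p : upper p -> - A <= (a t p.1 p.2)%:R * log_mean G al t p.1 p.2 -
     expR (log_mean G al t p.1 p.2).
  move=> up; set f := fun t p => (a t p.1 p.2)%:R * log_mean G al t p.1 p.2 -
     expR (log_mean G al t p.1 p.2).
  have h : \sum_s \sum_(q | upper q) (- 1 - (a s q.1 q.2)%:R ^+ 2) <=
      \sum_s \sum_(q | upper q) (f s q - (a s q.1 q.2)%:R ^+ 2).
    rewrite -subr_ge0 -sumrB.
    move: le; rewrite -subr_ge0 -sumrB => /le_trans; apply.
    apply: ler_sum => s _; rewrite -!sumrB; apply: ler_sum => q _.
    by rewrite /log_mean !mxE !addr0 mulr0 expR0 /f /log_mean; lra.
  have -> : - A = \sum_s \sum_(q | upper q) (- 1 - (a s q.1 q.2)%:R ^+ 2).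
    rewrite /A -sumrN; apply: eq_bigr => s _; rewrite -sumrN; apply: eq_bigr => q _.
    by rewrite opprD.
  apply: le_trans h _; rewrite (bigD1 t) //= (bigD1 p) //=.
  have neg s q : f s q - (a s q.1 q.2)%:R ^+ 2 <= 0.
    by rewrite subr_le0 poisson_term_le.
  have h1 : \sum_(q | upper q && (q != p)) (f t q - (a t q.1 q.2)%:R ^+ 2) <= 0.
    by apply: sumr_le0 => q _.
  have h2 : \sum_(s | s != t) \sum_(q | upper q) (f s q - (a s q.1 q.2)%:R ^+ 2) <= 0.
    by apply: sumr_le0 => s _; apply: sumr_le0 => q _.
  by have := sqr_ge0 ((a t p.1 p.2)%:R : R); rewrite -/(f t p); lra.
have GM' i j : - `|M| <= G i j <= `|M|.
  by rewrite -ler_norml (le_trans (GM i j)) ?ler_norm.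
have up i t : al i t <= (24 * A + 1 + `|M|) / 2.
  have ii : upper (i, i) by rewrite /upper.
  have := poisson_term_level (ler0n _ _) (aA t (i, i) ii) (term t (i, i) ii).
  by rewrite /log_mean /=; have := GM' i i; lra.
move=> i t; rewrite ler_norml; apply/andP; split; last first.
  by have := up i t; have := normr_ge0 M; lra.
have [p [pu p1 p2]] : exists p, [/\ upper p, (0 < a t p.1 p.2)%N & (p.1 == i) || (p.2 == i)].
  apply: contrapT => H; have := deg t i; rewrite /degree big1 ?ltxx // => p pu.
  have [e|e] := posnP (a t p.1 p.2); first by rewrite e mul0r.
  have [e2|] := boolP ((p.1 == i) || (p.2 == i)); first by case: H; exists p.
  by rewrite negb_or /inc => /andP[/negbTE -> /negbTE ->]; rewrite addr0 mulr0.
have := term t p pu; have a1 : 1 <= (a t p.1 p.2)%:R :> R by rewrite ler1n.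
set x := log_mean _ _ _ _ _ => le2.
have xl : - A <= x.
  have [x0|x0] := leP 0 x; first lra.
  have := expR_ge0 x; have : (a t p.1 p.2)%:R * x <= x.
    by rewrite ger_nMl.
  by lra.
have := GM' p.1 p.2; rewrite /x /log_mean in xl; have := normr_ge0 M.
case/orP: p2 xl => /eqP ->; first by have := up p.2 t; lra.
by have := up p.1 t; lra.
Qed.

Lemma closed_nonneg (R : realType) (V : topologicalType) (f : V -> R) :
  continuous f -> closed [set v | 0 <= f v].
Proof.
move=> cf; rewrite (_ : [set v | 0 <= f v] = f @^-1` [set x | 0 <= x]) //.
by apply: preimage_closed => //; exact: closed_ge.
Qed.

Lemma continuous_bigsum (R : realType) (V : topologicalType) (I : finType) (P : pred I)
    (f : I -> V -> R) :
  (forall i, continuous (f i)) -> continuous (fun v => \sum_(i | P i) f i v).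
Proof.
move=> cf; elim: (index_enum I) => [|i r IH].
  rewrite (_ : (fun v => _) = fun=> 0); first exact: cst_continuous.
  by apply/funext => u; rewrite big_nil.
rewrite (_ : (fun v => _) =
    fun v => (if P i then f i v else 0) + \sum_(i <- r | P i) f i v).
  move=> v; apply: (continuousD _ (IH v)); case: (P i); first exact: cf.
  exact: cst_continuous.
by apply/funext => u; rewrite big_cons; case: (P i); rewrite ?add0r.
Qed.

Lemma closed_feasible (R : realType) (V : topologicalType) (n : nat) (M : R)
    (G : V -> 'M[R]_n) :
  (forall i j, continuous (fun v => G v i j)) -> closed [set v | feasible M (G v)].
Proof.
move=> cG.
have cG1 i : continuous (fun v : V => (G v *m ones R n) i 0).
  rewrite (_ : (fun v => _) = fun v => \sum_j G v i j * ones R n j 0); last first.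
    by apply/funext => v; rewrite mxE.
  apply: continuous_bigsum => j v; apply: (continuousM (cG i j v)).
  exact: cst_continuous.
have c1 i j : closed [set v | 0 <= G v i j - G v j i].
  by apply: closed_nonneg => v; exact: (continuousB (cG i j v) (cG j i v)).
have c2 (x : 'cV[R]_n) : closed [set v | 0 <= (x^T *m G v *m x) 0 0].
  apply: closed_nonneg.
  rewrite (_ : (fun v => _) = fun v => \sum_i (\sum_j x^T 0 j * G v j i) * x i 0); last first.
    by apply/funext => v; rewrite mxE; apply: eq_bigr => i _; rewrite mxE.
  apply: continuous_bigsum => i v; apply: continuousM; last exact: cst_continuous.
  apply: (@continuous_bigsum R V) => j u; apply: (continuousM _ (cG j i u)).
  exact: cst_continuous.
have c3 i : closed [set v | 0 <= (G v *m ones R n) i 0] by apply: closed_nonneg; exact: cG1.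
have c4 i : closed [set v | 0 <= - (G v *m ones R n) i 0].
  by apply: closed_nonneg => v; exact: (continuousN (cG1 i v)).
have c5 i j : closed [set v | 0 <= M - `|G v i j|].
  have cM : continuous (fun _ : V => M) by exact: cst_continuous.
  apply: closed_nonneg => v; apply: (continuousD (cM v)); apply: continuousN.
  apply: (continuous_comp (cG i j v)); exact: norm_continuous.
rewrite (_ : [set v | _] = (\bigcap_i \bigcap_j [set v | 0 <= G v i j - G v j i]) `&`
  (\bigcap_(x in [set: 'cV[R]_n]) [set v | 0 <= (x^T *m G v *m x) 0 0]) `&`
  (\bigcap_i [set v | 0 <= (G v *m ones R n) i 0]) `&`
  (\bigcap_i [set v | 0 <= - (G v *m ones R n) i 0]) `&`
  (\bigcap_i \bigcap_j [set v | 0 <= M - `|G v i j|])).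
  by do !apply: closedI; do !(apply: closed_bigI => ? _).
apply/seteqP; split => v /=.
  move=> [[Gs Gp] G1 GM]; do !split => //.
  - by move=> i _ j _ /=; rewrite -[in X in X - _]Gs mxE subrr.
  - by move=> x _; exact: Gp.
  - by move=> i _ /=; rewrite G1 mxE.
  - by move=> i _ /=; rewrite G1 mxE oppr0.
  - by move=> i _ j _ /=; rewrite subr_ge0.
move=> [[[[H1 H2] H3] H4] H5]; split; first split.
- apply/matrixP => i j; rewrite mxE; apply/eqP; rewrite eq_le -subr_ge0 (H1 i I j I).
  by rewrite -subr_ge0 (H1 j I i I).
- by move=> x; exact: (H2 x I).
- apply/matrixP => i j; rewrite ord1 [RHS]mxE; apply/eqP; rewrite eq_le.
  by rewrite -oppr_ge0 (H4 i I) (H3 i I).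
- by move=> i j; rewrite -subr_ge0; exact: (H5 i I j I).
Qed.

(** Competitors at least as good as the origin lie in a compact box by [coercive]; those below it
    are beaten by the maximiser over the box, which contains the origin. *)
Lemma solution_exists (R : realType) (n T : nat) (a : counts n T) (M lam : R) :
  0 <= M -> 0 <= lam ->
  (forall t i, 0 < degree (fun p => (a t p.1 p.2)%:R : R) i) ->
  exists (G : 'M[R]_n) (al : 'M[R]_(n, T)), is_solution M lam a G al.
Proof.
move=> M0 l0 deg; have [B [B0 HB]] := coercive M deg.
pose V := 'rV[R]_(n * n + n * T).
pose G (v : V) : 'M[R]_n := vec_mx (lsubmx v).
pose al (v : V) : 'M[R]_(n, T) := vec_mx (rsubmx v).
have cG i j : continuous (fun v : V => G v i j).
  move=> v; rewrite (_ : (fun v : V => G v i j) = fun v : V => v ord0 (lshift _ (mxvec_index i j))).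
    exact: coord_continuous.
  by apply/funext => u; rewrite !mxE.
have cal i t : continuous (fun v : V => al v i t).
  move=> v; rewrite (_ : (fun v : V => al v i t) = fun v : V => v ord0 (rshift _ (mxvec_index i t))).
    exact: coord_continuous.
  by apply/funext => u; rewrite !mxE.
have ccst (r : R) : continuous (fun v : V => r) by move=> v; exact: (@cst_continuous V R r v).
have cmul (f g : V -> R) : continuous f -> continuous g -> continuous (fun v => f v * g v).
  by move=> cf cg v; exact: (continuousM (cf v) (cg v)).
have cadd (f g : V -> R) : continuous f -> continuous g -> continuous (fun v => f v + g v).
  by move=> cf cg v; exact: (continuousD (cf v) (cg v)).
have csum := @continuous_bigsum R V.
have copp (f : V -> R) : continuous f -> continuous (fun v => - f v).
  by move=> cf v; exact: (continuousN (cf v)).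
have cexp (f : V -> R) : continuous f -> continuous (fun v => expR (f v)).
  by move=> cf v; apply: continuous_comp; [exact: cf|exact: continuous_expR].
(* The trace agrees with the nuclear norm on the feasible set and is evidently continuous. *)
pose f (v : V) := loglik a (G v) (al v) - lam * \tr (G v).
have cf : continuous f.
  apply: (cadd); last by apply: (copp); apply: (cmul) => //; apply: (csum) => i; exact: cG.
  rewrite /loglik; do 3 (apply: (csum) => ?).
  have cm t i j : continuous (fun v : V => log_mean (G v) (al v) t i j).
    by apply: (cadd); [apply: (cadd); exact: cal|exact: cG].
  by apply: (cadd); [apply: (cmul) => //|apply: (copp); apply: (cexp)].
pose box := [set v : V | forall i, `[- B - M, B + M]%classic (v ord0 i)].
pose F := [set v : V | feasible M (G v)].
have cbox : compact box.
  apply: (@rV_compact _ _ (fun=> `[- B - M, B + M]%classic)) => _; exact: segment_compact.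
have clF : closed F by exact: closed_feasible.
have feas0 : feasible M (0 : 'M[R]_n).
  split; first split; rewrite ?trmx0 ?mul0mx //.
    by move=> x; rewrite mulmx0 mul0mx mxE.
  by move=> i j; rewrite mxE normr0.
have G0 : G 0 = 0 by rewrite /G linear0 linear0.
have al0 : al 0 = 0 by rewrite /al linear0 linear0.
have K0 : (box `&` F) 0.
  split; last by rewrite /F /= G0.
  by move=> i /=; rewrite in_itv /= mxE; apply/andP; split; lra.
have cK : compact (box `&` F).
  apply: (subclosed_compact _ cbox); last exact: subIsetl.
  by apply: closedI => //; apply: compact_closed => //; exact: norm_hausdorff.
have [c cK' cmax] := @EVT_max_rV R _ f (box `&` F) (ex_intro _ 0 K0) cK
   (continuous_subspaceT cf).
have {cK'} [cb cF] : (box `&` F) c by rewrite inE in cK'.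
have objE v : F v -> objective lam a (G v) (al v) = f v.
  by case=> psd _ _; rewrite /objective nuclear_norm_psd.
exists (G c), (al c); split => // G' al' fG'; rewrite objE //.
have [psd _ GM'] := fG'.
have f0 : f 0 <= f c by apply: cmax; rewrite inE.
have obj0 : f 0 = loglik a 0 0 by rewrite /f G0 al0 linear0 mulr0 subr0.
have [lt|le] := ltP (objective lam a G' al') (f 0).
  by apply: ltW; apply: lt_le_trans f0.
have trG : 0 <= \tr G'.
  have [B' ->] := psd_gram psd.1 psd.2; rewrite mxtrace_mulC.
  rewrite /mxtrace; apply: sumr_ge0 => i _; rewrite mxE; apply: sumr_ge0 => j _.
  by rewrite mxE -expr2 sqr_ge0.
have alB : forall i t, `|al' i t| <= B.
  apply: (HB G') => //; rewrite -obj0; apply: le_trans le _.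
  by rewrite /objective nuclear_norm_psd // gerBl mulr_ge0.
pose v : V := row_mx (mxvec G') (mxvec al').
have Gv : G v = G' by rewrite /G row_mxKl mxvecK.
have alv : al v = al' by rewrite /al row_mxKr mxvecK.
have vF : F v by rewrite /F /= Gv.
rewrite -[G']Gv -[al']alv objE //; apply: cmax; rewrite inE; split => //.
move=> i /=; rewrite in_itv /= /v; have [j ->|j ->] := split_ordP i.
  rewrite row_mxEl; case/mxvec_indexP: j => r q.
  by rewrite mxvecE; have := GM' r q; rewrite ler_norml; lra.
rewrite row_mxEr; case/mxvec_indexP: j => r q.
by rewrite mxvecE; have := alB r q; rewrite ler_norml; lra.
Qed.

(** * The deterministic inequality *)

(** For x >= -2 squaring 1 + x/2 <= exp (x/2) gives curvature 1/4. Below -2 the left side is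
    negative, because |x| <= B bounds its quadratic term by -x/4. The modulus thus decays only like
    1 / B. *)
Lemma expR_ge_quad (R : realType) (B x : R) :
  1 <= B -> `|x| <= B -> 1 + x + x ^+ 2 / (4 * B) <= expR x.
Proof.
move=> B1 xB; have B0 : 0 < B by lra.
have [x2|x2] := leP (-2) x.
  apply: (@le_trans _ _ ((1 + x / 2) ^+ 2)).
    have -> : (1 + x / 2) ^+ 2 = 1 + x + x ^+ 2 / 4 by field.
    rewrite lerD2l ler_wpM2l ?sqr_ge0 // lef_pV2 ?posrE ?mulr_gt0 //; lra.
  have -> : expR x = expR (x / 2) ^+ 2 by rewrite -expRM_natl; congr expR; field.
  by rewrite ler_pXn2r ?nnegrE ?expR_ge0 ?expR_ge1Dx //; lra.
have xb : x ^+ 2 / (4 * B) <= - x / 4.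
  rewrite ler_pdivrMr ?mulr_gt0 //.
  have : 0 <= (- x) * (B + x).
    by rewrite mulr_ge0 //; move: xB; rewrite ler_norml; lra.
  by rewrite expr2; lra.
by have := expR_ge0 x; lra.
Qed.

Lemma poisson_term_concave (R : realType) (a x y e0 B : R) :
  0 < e0 -> e0 <= expR x -> 1 <= B -> `|y| <= B ->
  (a * (x + y) - expR (x + y)) - (a * x - expR x) <=
    (a - expR x) * y - e0 / (4 * B) * y ^+ 2.
Proof.
move=> e00 le1 B1 yB; have le2 := expR_ge_quad B1 yB; rewrite expRD.
move: (expR x) (expR y) le1 le2 => u v le1 le2.
have h1 := ler_wpM2l (le_trans (ltW e00) le1) le2.
have h2 : e0 * (y ^+ 2 / (4 * B)) <= u * (y ^+ 2 / (4 * B)).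
  by rewrite ler_wpM2r // divr_ge0 ?sqr_ge0 //; lra.
have -> : e0 / (4 * B) * y ^+ 2 = e0 * (y ^+ 2 / (4 * B)) by ring.
by lra.
Qed.

Lemma exp_remainder_sqr_le (R : realType) (m y d : R) :
  0 <= m -> m <= 1 -> `|y| <= 2 * d -> d <= 2^-1 ->
  (m * expR y - m - m * y) ^+ 2 <= 64 * d ^+ 4.
Proof.
move=> m0 m1 yd d1.
have y1 : y <= 1 by apply: le_trans (ler_norm _) _; lra.
have q1 := expR_ge1Dx y; have q2 := expR_le_quad y1.
have d0 : 0 <= 2 * d by apply: le_trans yd.
have yy : y ^+ 2 <= 4 * d ^+ 2.
  have -> : 4 * d ^+ 2 = (2 * d) ^+ 2 by ring.
  by rewrite -(real_normK (num_real y)) ler_pXn2r ?nnegrE.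
have -> : m * expR y - m - m * y = m * (expR y - 1 - y) by ring.
have r0 : 0 <= m * (expR y - 1 - y) by rewrite mulr_ge0 //; lra.
have r1 : m * (expR y - 1 - y) <= 8 * d ^+ 2.
  apply: (@le_trans _ _ (1 * (expR y - 1 - y))); last lra.
  by rewrite ler_wpM2r //; lra.
have -> : 64 * d ^+ 4 = (8 * d ^+ 2) ^+ 2 by ring.
by rewrite ler_pXn2r ?nnegrE // mulr_ge0 ?sqr_ge0.
Qed.

(* A matrix with zero row and column sums is orthogonal to every matrix [v_i + v_j]. *)
Lemma centered_edge_norm (R : realType) (n : nat) (D : 'M[R]_n) (v : 'I_n -> R) :
  D^T = D -> D *m ones R n = 0 ->
  frobenius_norm D ^+ 2 <= 2 * \sum_(p | upper p) (D p.1 p.2 + v p.1 + v p.2) ^+ 2.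
Proof.
move=> DT D1.
have Dij i j : D i j = D j i by rewrite -{1}DT mxE.
have row0 i : \sum_j D i j = 0.
  have /matrixP/(_ i 0) := D1; rewrite mxE [RHS]mxE => h; rewrite -[RHS]h.
  by apply: eq_bigr => j _; rewrite mxE mulr1.
apply: le_trans (_ : _ <= \sum_p (D p.1 p.2 + v p.1 + v p.2) ^+ 2) _; last first.
  apply: sum_le_upper => [p|i j] /=; first exact: sqr_ge0.
  by rewrite Dij addrAC.
rewrite frobenius_norm_sqr mxtrace_mulT.
rewrite -(pair_bigA _ (fun i j => (D i j + v i + v j) ^+ 2)) /=.
have -> : \sum_i \sum_j (D i j + v i + v j) ^+ 2 =
    \sum_i \sum_j D i j * D i j + \sum_i \sum_j (v i + v j) ^+ 2 +
    2 * (\sum_i \sum_j D i j * v i) + 2 * (\sum_i \sum_j D i j * v j).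
  rewrite !big_distrr /= -!big_split /=; apply: eq_bigr => i _.
  by rewrite !big_distrr /= -!big_split /=; apply: eq_bigr => j _; ring.
have -> : \sum_i \sum_j D i j * v i = 0.
  by rewrite big1 // => i _; rewrite -big_distrl /= row0 mul0r.
have -> : \sum_i \sum_j D i j * v j = 0.
  rewrite exchange_big big1 // => j _; rewrite -big_distrl /=.
  by rewrite (eq_bigr (D j)) // row0 mul0r.
rewrite !mulr0 !addr0 lerDl; apply: sumr_ge0 => i _; apply: sumr_ge0 => j _.
exact: sqr_ge0.
Qed.

(** The basic inequality from optimality against the shifted truth ([Gs], [al']). [dl] bounds the
    Newton step and [w] the entries of the correction that is linear in the noise. *)
Lemma deterministic_bound (R : realType) (k n T : nat) (M lam e0 B dl w : R)
    (Z : 'M[R]_(n, k)) (al al' : 'M[R]_(n, T)) (a : counts n T)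
    (Gh : 'M[R]_n) (ah : 'M[R]_(n, T)) (delta : 'I_T -> 'I_n -> R)
    (mu e x : 'I_T -> 'I_n * 'I_n -> R) :
  let Gs := Z *m Z^T in let D := Gh - Gs in let kap := e0 / (4 * B) in
  (forall t p, mu t p = expR (log_mean Gs al t p.1 p.2)) ->
  (forall t p, e t p = (a t p.1 p.2)%:R - mu t p) ->
  (forall t p, x t p = delta t p.1 + delta t p.2) ->
  (forall i t, al' i t = al i t + delta t i) ->
  0 <= lam -> 0 < e0 -> 1 <= B -> 0 <= w ->
  feasible M Gs -> \det (Z^T *m Z) != 0 -> is_solution M lam a Gh ah ->
  (forall t p, mu t p <= 1) ->
  (forall t i, degree (fun p => mu t p * x t p) i = degree (e t) i) ->
  (forall t i, `|delta t i| <= dl) -> dl <= 2^-1 ->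
  (forall p, `|\sum_t mu t p * x t p| <= w) ->
  opnorm_le (\matrix_(i, j) if (i <= j)%N then \sum_t e t (i, j) else 0) lam ->
  (forall t i j, e0 <= expR (log_mean Gs al' t i j)) ->
  (forall t i j, `|log_mean Gh ah t i j - log_mean Gs al' t i j| <= B) ->
  (kap / 4 * T%:R * frobenius_norm D ^+ 2 <=
    (3 * lam * Num.sqrt k%:R + n%:R * w) * frobenius_norm D +
    32 / kap * T%:R * n%:R ^+ 2 * dl ^+ 4)%R.
Proof.
move=> Gs D kap muE eE xE al'E l0 e00 B1 w0 fGs dZ [fGh opt] mu1 newton dlt dl1 wb op ge0 leB.
have B0 : 0 < B by lra.
have kap0 : 0 < kap by rewrite divr_gt0 // mulr_gt0.
pose th t (p : 'I_n * 'I_n) := log_mean Gs al' t p.1 p.2.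
pose De t (p : 'I_n * 'I_n) := log_mean Gh ah t p.1 p.2 - th t p.
pose eta t i := ah i t - al' i t.
have DeE t p : De t p = D p.1 p.2 + (eta t p.1 + eta t p.2).
  have -> : D p.1 p.2 = Gh p.1 p.2 - Gs p.1 p.2 by rewrite !mxE.
  by rewrite /De /th /log_mean /eta; ring.
pose N2 : R := \sum_t \sum_(p | upper p) De t p ^+ 2.
pose X : R := \sum_t \sum_(p | upper p) ((a t p.1 p.2)%:R - expR (th t p)) * De t p.
have h1 : 0 <= X - kap * N2 - lam * \tr D.
  have := opt Gs al' fGs; rewrite /objective !nuclear_norm_psd; try by case: fGs; try by case: fGh.
  rewrite !loglik_upper => le.
  have : \sum_t \sum_(p | upper p) ((a t p.1 p.2)%:R * log_mean Gh ah t p.1 p.2 -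
        expR (log_mean Gh ah t p.1 p.2)) -
      \sum_t \sum_(p | upper p) ((a t p.1 p.2)%:R * th t p - expR (th t p)) <= X - kap * N2.
    rewrite /X /N2 big_distrr /= -!sumrB; apply: ler_sum => t _.
    rewrite big_distrr /= -!sumrB; apply: ler_sum => p _.
    have -> : log_mean Gh ah t p.1 p.2 = th t p + De t p by rewrite /De addrC subrK.
    by apply: poisson_term_concave => //; [exact: ge0|exact: leB].
  have -> : \tr D = \tr Gh - \tr Gs by rewrite /D raddfB.
  by move: le; rewrite /th; clear; move: (\sum_t _) (\sum_t _) (\tr _) (\tr _) X N2 => *; lra.
(* The second-order Taylor remainder of the mean under the Newton shift. *)
pose rho t p := expR (th t p) - mu t p - mu t p * x t p.
pose P : R := \sum_t \sum_(p | upper p) rho t p * De t p.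
pose W p := \sum_t mu t p * x t p.
pose U : 'M[R]_n := \matrix_(i, j) if (i <= j)%N then \sum_t e t (i, j) else 0.
(* The residual at the shifted point is [e - mu * x - rho]. Its part [e - mu * x] has zero degrees
   by the Newton equation, so it pairs with [D] only and [eta] disappears; [rho] keeps the full
   difference [De]. *)
have h2 : X = \tr (U^T *m D) - \sum_(p | upper p) W p * D p.1 p.2 - P.
  have z t : \sum_(p | upper p) (e t p - mu t p * x t p) * (eta t p.1 + eta t p.2) = 0.
    rewrite sum_upper_degree big1 // => i _.
    have -> : degree (fun p => e t p - mu t p * x t p) i =
        degree (e t) i - degree (fun p => mu t p * x t p) i.
      by rewrite /degree -sumrB; apply: eq_bigr => p _; rewrite mulrBl.
    by rewrite newton subrr mulr0.
  have -> : \tr (U^T *m D) = \sum_(p | upper p) (\sum_t e t p) * D p.1 p.2.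
    transitivity (\sum_(i < n) \sum_(j < n | (i <= j)%N) (\sum_t e t (i, j)) * D i j).
      2: by rewrite sum_upper; apply: eq_bigr => -[].
    rewrite -[D in LHS]trmxK mxtrace_mulT exchange_big /=.
    apply: eq_bigr => i _; rewrite [RHS]big_mkcond /=; apply: eq_bigr => j _.
    have trE (V : 'M[R]_n) : V^T j i = V i j by rewrite mxE.
    by rewrite !trE [U _ _]mxE; case: ifP => // _; rewrite mul0r.
  transitivity (\sum_t (\sum_(p | upper p) e t p * D p.1 p.2 -
      \sum_(p | upper p) mu t p * x t p * D p.1 p.2 +
      \sum_(p | upper p) (e t p - mu t p * x t p) * (eta t p.1 + eta t p.2) -
      \sum_(p | upper p) rho t p * De t p)).
    apply: eq_bigr => t _; rewrite -sumrB -big_split /= -sumrB; apply: eq_bigr => p _.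
    by rewrite DeE /rho eE; ring.
  rewrite sumrB big_split /= [X in _ + X - _]big1 ?addr0 // sumrB.
  congr (_ - _ - _).
    by rewrite exchange_big /=; apply: eq_bigr => p _; rewrite big_distrl.
  by rewrite exchange_big /=; apply: eq_bigr => p _; rewrite big_distrl.
have h3 : \tr (U^T *m D) - lam * \tr D <= 3 * lam * Num.sqrt k%:R * frobenius_norm D.
  by apply: penalized_noise_le => //; case: fGh.
have d0 : 0 <= frobenius_norm D by exact: sqrtr_ge0.
have up_d : \sum_(p | upper p) D p.1 p.2 ^+ 2 <= frobenius_norm D ^+ 2.
  rewrite frobenius_norm_sqr mxtrace_mulT pair_bigA /=.
  by apply: sum_upper_le => p; exact: sqr_ge0.
have h4 : - \sum_(p | upper p) W p * D p.1 p.2 <= n%:R * w * frobenius_norm D.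
  apply: le_trans (ler_norm _) _; rewrite normrN.
  rewrite -(@ler_pXn2r _ 2) ?nnegrE ?mulr_ge0 // real_normK ?num_real // exprMn.
  apply: le_trans (cauchy_schwarz_sum _ _ _) _.
  apply: ler_pM => //; try by apply: sumr_ge0 => p _; exact: sqr_ge0.
  apply: le_trans (sum_upper_le (F := fun p => W p ^+ 2) (fun p => sqr_ge0 _)) _.
  apply: (@le_trans _ _ (\sum_(p : 'I_n * 'I_n) w ^+ 2)).
    apply: ler_sum => p _; rewrite -(real_normK (num_real (W p))).
    by rewrite ler_pXn2r ?nnegrE // wb.
  rewrite sumr_const cardE -cardT card_prod card_ord -[_ *+ _]mulr_natl natrM.
  by rewrite le_eqVlt; apply/orP; left; apply/eqP; ring.
pose Q : R := \sum_t \sum_(p | @upper n p) rho t p ^+ 2.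
(* Young's inequality spends half of the curvature on the remainder. The surviving half loses
   another factor 2 in [h7], which leaves the [kap / 4] of the conclusion. *)
have h5 : - P <= kap / 2 * N2 + Q / (2 * kap).
  rewrite /P /N2 /Q -sumrN big_distrr big_distrl /= -big_split /=.
  apply: ler_sum => t _; rewrite -sumrN big_distrr big_distrl /= -big_split /=.
  apply: ler_sum => p _; move: (rho t p) (De t p) => r y.
  have h : 0 <= (kap * y + r) ^+ 2 / (2 * kap).
    by rewrite divr_ge0 ?sqr_ge0 // mulr_ge0 // ltW.
  rewrite -subr_ge0; move: h; congr (0 <= _); field; exact: lt0r_neq0.
have rho4 t p : rho t p ^+ 2 <= 64 * dl ^+ 4.
  have -> : rho t p = mu t p * expR (x t p) - mu t p - mu t p * x t p.
    congr (_ - _ - _); rewrite {1}muE -expRD /th /log_mean !al'E xE; congr expR; ring.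
  apply: exp_remainder_sqr_le => //; first by rewrite muE expR_ge0.
  by rewrite xE mulr_natl mulr2n (le_trans (ler_normD _ _)) // lerD.
have h6 : Q <= T%:R * (n%:R ^+ 2 * (64 * dl ^+ 4)).
  apply: (@le_trans _ _ (\sum_(t < T) (n%:R ^+ 2 * (64 * dl ^+ 4)))); last first.
    by rewrite sumr_const card_ord -[leLHS]mulr_natl.
  apply: ler_sum => t _.
  apply: le_trans (sum_upper_le (F := fun p => rho t p ^+ 2) (fun p => sqr_ge0 _)) _.
  apply: (@le_trans _ _ (\sum_(p : 'I_n * 'I_n) (64 * dl ^+ 4))).
    by apply: ler_sum => p _; exact: rho4.
  by rewrite sumr_const cardE -cardT card_prod card_ord -[_ *+ (_ * _)]mulr_natl natrM expr2.
have h7 : T%:R * frobenius_norm D ^+ 2 <= 2 * N2.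
  have -> : T%:R * frobenius_norm D ^+ 2 = \sum_(t < T) frobenius_norm D ^+ 2.
    by rewrite sumr_const card_ord mulr_natl.
  rewrite /N2 big_distrr /=; apply: ler_sum => t _.
  rewrite (eq_bigr (fun p => (D p.1 p.2 + eta t p.1 + eta t p.2) ^+ 2)); last first.
    by move=> p _; rewrite DeE addrA.
  have [[s1 _] o1 _] := fGh; have [[s2 _] o2 _] := fGs.
  apply: centered_edge_norm; first by rewrite /D linearB /= s1 s2.
  by rewrite /D mulmxBl o1 o2 subrr.
have h6' : Q / (2 * kap) <= 32 / kap * T%:R * n%:R ^+ 2 * dl ^+ 4.
  have -> : 32 / kap * T%:R * n%:R ^+ 2 * dl ^+ 4 =
      T%:R * (n%:R ^+ 2 * (64 * dl ^+ 4)) / (2 * kap).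
    by field; exact: lt0r_neq0.
  by rewrite ler_pM2r // invr_gt0 mulr_gt0.
have h7' : kap / 4 * T%:R * frobenius_norm D ^+ 2 <= kap / 2 * N2.
  by move: (ler_wpM2l (ltW kap0) h7); clear; move: (frobenius_norm D) N2 => *; lra.
by move: h1 h2 h3 h4 h5 h6' h7'; clear;
  move: (frobenius_norm D) (\tr _) (\tr _) N2 X P Q (\sum_(p | _) _) => *; lra.
Qed.

(** * Operator norm of the noise *)

Definition signed_val (R : realType) (N : nat) (q : bool * 'I_N) : R := (-1) ^+ q.1 * q.2%:R.

(** The bound 4 n results from rounding a vector of squared norm n with a loss of 2 y^2 + 2 per
    coordinate. Magnitudes up to 2 n suffice, since m^2 <= 4 n forces m <= 2 n. *)
Definition net (R : realType) (n : nat) (z : {ffun 'I_n -> bool * 'I_(2 * n).+1}) : bool :=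
  \sum_i (signed_val R (z i)) ^+ 2 <= 4 * n%:R.

Lemma sum_expRN_le (R : realType) (N : nat) : \sum_(m < N) expR (- m%:R) <= 2 :> R.
Proof.
have h : \sum_(m < N) expR (- m%:R) <= 2 * (1 - 2^-1 ^+ N) :> R.
  elim: N => [|N IH]; first by rewrite big_ord0 expr0 subrr mulr0.
  rewrite big_ord_recr /= exprS.
  have : expR (- N%:R) <= 2^-1 ^+ N :> R.
    rewrite expRN exprVn lef_pV2 ?posrE ?expR_gt0 ?exprn_gt0 //.
    rewrite -[N%:R]mulr1 -[N%:R * 1]mulrC expRM_natr.
    by apply: lerXn2r; rewrite ?nnegrE ?expR_ge0 //; have := expR_ge1Dx (1 : R); lra.
  by move: (2^-1 ^+ N) (expR _) (\sum_(_ < _) _) IH => *; lra.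
apply: le_trans h _; have : 0 <= 2^-1 ^+ N :> R by rewrite exprn_ge0.
by lra.
Qed.

(** Each net vector has weight at least 1 under the product of the [g], and the total weight
    factorises into the n-th power of a sum at most 4 e^4 <= e^6. *)
Lemma card_net_le (R : realType) (n : nat) : #|@net R n|%:R <= expR (6 * n%:R) :> R.
Proof.
pose g (q : bool * 'I_(2 * n).+1) : R := expR (4 - signed_val R q ^+ 2).
have e1 : #|@net R n|%:R <= \sum_(z : {ffun 'I_n -> bool * 'I_(2 * n).+1}) \prod_i g (z i).
  rewrite -sum1_card natr_sum big_mkcond /=; apply: ler_sum => z _.
  rewrite -expR_sum; case: ifP => [zn|_]; last exact: expR_ge0.
  rewrite -[leLHS]expR0 ler_expR sumrB sumr_const card_ord subr_ge0 -[_ *+ n]mulr_natr.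
  exact: zn.
apply: le_trans e1 _; rewrite -(bigA_distr_bigA (fun _ q => g q)) /= prodr_const card_ord.
rewrite expRM_natr; apply: lerXn2r; rewrite ?nnegrE ?expR_ge0 //.
  by apply: sumr_ge0 => q _; exact: expR_ge0.
rewrite /g -(pair_bigA _ (fun b m => expR (4 - (signed_val R (b, m)) ^+ 2))) /=.
apply: (@le_trans _ _ (\sum_(b : bool) expR 4 * 2)).
  apply: ler_sum => b _; apply: (@le_trans _ _ (\sum_(m < (2 * n).+1) expR 4 * expR (- m%:R))).
    apply: ler_sum => m _; rewrite expRD ler_pM2l ?expR_gt0 // ler_expR lerN2.
    rewrite /signed_val exprMn sqrr_sign mul1r /= -natrX ler_nat.
    by rewrite -mulnn; case: (nat_of_ord m) => // r; exact: leq_pmulr.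
  by rewrite -big_distrr /= ler_pM2l ?expR_gt0 // sum_expRN_le.
rewrite sumr_const card_bool mulr2n.
have -> : 6 = 4 + 1 + 1 :> R by ring.
rewrite (expRD (4 + 1) 1) (expRD 4 1); have := expR_ge1Dx (1 : R); have := expR_gt0 (4 : R).
move: (expR 4) (expR 1) => u v u0 v2.
have h : 2 * 2 <= v * v by apply: ler_pM; lra.
have := ler_wpM2l (ltW u0) h; lra.
Qed.

(** The modulus is rounded up or down according to the sign of [c] times that of [y]; the size bound
    is (|y| + 1)^2 <= 2 y^2 + 2. *)
Lemma rounding (R : realType) (c y : R) :
  exists (b : bool) (m : nat), c * y <= c * ((-1) ^+ b * m%:R) /\
     ((-1) ^+ b * m%:R) ^+ 2 <= 2 * y ^+ 2 + 2.
Proof.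
have /andP[t1 t2] := truncn_itv (normr_ge0 y).
have yE : y = (-1) ^+ (y < 0)%R * `|y| by rewrite mulr_sign_norm.
have q (v : R) : 0 <= v -> v <= `|y| + 1 -> ((-1) ^+ (y < 0)%R * v) ^+ 2 <= 2 * y ^+ 2 + 2.
  move=> v0 vy; rewrite exprMn sqrr_sign mul1r.
  apply: (@le_trans _ _ ((`|y| + 1) ^+ 2)).
    by rewrite ler_pXn2r ?nnegrE // addr_ge0.
  rewrite -(real_normK (num_real y)); have := sqr_ge0 (`|y| - 1); rewrite !expr2; lra.
have [cs|cs] := leP 0 (c * (-1) ^+ (y < 0)%R).
  exists (y < 0)%R, (Num.truncn `|y|).+1; split; last by apply: q => //; rewrite -natr1 lerD2r.
  by rewrite {1}yE !mulrA ler_wpM2l // ltW.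
exists (y < 0)%R, (Num.truncn `|y|); split; last by apply: q => //; lra.
by rewrite {1}yE !mulrA ler_wnM2l // ltW.
Qed.

(* A linear form on a cube is largest at a vertex: each coordinate is rounded up or down,
   whichever increases the form. *)
Lemma net_dominates (R : realType) (n : nat) (c y : 'I_n -> R) :
  \sum_i y i ^+ 2 = n%:R ->
  exists z : {ffun 'I_n -> bool * 'I_(2 * n).+1}, net R z /\
    \sum_i c i * y i <= \sum_i c i * signed_val R (z i).
Proof.
move=> yn.
have /choice[zz Hz] : forall i, exists q : bool * nat, c i * y i <= c i * ((-1) ^+ q.1 * q.2%:R) /\
     ((-1) ^+ q.1 * q.2%:R) ^+ 2 <= 2 * y i ^+ 2 + 2.
  by move=> i; have [b [m H]] := rounding (c i) (y i); exists (b, m).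
have tot : \sum_i ((-1) ^+ (zz i).1 * (zz i).2%:R) ^+ 2 <= 4 * n%:R :> R.
  apply: (@le_trans _ _ (\sum_i (2 * y i ^+ 2 + 2))).
    by apply: ler_sum => i _; have [] := Hz i.
  rewrite big_split /= -big_distrr /= yn sumr_const card_ord -[_ *+ n]mulr_natl; lra.
have lt i : ((zz i).2 < (2 * n).+1)%N.
  rewrite ltnS; have n0 : (0 < n)%N by apply: leq_ltn_trans (ltn_ord i).
  rewrite -(@leq_exp2r _ _ 2) // -(ler_nat R).
  have : ((-1) ^+ (zz i).1 * (zz i).2%:R) ^+ 2 <= 4 * n%:R :> R.
    apply: le_trans tot; rewrite (bigD1 i) //= lerDl.
    by apply: sumr_ge0 => j _; exact: sqr_ge0.
  rewrite exprMn sqrr_sign mul1r -natrX => /le_trans; apply.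
  by rewrite -natrM ler_nat expnMn leq_mul // expnS leq_pmulr.
exists [ffun i => ((zz i).1, inord (zz i).2)].
have sv i : signed_val R ([ffun i => ((zz i).1, inord (zz i).2 : 'I_(2 * n).+1)] i) =
    (-1) ^+ (zz i).1 * (zz i).2%:R.
  by rewrite ffunE /signed_val /= inordK.
split; first by rewrite /net (eq_bigr _ (fun i _ => congr1 (fun x => x ^+ 2) (sv i))).
by apply: ler_sum => i _; rewrite sv; have [] := Hz i.
Qed.

(** Both vectors are scaled to squared norm n and rounded one after the other. The form is linear in
    each, so rounding never decreases it and no approximation factor appears. *)
Lemma opnorm_le_net (R : realType) (n : nat) (U : 'M[R]_n) (u : R) :
  (0 < n)%N -> 0 <= u ->
  (forall z v : {ffun 'I_n -> bool * 'I_(2 * n).+1}, net R z -> net R v ->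
     \sum_i \sum_j U i j * (signed_val R (z i) * signed_val R (v j)) <= n%:R * u) ->
  opnorm_le U u.
Proof.
move=> n0 u0 H x y.
have np : 0 < n%:R :> R by rewrite ltr0n.
have fE (v : 'rV[R]_n) : frobenius_norm v ^+ 2 = \sum_i v 0 i ^+ 2.
  rewrite sqr_sqrtr ?big_ord1 //.
  by apply: sumr_ge0 => j _; exact: sqr_ge0.
have v0 (v : 'rV[R]_n) : frobenius_norm v = 0 -> v = 0.
  move=> e; have := fE v; rewrite e expr0n /= => /esym/eqP.
  rewrite psumr_eq0 => [/allP h|i _]; last exact: sqr_ge0.
  apply/rowP => i; rewrite mxE; apply/eqP; rewrite -sqrf_eq0; apply: h.
  exact: mem_index_enum.
have fge0 (v : 'rV[R]_n) : 0 <= frobenius_norm v by exact: sqrtr_ge0.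
have [xz|xn] := eqVneq (frobenius_norm x) 0.
  by rewrite (v0 _ xz) !mul0mx mxE -(v0 _ xz) mulr_ge0 // mulr_ge0.
have [yz|yn] := eqVneq (frobenius_norm y) 0.
  by rewrite (v0 _ yz) trmx0 mulmx0 mxE -(v0 _ yz) mulr_ge0 // mulr_ge0.
have nrm (v : 'rV[R]_n) : frobenius_norm v != 0 ->
    \sum_i (Num.sqrt n%:R / frobenius_norm v * v 0 i) ^+ 2 = n%:R.
  move=> vn; rewrite (eq_bigr (fun i => (n%:R / frobenius_norm v ^+ 2) * v 0 i ^+ 2)); last first.
    by move=> i _; rewrite !exprMn sqr_sqrtr // exprVn.
  by rewrite -big_distrr /= -fE divfK // sqrf_eq0.
set a := Num.sqrt n%:R / frobenius_norm x.
set b := Num.sqrt n%:R / frobenius_norm y.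
have xE : (x *m U *m y^T) 0 0 = \sum_j (\sum_i x 0 i * U i j) * y 0 j.
  by rewrite mxE; apply: eq_bigr => j _; rewrite !mxE.
have [v [vn lev]] := net_dominates (fun j => \sum_i a * x 0 i * U i j) (nrm y yn).
have [z [zn lez]] := net_dominates (fun i => \sum_j U i j * signed_val R (v j)) (nrm x xn).
have key : a * b * (x *m U *m y^T) 0 0 <= n%:R * u.
  apply: le_trans (H z v zn vn).
  apply: (@le_trans _ _ (\sum_j (\sum_i a * x 0 i * U i j) * (b * y 0 j))).
    rewrite xE big_distrr /=; apply: ler_sum => j _.
    rewrite le_eqVlt; apply/orP; left; apply/eqP.
    rewrite -(eq_bigr _ (fun i _ => mulrA a (x 0 i) (U i j))) -big_distrr /=; ring.
  apply: le_trans lev _.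
  rewrite [leLHS](_ : _ = \sum_i (\sum_j U i j * signed_val R (v j)) * (a * x 0 i)); last first.
    under eq_bigr do rewrite big_distrl /=.
    rewrite exchange_big /=; apply: eq_bigr => i _; rewrite big_distrl /=.
    by apply: eq_bigr => j _; ring.
  apply: le_trans lez _.
  rewrite le_eqVlt; apply/orP; left; apply/eqP; apply: eq_bigr => i _.
  by rewrite big_distrl /=; apply: eq_bigr => j _; ring.
have xp : 0 < frobenius_norm x by rewrite lt_neqAle eq_sym xn fge0.
have yp : 0 < frobenius_norm y by rewrite lt_neqAle eq_sym yn fge0.
have ab : a * b = n%:R / (frobenius_norm x * frobenius_norm y).
  rewrite /a /b -[in RHS](sqr_sqrtr (ler0n R n)); field.
  by rewrite xn yn.
rewrite ab mulrAC ler_pdivrMr ?mulr_gt0 // -!mulrA ler_pM2l // in key.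
Qed.

Lemma poisson_pmf_le (R : realType) (mu b : R) (L : nat) : 0 < mu -> mu <= 1 -> 0 <= b ->
  poisson_pmf mu L <= expR (expR b - b * L%:R).
Proof.
move=> mu0 mu1 b0; rewrite expRD expRN ler_pdivlMr ?expR_gt0 //.
apply: le_trans (_ : _ <= \sum_(m < L.+1) poisson_pmf mu m * expR (b * m%:R)) _.
  rewrite big_ord_recr /= lerDr; apply: sumr_ge0 => m _.
  by rewrite mulr_ge0 ?expR_ge0 // poisson_pmf_ge0.
apply: le_trans (poisson_partial_mgf _ _ mu0) _; rewrite ler_expR.
have := expR_ge1Dx b => h; apply: le_trans (_ : _ <= 1 * (expR b - 1)) _; last by lra.
by rewrite ler_wpM2r //; lra.
Qed.

Lemma poisson_partial_sum (R : realType) (mu : R) (N : nat) : 0 < mu ->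
  \sum_(m < N) poisson_pmf mu m <= 1.
Proof.
move=> mu0; have := poisson_partial_mgf 0 N mu0.
rewrite expR0 subrr mulr0 expR0 => h; apply: le_trans h.
by apply: ler_sum => m _; rewrite mul0r expR0 mulr1.
Qed.

(** The sum telescopes, because m times the mass at m is mu times the mass at m - 1. *)
Lemma poisson_partial_mean (R : realType) (mu : R) (L : nat) : 0 < mu ->
  \sum_(m < L.+1) poisson_pmf mu m * (m%:R - mu) = - mu * poisson_pmf mu L.
Proof.
move=> mu0; elim: L => [|L IH].
  by rewrite big_ord_recr big_ord0 /= add0r sub0r mulrC.
rewrite big_ord_recr /= IH /poisson_pmf mu0.
have -> : L.+1`!%:R = L.+1%:R * L`!%:R :> R by rewrite factS natrM.
rewrite exprS; field.
by rewrite nat1r !pnatr_eq0 -lt0n fact_gt0.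
Qed.

(* Centring after truncation costs only [E ((X - mu) 1_(X > L))], which is [mu * poisson_pmf mu L]. *)
Lemma truncated_poisson_mgf (R : realType) (mu a : R) (L N : nat) :
  0 < mu -> mu <= 1 -> (0 < L)%N -> (L < N)%N ->
  \sum_(m < N) poisson_pmf mu m * expR (a * (if (m <= L)%N then m%:R - mu else 0)) <=
    expR (2 * a ^+ 2 * L%:R ^+ 2 + `|a| * poisson_pmf mu L).
Proof.
move=> mu0 mu1 L0 LN.
have p0 m : 0 <= poisson_pmf mu m by exact: poisson_pmf_ge0.
have L1 : 1 <= L%:R :> R by rewrite ler1n.
pose Y (m : nat) : R := if (m <= L)%N then m%:R - mu else 0.
have YL m : `|Y m| <= L%:R.
  rewrite /Y; case: leqP => // mL; last by rewrite normr0.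
  by rewrite ler_norml; have : m%:R <= L%:R :> R; [rewrite ler_nat|have := ler0n R m; lra].
have aYL m : `|a * Y m| <= `|a| * L%:R by rewrite normrM ler_wpM2l.
(* If |a| L > 1 the crude bound |a| L <= 2 a^2 L^2 of the exponent suffices; otherwise the quadratic
   bound on the exponential applies. *)
have [aL|aL] := leP (`|a| * L%:R) 1; last first.
  apply: (@le_trans _ _ (\sum_(m < N) poisson_pmf mu m * expR (2 * a ^+ 2 * L%:R ^+ 2))).
    apply: ler_sum => m _; rewrite ler_wpM2l // ler_expR -/(Y m).
    apply: le_trans (ler_norm _) _; apply: le_trans (aYL _) _.
    have h : `|a| * L%:R <= (`|a| * L%:R) * (`|a| * L%:R).
      by rewrite ler_peMr ?mulr_ge0 // ltW.
    apply: le_trans h _; rewrite -(real_normK (num_real a)).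
    have := sqr_ge0 (`|a| * L%:R); rewrite !expr2; lra.
  rewrite -big_distrl /= -[leRHS]mul1r; apply: ler_pM.
  - by apply: sumr_ge0.
  - exact: expR_ge0.
  - exact: poisson_partial_sum.
  - by rewrite ler_expR lerDl mulr_ge0.
apply: (@le_trans _ _ (\sum_(m < N) (poisson_pmf mu m + a * (poisson_pmf mu m * Y m) +
   2 * a ^+ 2 * (poisson_pmf mu m * Y m ^+ 2)))).
  apply: ler_sum => m _; rewrite -/(Y m).
  have h : a * Y m <= 1 by apply: le_trans (ler_norm _) _; apply: le_trans (aYL _) _.
  by have := ler_wpM2l (p0 m) (expR_le_quad h); rewrite exprMn; lra.
rewrite !big_split /= -!big_distrr /=.
have s1 := poisson_partial_sum N mu0.
have s2 : \sum_(m < N) poisson_pmf mu m * Y m = - mu * poisson_pmf mu L.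
  rewrite -(poisson_partial_mean L mu0) (big_ord_widen N (fun m => poisson_pmf mu m * (m%:R - mu))) //.
  rewrite [RHS]big_mkcond /=; apply: eq_bigr => m _; rewrite /Y ltnS.
  by case: ifP => // _; rewrite mulr0.
have s3 : \sum_(m < N) poisson_pmf mu m * Y m ^+ 2 <= L%:R ^+ 2.
  apply: (@le_trans _ _ (\sum_(m < N) poisson_pmf mu m * L%:R ^+ 2)).
    apply: ler_sum => m _; rewrite ler_wpM2l // -(real_normK (num_real (Y m))).
    by rewrite lerXn2r ?nnegrE.
  by rewrite -big_distrl /= -[leRHS]mul1r ler_wpM2r ?sqr_ge0.
rewrite s2; apply: le_trans (expR_ge1Dx _).
have h1 : a * (- mu * poisson_pmf mu L) <= `|a| * poisson_pmf mu L.
  rewrite mulNr mulrN -mulNr; apply: le_trans (ler_norm _) _.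
  rewrite normrM normrN ler_wpM2l // ger0_norm ?mulr_ge0 ?(ltW mu0) //.
  by rewrite ler_piMl.
have h2 := ler_wpM2l (_ : 0 <= 2 * a ^+ 2) s3.
have := h2 (mulr_ge0 (ler0n _ _) (sqr_ge0 _)); lra.
Qed.

Definition index_set (n T : nat) : {set 'I_T * 'I_n * 'I_n} :=
  [set x : 'I_T * 'I_n * 'I_n | (x.1.2 <= x.2)%N]%SET.

Lemma sum_index_set (V : nmodType) (n T : nat) (F : 'I_T * 'I_n * 'I_n -> V) :
  \sum_(x in index_set n T) F x = \sum_t \sum_(p | upper p) F (t, p.1, p.2).
Proof.
rewrite pair_big_dep /= (reindex (fun q : 'I_T * ('I_n * 'I_n) => (q.1, q.2.1, q.2.2))) /=.
  by apply: eq_bigl => -[t [i j]]; rewrite inE.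
exists (fun x => (x.1.1, (x.1.2, x.2))); first by move=> [t [i j]].
by move=> [[t i] j].
Qed.

Lemma sum_index_set_mx (V : nmodType) (n T : nat) (F : 'I_T * 'I_n * 'I_n -> V) :
  \sum_(x in index_set n T) F x =
    \sum_(i < n) \sum_(j < n) (if (i <= j)%N then \sum_t F (t, i, j) else 0).
Proof.
rewrite sum_index_set exchange_big /= -(sum_upper (fun i j => \sum_t F (t, i, j))).
by apply: eq_bigr => i _; rewrite big_mkcond.
Qed.

Lemma sum_index_set_prod_le (R : realFieldType) (n T : nat) (f g : 'I_n -> R) :
  (forall i, 0 <= f i) -> (forall i, 0 <= g i) ->
  \sum_(x in index_set n T) f x.1.2 * g x.2 <= T%:R * (\sum_i f i) * (\sum_i g i).
Proof.
move=> f0 g0; rewrite sum_index_set /=.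
have -> : T%:R * (\sum_i f i) * (\sum_i g i) = \sum_(t < T) (\sum_i f i) * (\sum_i g i).
  by rewrite sumr_const card_ord -[RHS]mulr_natl mulrA.
apply: ler_sum => t _.
apply: le_trans (sum_upper_le (F := fun p => f p.1 * g p.2) _) _.
  by move=> p; rewrite mulr_ge0.
by rewrite big_distrl /= -(pair_bigA _ (fun i j => f i * g j)) /=;
  apply: ler_sum => i _; rewrite big_distrr.
Qed.

Lemma mutually_independentS (R : realType) (d d' : measure_display)
    (Omega : measurableType d) (E : measurableType d')
    (P : probability Omega R) (I : finType) (D D' : {set I}) (X : I -> {RV P >-> E}) :
  D' \subset D -> mutually_independent D X -> mutually_independent D' X.
Proof. by move=> DD ind J B JD; apply: ind; exact: fintype.subset_trans DD. Qed.

Lemma poisson_tail (R : realType) (d : measure_display)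
    (Omega : measurableType d) (P : probability Omega R) (I : finType)
    (X : I -> {RV P >-> nat}) (D : {set I}) (mu : I -> R) (x : I) (b : R) (L : nat) :
  mutually_independent D X -> (forall i, has_poisson_law (X i) (mu i)) ->
  (forall i, 0 < mu i) -> (forall i, mu i <= 1) -> x \in D -> 0 <= b ->
  (P [set w | (L <= X x w)%N] <= (expR (expR b - b * L%:R))%:E)%E.
Proof.
move=> ind law mu0 mu1 xD b0.
have ind1 : mutually_independent [set x]%SET X.
  by apply: mutually_independentS ind; rewrite finset.sub1set.
apply: (@le_trans _ _ (P [set w | (expR (b * L%:R) <=
    \prod_(i in [set x]%SET) expR (b * (X i w)%:R))%R])).
  apply: le_measure; rewrite ?inE.
  - exact: (measurable_fin_family X (fun g => (L <= g x)%N)).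
  - exact: (measurable_fin_family X (fun g => expR (b * L%:R) <=
      \prod_(i in [set x]%SET) expR (b * (g i)%:R))).
  by move=> w /= Lw; rewrite big_set1 ler_expR ler_wpM2l // ler_nat.
have := product_markov (f := fun i m => expR (b * m%:R)) (F := fun=> expR (expR b)) (N0 := 0)
  ind1 (fun _ _ => expR_ge0 _) _ (expR_gt0 (b * L%:R)).
move=> /(_ _)/le_trans; apply.
  move=> i N _ _; under eq_bigr do rewrite law /=.
  apply: le_trans (poisson_partial_mgf _ _ (mu0 i)) _; rewrite ler_expR.
  have := expR_ge1Dx b => h; apply: le_trans (_ : _ <= 1 * (expR b - 1)) _; last by lra.
  by rewrite ler_wpM2r //; lra.
by rewrite big_set1 lee_fin -expRN -expRD addrC.
Qed.

Lemma net_abs_sum (R : realType) (n : nat) (z : {ffun 'I_n -> bool * 'I_(2 * n).+1}) :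
  net R z -> \sum_i `|signed_val R (z i)| <= 2 * n%:R.
Proof.
move=> zn; rewrite -(@ler_pXn2r _ 2) ?nnegrE ?mulr_ge0 ?sumr_ge0 //.
have := cauchy_schwarz_sum xpredT (fun i => `|signed_val R (z i)|) (fun=> 1).
under eq_bigr do rewrite mulr1.
under [X in _ <= X * _]eq_bigr do rewrite real_normK ?num_real //.
rewrite expr1n sumr_const card_ord => /le_trans; apply.
rewrite -[1 *+ n]/(n%:R) exprMn; apply: le_trans (_ : _ <= 4 * n%:R * n%:R) _.
  by rewrite ler_wpM2r.
by rewrite !expr2; lra.
Qed.

(** Upper triangular, so that each independent count occurs once; its pairing with a matrix is the
    sum over i <= j in the likelihood. *)
Definition noise_mx (R : realType) (n T : nat) (mu : 'I_T * 'I_n * 'I_n -> R)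
    (g : 'I_T * 'I_n * 'I_n -> nat) : 'M[R]_n :=
  \matrix_(i, j) if (i <= j)%N then \sum_t ((g (t, i, j))%:R - mu (t, i, j)) else 0.

(** For net vectors the weights have squares summing to at most T (4 n)^2 and absolute values
    summing to at most T (2 n)^2, whence the 32 and the 4 in the exponent. *)
Lemma net_pair_tail (R : realType) (d : measure_display)
    (Omega : measurableType d) (P : probability Omega R) (n T : nat)
    (X : 'I_T * 'I_n * 'I_n -> {RV P >-> nat}) (mu : 'I_T * 'I_n * 'I_n -> R)
    (L : nat) (tau y eta : R) (z v : {ffun 'I_n -> bool * 'I_(2 * n).+1}) :
  mutually_independent (index_set n T) X -> (forall i, has_poisson_law (X i) (mu i)) ->
  (forall i, 0 < mu i) -> (forall i, mu i <= 1) -> (0 < L)%N -> 0 <= tau ->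
  (forall i, poisson_pmf (mu i) L <= eta) -> net R z -> net R v ->
  (P [set w | (y <= \sum_(x in index_set n T)
        signed_val R (z x.1.2) * signed_val R (v x.2) *
        (if (X x w <= L)%N then (X x w)%:R - mu x else 0))%R] <=
    (expR (32 * tau ^+ 2 * L%:R ^+ 2 * T%:R * n%:R ^+ 2 +
       4 * tau * eta * T%:R * n%:R ^+ 2 - tau * y))%:E)%E.
Proof.
move=> ind law mu0 mu1 L0 tau0 peta zn vn.
pose a (x : 'I_T * 'I_n * 'I_n) : R := signed_val R (z x.1.2) * signed_val R (v x.2).
pose Y (x : 'I_T * 'I_n * 'I_n) (m : nat) : R := if (m <= L)%N then m%:R - mu x else 0.
pose f x m := expR (tau * a x * Y x m).
pose F x := expR (2 * (tau * a x) ^+ 2 * L%:R ^+ 2 + `|tau * a x| * poisson_pmf (mu x) L).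
apply: (@le_trans _ _ (P [set w | (expR (tau * y) <= \prod_(x in index_set n T) f x (X x w))%R])).
  apply: le_measure; rewrite ?inE.
  - exact: (measurable_fin_family X (fun g => y <= \sum_(x in index_set n T) a x * Y x (g x))).
  - exact: (measurable_fin_family X (fun g => expR (tau * y) <= \prod_(x in index_set n T) f x (g x))).
  move=> w /= H; rewrite /f -expR_sum ler_expR.
  under eq_bigr do rewrite -mulrA.
  by rewrite -big_distrr /= ler_wpM2l.
have := product_markov (f := f) (F := F) (N0 := L.+1) ind (fun _ _ => expR_ge0 _) _
  (expR_gt0 (tau * y)).
move=> /(_ _)/le_trans; apply.
  move=> x N _ LN; under eq_bigr do rewrite law /=.
  exact: truncated_poisson_mgf.
rewrite lee_fin -expRN -expR_sum -expRD ler_expR addrC lerD2r big_split /=.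
have S2 : \sum_(x in index_set n T) a x ^+ 2 <= T%:R * (4 * n%:R) * (4 * n%:R).
  under eq_bigr do rewrite exprMn.
  apply: le_trans (sum_index_set_prod_le T (fun i => sqr_ge0 (signed_val R (z i)))
    (fun i => sqr_ge0 (signed_val R (v i)))) _.
  have q0 (u : {ffun 'I_n -> bool * 'I_(2 * n).+1}) : 0 <= \sum_i signed_val R (u i) ^+ 2.
    by apply: sumr_ge0 => *; exact: sqr_ge0.
  by apply: ler_pM; rewrite ?mulr_ge0 ?q0 //; apply: ler_wpM2l.
have S1 : \sum_(x in index_set n T) `|a x| <= T%:R * (2 * n%:R) * (2 * n%:R).
  under eq_bigr do rewrite normrM.
  apply: le_trans (sum_index_set_prod_le T (fun i => normr_ge0 (signed_val R (z i)))
    (fun i => normr_ge0 (signed_val R (v i)))) _.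
  by apply: ler_pM; rewrite ?mulr_ge0 ?sumr_ge0 ?net_abs_sum // ler_wpM2l ?net_abs_sum.
apply: lerD.
  rewrite (eq_bigr (fun x => 2 * tau ^+ 2 * L%:R ^+ 2 * a x ^+ 2)); last by move=> *; rewrite exprMn; ring.
  rewrite -big_distrr /=.
  apply: le_trans (ler_wpM2l _ S2) _; first by rewrite !mulr_ge0 ?sqr_ge0.
  by rewrite le_eqVlt; apply/orP; left; apply/eqP; ring.
apply: (@le_trans _ _ (\sum_(x in index_set n T) tau * eta * `|a x|)).
  apply: ler_sum => x _; rewrite normrM (ger0_norm tau0) mulrAC.
  by rewrite ler_wpM2r // ler_wpM2l.
rewrite -big_distrr /=.
(* The sign of [eta] is known only through [peta] at some index; without any index, n or T is 0 and
   both sides vanish. *)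
have eta0 : 0 <= tau * eta \/ (forall x : 'I_T * 'I_n * 'I_n, False).
  have [[x]|H] := pselect (exists x : 'I_T * 'I_n * 'I_n, True); last first.
    by right => x; apply: H; exists x.
  by left; rewrite mulr_ge0 // (le_trans _ (peta x)) // poisson_pmf_ge0.
case: eta0 => [te|nox].
  apply: le_trans (ler_wpM2l te S1) _.
  by rewrite le_eqVlt; apply/orP; left; apply/eqP; ring.
rewrite big1 ?mulr0 => [|x _]; last by case: (nox x).
have [t0|t0] := posnP T; first by rewrite t0 mulr0 mul0r.
have [n0|n0] := posnP n; first by rewrite n0 expr0n mulr0.
by case: (nox (Ordinal t0, Ordinal n0, Ordinal n0)).
Qed.

(* The 120 makes the Chernoff exponent at least [15 n], which beats the entropy [12 n] of pairs of
   net points plus the variance term [2 n]. *)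
Lemma noise_opnorm_tail (R : realType) (d : measure_display)
    (Omega : measurableType d) (P : probability Omega R) (n T : nat)
    (X : 'I_T * 'I_n * 'I_n -> {RV P >-> nat}) (mu : 'I_T * 'I_n * 'I_n -> R)
    (c s lam : R) :
  let l := ln (n * T)%:R in let eps := c / 120 in let b := (s + 3) / eps in
  mutually_independent (index_set n T) X -> (forall i, has_poisson_law (X i) (mu i)) ->
  (forall i, 0 < mu i) -> (forall i, mu i <= 1) -> (0 < n)%N -> (0 < T)%N ->
  0 < c -> 0 <= s -> 1 <= eps * l -> c * (Num.sqrt (n * T)%:R * l) <= lam ->
  (P [set w | ~ opnorm_le (noise_mx mu (fun x => X x w)) lam] <=
    (expR (expR b - (s + 1) * l) + expR (4 * expR (expR b) - n%:R))%:E)%E.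
Proof.
move=> l eps b ind law mu0 mu1 n0 T0 c0 s0 el1 lamb.
have np : 1 <= n%:R :> R by rewrite ler1n.
have Tp : 1 <= T%:R :> R by rewrite ler1n.
have nT1 : 1 <= (n * T)%:R :> R by rewrite ler1n muln_gt0 n0 T0.
have nTe : (n * T)%:R = expR l by rewrite lnK // posrE (lt_le_trans ltr01).
have eps0 : 0 < eps by rewrite divr_gt0.
have l0 : 0 < l by rewrite -(pmulr_rgt0 _ eps0) (lt_le_trans ltr01).
have b0 : 0 <= b by rewrite divr_ge0 ?(ltW eps0) //; lra.
pose L := (Num.truncn (eps * l)).+1.
have /andP[t1 t2] := truncn_itv (ltW (mulr_gt0 eps0 l0)).
have Llo : eps * l <= L%:R by exact: ltW.
have Lhi : L%:R <= 2 * (eps * l) by rewrite /L -natr1; lra.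
have L1 : 1 <= L%:R :> R by rewrite ler1n.
(* This makes one exceedance cost (n T)^-(s + 3) up to a constant; the union over n^2 T <= (n T)^2
   entries leaves the exponent s + 1. *)
have bl : (s + 3) * l <= b * L%:R.
  have -> : (s + 3) * l = b * (eps * l) by rewrite /b; field; rewrite gt_eqF.
  by rewrite ler_wpM2l.
pose q : R := Num.sqrt (n * T)%:R.
have q2 : q ^+ 2 = (n * T)%:R by rewrite sqr_sqrtr.
have q1 : 1 <= q by rewrite -[1]sqrtr1 ler_wsqrtr.
(* Chosen so that the variance term of [net_pair_tail] equals 2 n exactly. *)
pose tau := (4 * L%:R * q)^-1.
have tau0 : 0 < tau by rewrite invr_gt0 !mulr_gt0 //; lra.
have tauLq : tau * (4 * L%:R * q) = 1.
  by rewrite mulVf // gt_eqF // -invr_gt0.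
have tau1 : tau <= 1.
  rewrite -tauLq ler_peMr ?(ltW tau0) //.
  have : 1 * 1 <= L%:R * q by apply: ler_pM.
  by lra.
pose eta := expR (expR b - (s + 3) * l).
have peta i : poisson_pmf (mu i) L <= eta.
  apply: le_trans (poisson_pmf_le L (mu0 i) (mu1 i) b0) _.
  by rewrite ler_expR lerB.
have lam0 : 0 <= lam.
  by apply: le_trans lamb; rewrite mulr_ge0 ?(ltW c0) // mulr_ge0 ?sqrtr_ge0 ?(ltW l0).
pose Z := {ffun 'I_n -> bool * 'I_(2 * n).+1}.
pose J : finType := ('I_T * 'I_n * 'I_n + Z * Z)%type.
pose lin (z v : Z) (g : 'I_T * 'I_n * 'I_n -> nat) : R := \sum_(x in index_set n T)
        signed_val R (z x.1.2) * signed_val R (v x.2) *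
        (if (g x <= L)%N then (g x)%:R - mu x else 0).
pose F (j : J) : set Omega := match j with
  | inl x => [set w | x \in index_set n T /\ (L <= X x w)%N]
  | inr (z, v) => [set w | [/\ net R z, net R v & n%:R * lam <= lin z v (fun x => X x w)]]
  end.
pose C1 := 4 * expR (expR b).
pose r (j : J) : R := match j with
  | inl x => eta
  | inr (z, v) => if net R z && net R v then expR (C1 - 13 * n%:R) else 0
  end.
apply: (@le_trans _ _ (\sum_j r j)%:E).
  apply: (measure_exists_le (F := F)).
  - exact: (measurable_fin_family X (fun g => ~ opnorm_le (noise_mx mu g) lam)).
  - case=> [x|[z v]] /=.
      exact: (measurable_fin_family X (fun g => x \in index_set n T /\ (L <= g x)%N)).
    exact: (measurable_fin_family X (fun g => [/\ net R z, net R v & n%:R * lam <= lin z v g])).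
  - move=> w /= nop; apply: contrapT => nex; apply: nop.
    have small x : x \in index_set n T -> (X x w <= L)%N.
      move=> xD; rewrite leqNgt; apply/negP => lt; apply: nex; exists (inl x).
      by split => //; exact: ltnW.
    apply: opnorm_le_net => // z v zn vn.
    rewrite leNgt; apply/negP => lt; apply: nex; exists (inr (z, v)); split => //.
    apply: ltW; apply: lt_le_trans lt _; rewrite le_eqVlt; apply/orP; left; apply/eqP.
    transitivity (\sum_(x in index_set n T) signed_val R (z x.1.2) * signed_val R (v x.2) *
        ((X x w)%:R - mu x)); last first.
      by apply: eq_bigr => x xD; rewrite small.
    rewrite sum_index_set_mx; apply: eq_bigr => i _; apply: eq_bigr => j _.
    by rewrite mxE; case: ifP; rewrite ?mul0r // => _; rewrite mulrC big_distrr.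
  - case=> [x|[z v]] /=.
      have [xD|xD] := boolP (x \in index_set n T); last first.
        rewrite (_ : [set _ | _] = set0) ?measure0 ?lee_fin ?expR_ge0 //.
        by apply/seteqP; split => // w [].
      apply: (@le_trans _ _ (P [set w | (L <= X x w)%N])).
        apply: le_measure; rewrite ?inE.
        + exact: (measurable_fin_family X (fun g => true /\ (L <= g x)%N)).
        + exact: (measurable_fin_family X (fun g => (L <= g x)%N)).
        by move=> w [].
      apply: le_trans (poisson_tail L ind law mu0 mu1 xD b0) _.
      by rewrite lee_fin ler_expR lerB.
    case: ifPn => [/andP[zn vn]|zv]; last first.
      rewrite (_ : [set _ | _] = set0) ?measure0 ?lee_fin //.
      by apply/seteqP; split => // w [zn vn]; rewrite zn vn in zv.
    apply: (@le_trans _ _ (P [set w | (n%:R * lam <= lin z v (fun x => X x w))%R])).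
      apply: le_measure; rewrite ?inE.
      + exact: (measurable_fin_family X (fun g => [/\ net R z, net R v & n%:R * lam <= lin z v g])).
      + exact: (measurable_fin_family X (fun g => n%:R * lam <= lin z v g)).
      by move=> w [].
    apply: le_trans (net_pair_tail (n%:R * lam) ind law mu0 mu1 _ (ltW tau0) peta zn vn) _ => //.
    rewrite lee_fin ler_expR.
    have e1 : 32 * tau ^+ 2 * L%:R ^+ 2 * T%:R * n%:R ^+ 2 = 2 * n%:R.
      have -> : 32 * tau ^+ 2 * L%:R ^+ 2 * T%:R * n%:R ^+ 2 =
          32 * tau ^+ 2 * L%:R ^+ 2 * n%:R * (n * T)%:R by rewrite natrM; ring.
      rewrite -q2; have -> : 32 * tau ^+ 2 * L%:R ^+ 2 * n%:R * q ^+ 2 =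
         2 * n%:R * (tau * (4 * L%:R * q)) ^+ 2 by ring.
      by rewrite tauLq expr1n mulr1.
    have e2 : 4 * tau * eta * T%:R * n%:R ^+ 2 <= C1.
      apply: (@le_trans _ _ (4 * 1 * eta * expR (3 * l))).
        have -> : 4 * tau * eta * T%:R * n%:R ^+ 2 = 4 * tau * eta * (T%:R * n%:R ^+ 2) by ring.
        apply: ler_pM; rewrite ?mulr_ge0 ?expR_ge0 ?(ltW tau0) ?sqr_ge0 //.
          by rewrite ler_wpM2r ?expR_ge0 // ler_wpM2l.
        have -> : expR (3 * l) = (n * T)%:R ^+ 3 by rewrite nTe -expRM_natl.
        rewrite -!natrX -natrM ler_nat.
        rewrite mulnC (_ : (n * T) ^ 3 = (n ^ 2 * T) * (n * T ^ 2))%N.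
          by rewrite leq_pmulr // muln_gt0 n0 expn_gt0 T0.
        by rewrite !expnS !expn0; ring.
      rewrite mulr1 -mulrA /eta -expRD ler_wpM2l // ler_expR.
      by have := mulr_ge0 s0 (ltW l0); lra.
    have e3 : 15 * n%:R <= tau * (n%:R * lam).
      rewrite [leRHS]mulrCA mulrC ler_wpM2l //.
      apply: (@le_trans _ _ (tau * (c * (q * l)))); last by rewrite ler_wpM2l // ltW.
      have -> : 15 = 15 * (tau * (4 * L%:R * q)) by rewrite tauLq mulr1.
      have -> : c = 120 * eps by rewrite /eps; field.
      have tq : 0 <= tau * q by rewrite mulr_ge0 ?(ltW tau0) //; lra.
      by have := ler_wpM2l tq Lhi; lra.
    by rewrite e1; lra.
rewrite lee_fin big_sumType /=; apply: lerD.
  rewrite sumr_const cardE -cardT !card_prod !card_ord -[_ *+ _]mulr_natl.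
  apply: (@le_trans _ _ (expR (2 * l) * eta)); last by rewrite -expRD ler_expR; lra.
  rewrite ler_wpM2r ?expR_ge0 // expRM_natl -nTe -natrX ler_nat.
  rewrite (_ : (n * T) ^ 2 = (T * n * n) * T)%N ?leq_pmulr // !expnS expn0; ring.
have cE : #|@net R n|%:R = \sum_(z : Z) (if net R z then 1 else 0) :> R.
  by rewrite -sum1_card natr_sum big_mkcond.
have -> : \sum_(j : Z * Z) (let (z, v) := j in if net R z && net R v then expR (C1 - 13 * n%:R) else 0) =
    (#|@net R n|%:R * #|@net R n|%:R) * expR (C1 - 13 * n%:R).
  transitivity (\sum_(z : Z) \sum_(v : Z) (if net R z && net R v then expR (C1 - 13 * n%:R) else 0)).
    by rewrite pair_bigA /=; apply: eq_bigr => -[].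
  rewrite cE -mulrA big_distrl /=; apply: eq_bigr => z _.
  rewrite big_distrl big_distrr /=; apply: eq_bigr => v _.
  by case: (net R z); case: (net R v); rewrite ?mul1r ?mul0r.
apply: (@le_trans _ _ (expR (6 * n%:R) * expR (6 * n%:R) * expR (C1 - 13 * n%:R))).
  rewrite ler_wpM2r ?expR_ge0 //; apply: ler_pM => //; exact: card_net_le.
by rewrite -!expRD ler_expR /C1; lra.
Qed.

(** * Concentration of the Newton step *)

Lemma poisson_chernoff_abs (R : realType) (d : measure_display)
    (Omega : measurableType d) (P : probability Omega R) (I : finType)
    (X : I -> {RV P >-> nat}) (D : {set I}) (mu w : I -> R) (tau y V : R) :
  mutually_independent D X -> (forall i, has_poisson_law (X i) (mu i)) ->
  (forall i, 0 < mu i) -> 0 <= tau -> (forall i, `|tau * w i| <= 1) ->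
  \sum_(i in D) w i ^+ 2 * mu i <= V ->
  (P [set u | (y <= `|\sum_(i in D) w i * ((X i u)%:R - mu i)|)%R] <=
    (2 * expR (2 * tau ^+ 2 * V - tau * y))%:E)%E.
Proof.
move=> ind law mu0 tau0 tw SV.
pose sw (b : bool) i := (-1) ^+ b * w i.
pose F (b : bool) := [set u | y <= \sum_(i in D) sw b i * ((X i u)%:R - mu i)].
have -> : 2 * expR (2 * tau ^+ 2 * V - tau * y) =
    \sum_(b : bool) expR (2 * tau ^+ 2 * V - tau * y).
  by rewrite sumr_const card_bool mulr_natl.
apply: (measure_exists_le (F := F)).
- exact: (measurable_fin_family X (fun g => y <= `|\sum_(i in D) w i * ((g i)%:R - mu i)|)).
- move=> b; exact: (measurable_fin_family X (fun g => y <= \sum_(i in D) sw b i * ((g i)%:R - mu i))).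
- move=> u /=; set S := \sum_(i in D) _ => yS; exists (S < 0)%R; rewrite /F /=.
  under eq_bigr do rewrite /sw -mulrA.
  rewrite -big_distrr /= -/S; apply: le_trans yS _.
  by case: ltP => S0; rewrite ?expr1 ?expr0 ?mulN1r ?mul1r ?(ltr0_norm S0) ?(ger0_norm S0).
- move=> b; apply: le_trans (poisson_chernoff (tau := tau) y ind law mu0 _ tau0) _.
    move=> i; apply: le_trans (ler_norm _) _; rewrite /sw mulrCA normrM.
    by rewrite normrX normrN1 expr1n mul1r.
  rewrite lee_fin ler_expR lerD2r ler_wpM2l ?mulr_ge0 ?sqr_ge0 //.
  apply: le_trans SV; rewrite le_eqVlt; apply/orP; left; apply/eqP.
  by apply: eq_bigr => i _; rewrite /sw exprMn sqrr_sign mul1r.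
Qed.

Lemma degree1 (R : realFieldType) (n : nat) (i : 'I_n) :
  degree (fun=> 1 : R) i = n%:R + 1.
Proof.
rewrite degree_sym //; under eq_bigr do rewrite mul1r.
rewrite big_split /= sumr_const card_ord; congr (_ + _).
rewrite (bigD1 i) //= eqxx big1 ?addr0 // => j /negbTE.
by rewrite eq_sym => ->.
Qed.

Lemma sum_edge_sqr_le (R : realFieldType) (n : nat) (u : 'I_n -> R) : (0 < n)%N ->
  \sum_(p | upper p) (u p.1 + u p.2) ^+ 2 <= 4 * n%:R * \sum_l u l ^+ 2.
Proof.
move=> n0; have n1 : 1 <= n%:R :> R by rewrite ler1n.
apply: (@le_trans _ _ (2 * \sum_(p | upper p) 1 * (u p.1 ^+ 2 + u p.2 ^+ 2))).
  rewrite big_distrr /=; apply: ler_sum => p _.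
  by have := sqr_ge0 (u p.1 - u p.2); rewrite !expr2; lra.
rewrite (sum_upper_degree (fun=> 1) (fun l => u l ^+ 2)).
under eq_bigr do rewrite degree1.
rewrite -big_distrl /=; set S := \sum_l _.
have S0 : 0 <= S by apply: sumr_ge0 => l _; exact: sqr_ge0.
have := ler_wpM2l S0 n1; lra.
Qed.

Lemma linear_stat_tail (R : realType) (d : measure_display)
    (Omega : measurableType d) (P : probability Omega R) (n T : nat)
    (X : 'I_T * 'I_n * 'I_n -> {RV P >-> nat}) (mu : 'I_T * 'I_n * 'I_n -> R)
    (u : 'I_T -> 'I_n -> R) (tau y S m : R) :
  mutually_independent (index_set n T) X -> (forall i, has_poisson_law (X i) (mu i)) ->
  (forall i, 0 < mu i) -> (forall i, mu i <= 1) -> (0 < n)%N -> 0 <= tau ->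
  (forall t l, `|u t l| <= m) -> tau * (2 * m) <= 1 -> \sum_t \sum_l u t l ^+ 2 <= S ->
  (P [set w | (y <= `|\sum_t \sum_(p | upper p) ((X (t, p.1, p.2) w)%:R - mu (t, p.1, p.2)) *
       (u t p.1 + u t p.2)|)%R] <=
    (2 * expR (8 * tau ^+ 2 * n%:R * S - tau * y))%:E)%E.
Proof.
move=> ind law mu0 mu1 n0 tau0 um tm uS.
pose w (x : 'I_T * 'I_n * 'I_n) := u x.1.1 x.1.2 + u x.1.1 x.2.
have -> : 8 * tau ^+ 2 * n%:R * S = 2 * tau ^+ 2 * (4 * n%:R * S) by ring.
have E (g : 'I_T * 'I_n * 'I_n -> R) :
    \sum_t \sum_(p | upper p) g (t, p.1, p.2) * (u t p.1 + u t p.2) =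
    \sum_(x in index_set n T) w x * g x.
  rewrite sum_index_set; apply: eq_bigr => t _; apply: eq_bigr => p _.
  by rewrite mulrC.
have -> : [set v | y <= `|\sum_t \sum_(p | upper p) ((X (t, p.1, p.2) v)%:R - mu (t, p.1, p.2)) *
       (u t p.1 + u t p.2)|] =
    [set v | y <= `|\sum_(x in index_set n T) w x * ((X x v)%:R - mu x)|].
  apply/seteqP; split => v /=;
  by rewrite (E (fun x => (X x v)%:R - mu x)).
apply: poisson_chernoff_abs => //.
  move=> x; rewrite normrM (ger0_norm tau0); apply: le_trans tm; rewrite ler_wpM2l //.
  by rewrite mulr_natl mulr2n (le_trans (ler_normD _ _)) // lerD.
apply: (@le_trans _ _ (\sum_(x in index_set n T) w x ^+ 2)).
  by apply: ler_sum => x _; rewrite ler_piMr ?sqr_ge0.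
rewrite sum_index_set; apply: le_trans (_ : _ <= 4 * n%:R * \sum_t \sum_l u t l ^+ 2) _; last first.
  by rewrite ler_wpM2l.
rewrite big_distrr /=; apply: ler_sum => t _; exact: sum_edge_sqr_le.
Qed.

Lemma degree_tail (R : realType) (d : measure_display)
    (Omega : measurableType d) (P : probability Omega R) (n T : nat)
    (X : 'I_T * 'I_n * 'I_n -> {RV P >-> nat}) (mu : 'I_T * 'I_n * 'I_n -> R)
    (c : R) (t : 'I_T) (i : 'I_n) :
  mutually_independent (index_set n T) X -> (forall i, has_poisson_law (X i) (mu i)) ->
  (forall i, 0 < mu i) -> (forall i, mu i <= 1) -> (0 < n)%N -> 0 < c -> c <= 1 ->
  (P [set w | (c * n%:R / 2 <=
       `|degree (fun p => (X (t, p.1, p.2) w)%:R - mu (t, p.1, p.2)) i|)%R] <=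
    (2 * expR (- (c ^+ 2 / 128 * n%:R)))%:E)%E.
Proof.
move=> ind law mu0 mu1 n0 c0 c1.
have n1 : 1 <= n%:R :> R by rewrite ler1n.
pose w (x : 'I_T * 'I_n * 'I_n) : R := if x.1.1 == t then inc R i (x.1.2, x.2) else 0.
have E (g : 'I_T * 'I_n * 'I_n -> R) :
    degree (fun p => g (t, p.1, p.2)) i = \sum_(x in index_set n T) w x * g x.
  rewrite sum_index_set (bigD1 t) //= [X in _ + X]big1 ?addr0; last first.
    by move=> t' /negbTE tt; rewrite big1 // => p _; rewrite /w /= tt mul0r.
  by apply: eq_bigr => -[a b] _; rewrite /w /= eqxx mulrC.
have -> : [set v | c * n%:R / 2 <= `|degree (fun p => (X (t, p.1, p.2) v)%:R - mu (t, p.1, p.2)) i|] =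
    [set v | c * n%:R / 2 <= `|\sum_(x in index_set n T) w x * ((X x v)%:R - mu x)|].
  apply/seteqP; split => v /=;
  by rewrite (E (fun x => (X x v)%:R - mu x)).
(* The Chernoff parameter is c / 32. The variance is at most 4 n: the weights are at most 2 and sum
   to n + 1 <= 2 n. *)
have -> : - (c ^+ 2 / 128 * n%:R) = 2 * (c / 32) ^+ 2 * (4 * n%:R) - c / 32 * (c * n%:R / 2) by field.
have w02 x : 0 <= w x <= 2.
  by rewrite /w; case: ifP => _; [rewrite inc_ge0 inc_le2|rewrite lexx ler0n].
apply: poisson_chernoff_abs => //; first by rewrite divr_ge0 ?(ltW c0).
  move=> x; have /andP[w0 w2] := w02 x; rewrite ger0_norm; last by rewrite mulr_ge0 ?divr_ge0 ?(ltW c0).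
  have : c / 32 * w x <= c / 32 * 2 by rewrite ler_wpM2l // divr_ge0 // ltW.
  by lra.
apply: (@le_trans _ _ (\sum_(x in index_set n T) w x * 2)).
  apply: ler_sum => x _; have /andP[w0 w2] := w02 x; rewrite expr2 -mulrA ler_wpM2l //.
  by rewrite -[leRHS]mulr1; apply: ler_pM => //; exact: ltW.
rewrite -(E (fun=> 2)) [degree _ _](_ : _ = 2 * (n%:R + 1)); last first.
  by rewrite -(degree1 R i) /degree big_distrr /=; apply: eq_bigr => p _; rewrite mulrA mulr1.
by lra.
Qed.

Lemma feasible_gram (R : realType) (n k : nat) (M : R) (Z : 'M[R]_(n, k)) :
  (ones R n)^T *m Z = 0 -> (forall i, frobenius_norm (row i Z) ^+ 2 <= M) ->
  feasible M (Z *m Z^T).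
Proof.
move=> Z1 ZM; split; first split.
- by rewrite trmx_mul trmxK.
- move=> x; rewrite mulmxA -mulmxA -{1}[Z]trmxK -trmx_mul mxE.
  by apply: sumr_ge0 => i _; rewrite mxE -expr2 sqr_ge0.
- by rewrite -mulmxA -[Z^T *m _]trmxK trmx_mul trmxK Z1 trmx0 mulmx0.
move=> i j.
have rowE l : frobenius_norm (row l Z) ^+ 2 = \sum_q Z l q ^+ 2.
  rewrite sqr_sqrtr; last by apply: sumr_ge0 => *; apply: sumr_ge0 => *; exact: sqr_ge0.
  by rewrite big_ord1; apply: eq_bigr => q _; rewrite mxE.
have M0 : 0 <= M by apply: le_trans (ZM i); exact: sqr_ge0.
rewrite -(@ler_pXn2r _ 2) ?nnegrE // real_normK ?num_real // mxE.
under eq_bigr do rewrite [Z^T _ _]mxE.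
apply: le_trans (cauchy_schwarz_sum _ _ _) _; rewrite -!rowE [leRHS]expr2.
by apply: ler_pM; rewrite ?sqr_ge0.
Qed.

Lemma norm3_le (R : realFieldType) (x y z a b m : R) :
  `|x| <= a -> `|y| <= b -> `|z| <= m -> `|x + y + z| <= a + b + m.
Proof.
move=> xa yb zm; apply: le_trans (ler_normD _ _) _; apply: lerD => //.
by apply: le_trans (ler_normD _ _) _; apply: lerD.
Qed.

(* The bound of [degree_bound_alpha] for degrees between [c n / 2] and [3 n]. *)
Definition alpha_bound (R : realType) (M c : R) : R :=
  `|ln (2 * 3 ^+ 2 * expR (3 * M) / (c / 2))| + `|ln ((c / 2) ^+ 2 / (4 * 3 * expR (3 * M)))|.

(** Dominates the difference of log-means between the estimate and the shifted truth: twice a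
    difference of alphas and once a difference of two matrices with entries at most M. The final 1
    secures the condition [1 <= B] of [expR_ge_quad]. *)
Definition theta_bound (R : realType) (M Ma c : R) : R :=
  2 * (alpha_bound M c + Ma + 1) + 2 * M + 1.

(** The numerator is a lower bound for the means at the shifted truth, whose alphas are at most Ma +
    1/2 in modulus. *)
Definition curvature (R : realType) (M Ma c : R) : R :=
  expR (- (2 * Ma + 1 + M)) / (4 * theta_bound M Ma c).

(** The lower bound on the degrees acts twice: it makes a solution exist, so that [is_estimator]
    applies at [a], and through stationarity it bounds the estimated alphas. *)
Lemma good_event_bound (R : realType) (k n T : nat) (M Ma lam dl w : R)
    (Z : 'M[R]_(n, k)) (al : 'M[R]_(n, T)) (a : counts n T)
    (hG : counts n T -> 'M[R]_n) (hal : counts n T -> 'M[R]_(n, T))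
    (delta : 'I_T -> 'I_n -> R) (mu e : 'I_T -> 'I_n * 'I_n -> R) :
  let Gs := Z *m Z^T in let c := expR (- (2 * Ma + M)) in let kap := curvature M Ma c in
  (0 < n)%N -> 0 < M -> 0 < Ma -> 0 <= lam -> 0 <= w ->
  feasible M Gs -> \det (Z^T *m Z) != 0 -> (forall i t, `|al i t| <= Ma) ->
  (forall t p, mu t p = expR (log_mean Gs al t p.1 p.2)) -> (forall t p, mu t p <= 1) ->
  (forall t p, e t p = (a t p.1 p.2)%:R - mu t p) ->
  (forall t i, degree (fun p => mu t p * (delta t p.1 + delta t p.2)) i = degree (e t) i) ->
  (forall t i, `|degree (e t) i| < c * n%:R / 2) ->
  (forall t i, `|delta t i| <= dl) -> dl <= 2^-1 ->
  (forall p, `|\sum_t mu t p * (delta t p.1 + delta t p.2)| <= w) ->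
  opnorm_le (\matrix_(i, j) if (i <= j)%N then \sum_t e t (i, j) else 0) lam ->
  is_estimator M lam hG hal ->
  (kap / 4 * T%:R * frobenius_norm (hG a - Gs) ^+ 2 <=
    (3 * lam * Num.sqrt k%:R + n%:R * w) * frobenius_norm (hG a - Gs) +
    32 / kap * T%:R * n%:R ^+ 2 * dl ^+ 4)%R.
Proof.
move=> Gs c kap n0 M0 Ma0 l0 w0 fGs dZ alM muE mu1 eE newton degE dlt dl1 wb op est.
have n1 : 1 <= n%:R :> R by rewrite ler1n.
have c0 : 0 < c by exact: expR_gt0.
have GsM i j : `|Gs i j| <= M by case: fGs.
have cmu t p : c <= mu t p.
  rewrite muE ler_expR /log_mean.
  have := norm3_le (alM p.1 t) (alM p.2 t) (GsM p.1 p.2).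
  by rewrite ler_norml => /andP[h _]; apply: le_trans h; rewrite lerN2; lra.
have degmu t i : c * n%:R <= degree (mu t) i <= 2 * n%:R.
  have h1 : degree (fun=> c) i <= degree (mu t) i <= degree (fun=> 1) i.
    by apply/andP; split; apply: ler_sum => p _; rewrite ler_wpM2r ?inc_ge0.
  have d1 := degree1 R i.
  have dc : degree (fun=> c) i = c * (n%:R + 1).
    by rewrite -d1 /degree big_distrr /=; apply: eq_bigr => p _; rewrite mulrA mulr1.
  move: h1; rewrite d1 dc => /andP[h1 h2]; apply/andP; split; last by lra.
  by apply: le_trans h1; rewrite ler_pM2l // lerDl.
have dega t i : c / 2 * n%:R <= degree (fun p => (a t p.1 p.2)%:R : R) i <= 3 * n%:R.
  have -> : degree (fun p => (a t p.1 p.2)%:R : R) i = degree (e t) i + degree (mu t) i.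
    by rewrite /degree -big_split /=; apply: eq_bigr => p _; rewrite eE -mulrDl subrK.
  have := degmu t i; have := degE t i; rewrite ltr_norml.
  have c1 : c <= 1 by apply: le_trans (cmu t (i, i)) (mu1 _ _).
  have := ler_wpM2r (le_trans ler01 n1) c1.
  move: (degree _ _) (degree _ _); clear => x y ? /andP[? ?] /andP[? ?].
  by apply/andP; split; lra.
have solE : is_solution M lam a (hG a) (hal a).
  apply: est; apply: solution_exists => //; first exact: ltW.
  move=> t i; have /andP[h _] := dega t i; apply: lt_le_trans h.
  by rewrite mulr_gt0 ?divr_gt0 // ltr0n.
have [[[GhT Gpsd] Gh1 GhM] opt] := solE.
have halM i t : `|hal a i t| <= alpha_bound M c.
  apply: (degree_bound_alpha (n := n) (G := hG a) (al := fun i => hal a i t) (M := M)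
    (a := c / 2) (b := 3)) => //; first by rewrite divr_gt0.
  move=> j; rewrite -(@likelihood_stationary _ _ (fun p => (a t p.1 p.2)%:R)
     (fun p => log_mean (hG a) (hal a) t p.1 p.2)); first exact: dega.
  move=> h.
  (* Only node j at time t is moved, so the penalty and all other times cancel from the
     comparison. *)
  pose al2 : 'M[R]_(n, T) := \matrix_(i, u) (hal a i u + (if u == t then h * (i == j)%:R else 0)).
  have H := opt (hG a) al2 (And3 (conj GhT Gpsd) Gh1 GhM).
  rewrite /objective lerD2r !loglik_upper (bigD1 t) //= [leRHS](bigD1 t) //= in H.
  move: H; rewrite [X in _ + X <= _ -> _](_ : _ = \sum_(u | u != t) \sum_(p | upper p)
    ((a u p.1 p.2)%:R * log_mean (hG a) (hal a) u p.1 p.2 -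
       expR (log_mean (hG a) (hal a) u p.1 p.2))); last first.
    apply: eq_bigr => u /negbTE ut; apply: eq_bigr => p _.
    by rewrite /log_mean !mxE ut !addr0.
  rewrite lerD2r => H; apply: le_trans H; rewrite le_eqVlt; apply/orP; left; apply/eqP.
  apply: eq_bigr => p _.
  have -> : log_mean (hG a) al2 t p.1 p.2 = log_mean (hG a) (hal a) t p.1 p.2 + h * inc R j p.
    by rewrite /log_mean /inc !mxE eqxx; ring.
  by [].
pose al' : 'M[R]_(n, T) := \matrix_(i, t) (al i t + delta t i).
have al'M i t : `|al' i t| <= Ma + 2^-1.
  rewrite mxE; apply: le_trans (ler_normD _ _) _; apply: lerD => //.
  exact: le_trans (dlt t i) dl1.
have ab0 : 0 <= alpha_bound M c by rewrite addr_ge0.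
apply: (@deterministic_bound R k n T M lam (expR (- (2 * Ma + 1 + M))) (theta_bound M Ma c)
   dl w Z al al' a (hG a) (hal a) delta mu e
   (fun t p => delta t p.1 + delta t p.2)) => //.
- by move=> i t; rewrite mxE.
- exact: expR_gt0.
- by rewrite /theta_bound; lra.
- move=> t i j; rewrite ler_expR /log_mean.
  have := norm3_le (al'M i t) (al'M j t) (GsM i j).
  by rewrite ler_norml => /andP[h _]; apply: le_trans h; rewrite lerN2; lra.
- move=> t i j.
  have -> : log_mean (hG a) (hal a) t i j - log_mean Gs al' t i j =
     (hal a i t - al' i t) + (hal a j t - al' j t) + (hG a i j - Gs i j).
    by rewrite /log_mean; ring.
  have h q : `|hal a q t - al' q t| <= alpha_bound M c + (Ma + 2^-1).
    by apply: le_trans (ler_normB _ _) _; apply: lerD.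
  have hg : `|hG a i j - Gs i j| <= M + M.
    by apply: le_trans (ler_normB _ _) _; apply: lerD.
  by apply: le_trans (norm3_le (h i) (h j) hg) _; rewrite /theta_bound; lra.
Qed.

(** The linear term is absorbed by the arithmetic-geometric mean inequality, leaving multiples of n
    l^2 and T l^2; both n and T are at most n max (1, T / n). *)
Lemma rate_of_quadratic_bound (R : realType) (n T : nat) (ka K1 K2 l d : R) :
  (0 < n)%N -> (0 < T)%N -> 0 < ka -> 0 <= K1 -> 0 <= K2 ->
  ka * T%:R * d ^+ 2 <= K1 * (Num.sqrt (n * T)%:R * l) * d + K2 * T%:R * l ^+ 2 ->
  d ^+ 2 / n%:R <= T%:R^-1 *
    (2 / ka * (K1 ^+ 2 / (2 * ka) + K2) * (Num.max 1 (T%:R / n%:R) * l ^+ 2)).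
Proof.
move=> n0 T0 ka0 K10 K20 H.
have np : 0 < n%:R :> R by rewrite ltr0n.
have Tp : 0 < T%:R :> R by rewrite ltr0n.
set m := Num.max 1 _.
have nm : n%:R <= n%:R * m by rewrite ler_peMr ?(ltW np) // /m le_max lexx.
have Tm : T%:R <= n%:R * m.
  rewrite [leLHS](_ : _ = n%:R * (T%:R / n%:R)); last by field; rewrite gt_eqF.
  by rewrite ler_wpM2l ?(ltW np) // /m le_max lexx orbT.
set q := Num.sqrt _ in H.
have q2 : q ^+ 2 = n%:R * T%:R by rewrite sqr_sqrtr // natrM.
have amgm : K1 * (q * l) * d <= ka / 2 * T%:R * d ^+ 2 + K1 ^+ 2 / (2 * ka) * n%:R * l ^+ 2.
  have h : 0 <= (ka * T%:R * d - K1 * q * l) ^+ 2 / (2 * ka * T%:R).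
    by rewrite divr_ge0 ?sqr_ge0 // !mulr_ge0 // ltW.
  have e : (ka * T%:R * d - K1 * q * l) ^+ 2 / (2 * ka * T%:R) =
     ka / 2 * T%:R * d ^+ 2 - K1 * (q * l) * d + K1 ^+ 2 * q ^+ 2 * l ^+ 2 / (2 * ka * T%:R).
    by field; rewrite !gt_eqF.
  have e2 : K1 ^+ 2 * q ^+ 2 * l ^+ 2 / (2 * ka * T%:R) = K1 ^+ 2 / (2 * ka) * n%:R * l ^+ 2.
    by rewrite q2; field; rewrite !gt_eqF.
  by rewrite e e2 in h; lra.
have k1 : 0 <= K1 ^+ 2 / (2 * ka) * l ^+ 2.
  by rewrite mulr_ge0 ?sqr_ge0 // divr_ge0 ?sqr_ge0 // mulr_ge0 // ltW.
have h1 := ler_wpM2l k1 nm.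
have h2 := ler_wpM2l (mulr_ge0 K20 (sqr_ge0 l)) Tm.
have h3 : ka / 2 * T%:R * d ^+ 2 <= (K1 ^+ 2 / (2 * ka) + K2) * (n%:R * m) * l ^+ 2 by lra.
have e1 : d ^+ 2 / n%:R = 2 / (ka * T%:R * n%:R) * (ka / 2 * T%:R * d ^+ 2).
  by field; rewrite !gt_eqF.
have e2 : T%:R^-1 * (2 / ka * (K1 ^+ 2 / (2 * ka) + K2) * (m * l ^+ 2)) =
    2 / (ka * T%:R * n%:R) * ((K1 ^+ 2 / (2 * ka) + K2) * (n%:R * m) * l ^+ 2).
  by field; rewrite !gt_eqF.
by rewrite e1 e2 ler_wpM2l // divr_ge0 // !mulr_ge0 // ltW.
Qed.

Definition noise (R : realType) (n T : nat) (mu : 'I_T * 'I_n * 'I_n -> R)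
    (g : 'I_T * 'I_n * 'I_n -> nat) (t : 'I_T) (p : 'I_n * 'I_n) : R :=
  (g (t, p.1, p.2))%:R - mu (t, p.1, p.2).

(* [W t] stands for the inverse Hessian in [alpha] at time [t]; the result is the Newton step for
   [alpha] from its true value, with [G] held at its true value. *)
Definition newton (R : realType) (n T : nat) (mu : 'I_T * 'I_n * 'I_n -> R)
    (W : 'I_T -> 'M[R]_n) (g : 'I_T * 'I_n * 'I_n -> nat) (t : 'I_T) (i : 'I_n) : R :=
  \sum_j W t i j * degree (noise mu g t) j.

Definition pooled_newton (R : realType) (n T : nat) (mu : 'I_T * 'I_n * 'I_n -> R)
    (W : 'I_T -> 'M[R]_n) (g : 'I_T * 'I_n * 'I_n -> nat) (p : 'I_n * 'I_n) : R :=
  \sum_t mu (t, p.1, p.2) * (newton mu W g t p.1 + newton mu W g t p.2).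

Definition newton_bound (R : realType) (n T : nat) (c s : R) : R :=
  2 * (s + 4) / c * Num.sqrt (ln (n * T)%:R / n%:R).

(** The ratio sqrt (n T) / n is sqrt (T / n): steps of size 1 / sqrt n at T independent times add up
    to this, not to T / sqrt n. *)
Definition pooled_bound (R : realType) (n T : nat) (c s : R) : R :=
  4 * (s + 4) / c * (Num.sqrt (n * T)%:R / n%:R) * ln (n * T)%:R.

Definition bad_event (R : realType) (n T : nat) (mu : 'I_T * 'I_n * 'I_n -> R)
    (W : 'I_T -> 'M[R]_n) (c s lam : R) (g : 'I_T * 'I_n * 'I_n -> nat) : Prop :=
  [\/ exists t i, c * n%:R / 2 <= `|degree (noise mu g t) i|,
      exists t i, newton_bound n T c s <= `|newton mu W g t i|,
      exists p, pooled_bound n T c s <= `|pooled_newton mu W g p| |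
      ~ opnorm_le (noise_mx mu g) lam].

Lemma newton_tail (R : realType) (d : measure_display)
    (Omega : measurableType d) (P : probability Omega R) (n T : nat)
    (X : 'I_T * 'I_n * 'I_n -> {RV P >-> nat}) (mu : 'I_T * 'I_n * 'I_n -> R)
    (W : 'I_T -> 'M[R]_n) (c s : R) (t : 'I_T) (i : 'I_n) :
  let l := ln (n * T)%:R in
  mutually_independent (index_set n T) X -> (forall i, has_poisson_law (X i) (mu i)) ->
  (forall i, 0 < mu i) -> (forall i, mu i <= 1) -> (0 < n)%N -> (0 < T)%N ->
  0 < c -> 0 <= s -> l <= n%:R ->
  (forall t i, \sum_j W t i j ^+ 2 <= (c * n%:R)^-1 ^+ 2) ->
  (P [set w | (newton_bound n T c s <= `|newton mu W (fun x => X x w) t i|)%R] <=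
    (2 * expR (- ((s + 2) * l)))%:E)%E.
Proof.
move=> l ind law mu0 mu1 n0 T0 c0 s0 ln_n WW.
have np : 0 < n%:R :> R by rewrite ltr0n.
have cn : 0 < c * n%:R by rewrite mulr_gt0.
have l0 : 0 <= l by rewrite ln_ge0 // ler1n muln_gt0 n0 T0.
pose rt := Num.sqrt (l / n%:R).
have rt2 : rt ^+ 2 = l / n%:R by rewrite sqr_sqrtr // divr_ge0 // ltW.
have rt0 : 0 <= rt by exact: sqrtr_ge0.
have rt1 : rt <= 1 by rewrite -sqrtr1 ler_wsqrtr // ler_pdivrMr // mul1r.
pose u (t' : 'I_T) (j : 'I_n) : R := if t' == t then W t i j else 0.
have E (w : Omega) : newton mu W (fun x => X x w) t i =
    \sum_t' \sum_(p | upper p) ((X (t', p.1, p.2) w)%:R - mu (t', p.1, p.2)) * (u t' p.1 + u t' p.2).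
  rewrite (bigD1 t) //= [X in _ + X]big1 ?addr0.
    rewrite (sum_upper_degree (noise mu (fun x => X x w) t)).
    by apply: eq_bigr => j _; rewrite /u eqxx.
  by move=> t' /negbTE tt; rewrite big1 // => p _; rewrite /u tt addr0 mulr0.
have -> : [set w | newton_bound n T c s <= `|newton mu W (fun x => X x w) t i|] =
  [set w | newton_bound n T c s <= `|\sum_t' \sum_(p | upper p)
     ((X (t', p.1, p.2) w)%:R - mu (t', p.1, p.2)) * (u t' p.1 + u t' p.2)|].
  by apply/seteqP; split => w /=; rewrite E.
(* The variance term becomes 2 l and the linear term (s + 4) l, which leaves (s + 2) l. The
   condition of [linear_stat_tail] on the weights is [rt <= 1], that is l <= n. *)
pose tau := c / 2 * n%:R * rt.
have -> : - ((s + 2) * l) = 8 * tau ^+ 2 * n%:R * (c * n%:R)^-1 ^+ 2 - tau * newton_bound n T c s.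
  have e1 : 8 * tau ^+ 2 * n%:R * (c * n%:R)^-1 ^+ 2 = 2 * n%:R * rt ^+ 2.
    by rewrite /tau; field; rewrite !gt_eqF.
  have e2 : tau * newton_bound n T c s = (s + 4) * n%:R * rt ^+ 2.
    by rewrite /tau /newton_bound -/l -/rt; field; rewrite !gt_eqF.
  by rewrite e1 e2 rt2; field; rewrite !gt_eqF.
apply: (@linear_stat_tail _ _ _ _ _ _ X mu u tau _ _ (c * n%:R)^-1) => //.
- by rewrite !mulr_ge0 // ltW.
- move=> t' j; rewrite /u; case: eqP => _; last by rewrite normr0 invr_ge0 ltW.
  rewrite -(@ler_pXn2r _ 2) ?nnegrE ?invr_ge0 ?(ltW cn) // real_normK ?num_real //.
  apply: le_trans (WW t i); rewrite (bigD1 j) //= lerDl.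
  by apply: sumr_ge0 => *; exact: sqr_ge0.
- by rewrite [leLHS](_ : _ = rt) // /tau; field; rewrite !gt_eqF.
- rewrite (bigD1 t) //= [X in _ + X]big1 ?addr0; first by rewrite /u eqxx.
  by move=> t' /negbTE tt; rewrite big1 // => j _; rewrite /u tt expr0n.
Qed.

Lemma pooled_newton_tail (R : realType) (d : measure_display)
    (Omega : measurableType d) (P : probability Omega R) (n T : nat)
    (X : 'I_T * 'I_n * 'I_n -> {RV P >-> nat}) (mu : 'I_T * 'I_n * 'I_n -> R)
    (W : 'I_T -> 'M[R]_n) (c s : R) (p : 'I_n * 'I_n) :
  let l := ln (n * T)%:R in
  mutually_independent (index_set n T) X -> (forall i, has_poisson_law (X i) (mu i)) ->
  (forall i, 0 < mu i) -> (forall i, mu i <= 1) -> (0 < n)%N -> (0 < T)%N ->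
  0 < c -> 0 <= s ->
  (forall t i, \sum_j W t i j ^+ 2 <= (c * n%:R)^-1 ^+ 2) ->
  (P [set w | (pooled_bound n T c s <= `|pooled_newton mu W (fun x => X x w) p|)%R] <=
    (2 * expR (2 - (s + 4) * l))%:E)%E.
Proof.
move=> l ind law mu0 mu1 n0 T0 c0 s0 WW.
have np : 0 < n%:R :> R by rewrite ltr0n.
have cn : 0 < c * n%:R by rewrite mulr_gt0.
pose q : R := Num.sqrt (n * T)%:R.
have q2 : q ^+ 2 = n%:R * T%:R by rewrite sqr_sqrtr // natrM.
have q1 : 1 <= q by rewrite -[1]sqrtr1 ler_wsqrtr // ler1n muln_gt0 n0 T0.
have q0 : 0 < q by apply: lt_le_trans q1.
pose u (t : 'I_T) (j : 'I_n) : R := mu (t, p.1, p.2) * (W t p.1 j + W t p.2 j).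
have E (w : Omega) : pooled_newton mu W (fun x => X x w) p =
    \sum_t \sum_(r | upper r) ((X (t, r.1, r.2) w)%:R - mu (t, r.1, r.2)) * (u t r.1 + u t r.2).
  apply: eq_bigr => t _; rewrite (sum_upper_degree (noise mu (fun x => X x w) t)).
  rewrite /newton -big_split /= big_distrr /=; apply: eq_bigr => j _.
  by rewrite /u; ring.
have -> : [set w | pooled_bound n T c s <= `|pooled_newton mu W (fun x => X x w) p|] =
  [set w | pooled_bound n T c s <= `|\sum_t \sum_(r | upper r)
     ((X (t, r.1, r.2) w)%:R - mu (t, r.1, r.2)) * (u t r.1 + u t r.2)|].
  by apply/seteqP; split => w /=; rewrite E.
(* Here the variance term is the constant 2, and the condition on the weights reduces to
   [1 <= q]. *)
pose tau := c / 4 * (n%:R / q).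
have -> : 2 - (s + 4) * l = 8 * tau ^+ 2 * n%:R * (T%:R * (4 * (c * n%:R)^-1 ^+ 2)) -
    tau * pooled_bound n T c s.
  have e1 : 8 * tau ^+ 2 * n%:R * (T%:R * (4 * (c * n%:R)^-1 ^+ 2)) = 2 * (n%:R * T%:R / q ^+ 2).
    by rewrite /tau; field; rewrite !gt_eqF.
  have e2 : tau * pooled_bound n T c s = (s + 4) * l.
    by rewrite /tau /pooled_bound -/l -/q; field; rewrite !gt_eqF.
  by rewrite e1 e2 -q2 divff ?mulr1 // sqrf_eq0 gt_eqF.
have Wabs t i j : `|W t i j| <= (c * n%:R)^-1.
  rewrite -(@ler_pXn2r _ 2) ?nnegrE ?invr_ge0 ?(ltW cn) // real_normK ?num_real //.
  apply: le_trans (WW t i); rewrite (bigD1 j) //= lerDl.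
  by apply: sumr_ge0 => *; exact: sqr_ge0.
apply: (@linear_stat_tail _ _ _ _ _ _ X mu u tau _ _ (2 * (c * n%:R)^-1)) => //.
- by rewrite mulr_ge0 ?divr_ge0 // ltW.
- move=> t j; rewrite /u normrM (ger0_norm (ltW (mu0 _))).
  apply: le_trans (_ : _ <= 1 * `|W t p.1 j + W t p.2 j|) _; first by rewrite ler_wpM2r.
  rewrite mul1r; apply: le_trans (ler_normD _ _) _.
  by have := Wabs t p.1 j; have := Wabs t p.2 j; lra.
- rewrite [leLHS](_ : _ = q^-1); last by rewrite /tau; field; rewrite !gt_eqF.
  by rewrite invf_le1.
- apply: (@le_trans _ _ (\sum_(t < T) 4 * (c * n%:R)^-1 ^+ 2)); last first.
    by rewrite sumr_const card_ord -[leLHS]mulr_natl.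
  apply: ler_sum => t _.
  apply: (@le_trans _ _ (\sum_j (2 * W t p.1 j ^+ 2 + 2 * W t p.2 j ^+ 2))).
    apply: ler_sum => j _; rewrite /u exprMn.
    apply: le_trans (_ : _ <= 1 * (W t p.1 j + W t p.2 j) ^+ 2) _.
      rewrite ler_wpM2r ?sqr_ge0 // -(expr1n _ 2) lerXn2r ?nnegrE //; exact: ltW.
    by have := sqr_ge0 (W t p.1 j - W t p.2 j); rewrite !expr2; lra.
  rewrite big_split /= -!big_distrr /=.
  by have := WW t p.1; have := WW t p.2; lra.
Qed.

Lemma bad_event_tail (R : realType) (d : measure_display)
    (Omega : measurableType d) (P : probability Omega R) (n T : nat)
    (X : 'I_T * 'I_n * 'I_n -> {RV P >-> nat}) (mu : 'I_T * 'I_n * 'I_n -> R)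
    (W : 'I_T -> 'M[R]_n) (c c2 s lam : R) :
  let l := ln (n * T)%:R in let eps := c2 / 120 in let b := (s + 3) / eps in
  mutually_independent (index_set n T) X -> (forall i, has_poisson_law (X i) (mu i)) ->
  (forall i, 0 < mu i) -> (forall i, mu i <= 1) -> (0 < n)%N -> (0 < T)%N ->
  0 < c -> c <= 1 -> 0 <= s -> l <= n%:R -> 0 < c2 -> 1 <= eps * l ->
  c2 * (Num.sqrt (n * T)%:R * l) <= lam ->
  (forall t i, \sum_j W t i j ^+ 2 <= (c * n%:R)^-1 ^+ 2) ->
  (P [set w | bad_event mu W c s lam (fun x => X x w)] <=
    ((n * T)%:R * (2 * expR (- (c ^+ 2 / 128 * n%:R))) +
     (n * T)%:R * (2 * expR (- ((s + 2) * l))) +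
     (n * n)%:R * (2 * expR (2 - (s + 4) * l)) +
     (expR (expR b - (s + 1) * l) + expR (4 * expR (expR b) - n%:R)))%:E)%E.
Proof.
move=> l eps b ind law mu0 mu1 n0 T0 c0 c1 s0 ln_n c20 el1 lamb WW.
have mX Q := measurable_fin_family X Q.
pose J : finType := (('I_T * 'I_n) + ('I_T * 'I_n) + ('I_n * 'I_n) + unit)%type.
pose Q (j : J) (g : 'I_T * 'I_n * 'I_n -> nat) : Prop := match j with
  | inl (inl (inl ti)) => c * n%:R / 2 <= `|degree (noise mu g ti.1) ti.2|
  | inl (inl (inr ti)) => newton_bound n T c s <= `|newton mu W g ti.1 ti.2|
  | inl (inr p) => pooled_bound n T c s <= `|pooled_newton mu W g p|
  | inr _ => ~ opnorm_le (noise_mx mu g) lam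
  end.
pose r (j : J) : R := match j with
  | inl (inl (inl ti)) => 2 * expR (- (c ^+ 2 / 128 * n%:R))
  | inl (inl (inr ti)) => 2 * expR (- ((s + 2) * l))
  | inl (inr p) => 2 * expR (2 - (s + 4) * l)
  | inr _ => expR (expR b - (s + 1) * l) + expR (4 * expR (expR b) - n%:R)
  end.
apply: (@le_trans _ _ (\sum_j r j)%:E); last first.
  rewrite lee_fin !big_sumType /= !sumr_const !cardE -!cardT !card_prod !card_ord card_unit.
  by rewrite [(T * n)%N]mulnC mulr1n !mulr_natl.
apply: (measure_exists_le (F := fun j => [set w | Q j (fun x => X x w)])).
- exact: mX.
- by move=> j; exact: mX.
- move=> w [[t [i H]]|[t [i H]]|[p H]|H].
  + by exists (inl (inl (inl (t, i)))).
  + by exists (inl (inl (inr (t, i)))).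
  + by exists (inl (inr p)).
  + by exists (inr tt).
- case=> [[[[t i]|[t i]]|p]|u] /=.
  + exact: degree_tail.
  + exact: newton_tail.
  + exact: pooled_newton_tail.
  + exact: noise_opnorm_tail.
Qed.

(** * Rates *)

(** The right side is the maximum of the left, attained at x = p / h. It lets decay exponential in n
    absorb any power of n. *)
Lemma ln_le_linear (R : realType) (p h x : R) : 0 < p -> 0 < h -> 0 < x ->
  p * ln x - h * x <= - (p * (1 + ln (h / p))).
Proof.
move=> p0 h0 x0.
have hp : 0 < h / p by rewrite divr_gt0.
have := @le_ln1Dx R (h / p * x - 1); rewrite (addrC 1) subrK lnM ?posrE // => H.
have : ln (h / p) + ln x <= h / p * x - 1 by apply: H; have := mulr_gt0 hp x0; lra.
move/(ler_wpM2l (ltW p0)).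
have -> : p * (h / p * x - 1) = h * x - p by field; rewrite gt_eqF.
by lra.
Qed.

(** With y = sqrt x, ln x = 2 ln y <= 2 y, and the hypothesis says 4 <= r y. *)
Lemma ln_le_large (R : realType) (r x : R) :
  0 < r -> 0 < x -> 16 / r ^+ 2 <= x -> ln x <= r / 2 * x.
Proof.
move=> r0 x0 rx; pose y : R := Num.sqrt x.
have y2 : y ^+ 2 = x by rewrite sqr_sqrtr // ltW.
have y0 : 0 < y by rewrite sqrtr_gt0.
have ry0 : 0 <= r * y by rewrite mulr_ge0 // ltW.
have yr : 4 <= r * y.
  rewrite leNgt; apply/negP => lt.
  have h1 : (r * y) * (r * y) < 4 * 4 by apply: ltr_pM.
  have h2 : 16 <= x * r ^+ 2 by rewrite -ler_pdivrMr // exprn_gt0.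
  by move: h2; rewrite -y2 !expr2; lra.
have -> : ln x = 2 * ln y by rewrite -y2 lnXn // mulr_natl.
have := @le_ln1Dx R (y - 1) ltac:(lra); rewrite (addrC 1) subrK => h.
have := ler_wpM2r (ltW y0) yr; rewrite -[X in _ -> _ <= _ * X]y2 expr2; lra.
Qed.

Lemma tail_sum_le (R : realType) (c c2 s : R) : 0 < c -> 0 < s ->
  let eps := c2 / 120 in let b := (s + 3) / eps in
  exists K : R, 0 <= K /\ forall n T : nat, (0 < n)%N -> (0 < T)%N ->
    512 / c ^+ 2 * ln T%:R <= n%:R ->
    (n * T)%:R * (2 * expR (- (c ^+ 2 / 128 * n%:R))) +
    (n * T)%:R * (2 * expR (- ((s + 2) * ln (n * T)%:R))) +
    (n * n)%:R * (2 * expR (2 - (s + 4) * ln (n * T)%:R)) +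
    (expR (expR b - (s + 1) * ln (n * T)%:R) + expR (4 * expR (expR b) - n%:R)) <=
    K * n%:R `^ (- s).
Proof.
move=> c0 s0 eps b.
(* A quarter of the rate c^2 / 128 of the degree tail: one quarter pays for T through the threshold,
   another for n^(s + 1). *)
pose h := c ^+ 2 / 512.
have h0 : 0 < h by apply: divr_gt0; [exact: exprn_gt0|rewrite ltr0n].
pose k1 := - ((s + 1) * (1 + ln (h / (s + 1)))); pose k2 := - (s * (1 + ln (1 / s))).
exists (2 * expR k1 + 2 + 2 * expR 2 + expR (expR b) + expR (4 * expR (expR b) + k2)).
split; first by rewrite !addr_ge0 ?mulr_ge0 ?expR_ge0.
move=> n T n0 T0 nN; set l : R := ln (n * T)%:R.
have np : 0 < n%:R :> R by rewrite ltr0n.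
have Tp : 0 < T%:R :> R by rewrite ltr0n.
have a0 : 0 <= ln n%:R :> R by rewrite ln_ge0 // ler1n.
have t0 : 0 <= ln T%:R :> R by rewrite ln_ge0 // ler1n.
have lE : l = ln n%:R + ln T%:R by rewrite /l natrM lnM ?posrE.
have nE : n%:R = expR (ln n%:R) :> R by rewrite lnK.
have nTE : (n * T)%:R = expR l :> R by rewrite lnK // posrE ltr0n muln_gt0 n0 T0.
have th : ln T%:R <= h * n%:R.
  have := ler_wpM2l (ltW h0) nN; rewrite mulrA (_ : h * (512 / c ^+ 2) = 1) ?mul1r //.
  by rewrite /h; field; rewrite gt_eqF.
have h1 := ln_le_linear (addr_gt0 s0 ltr01) h0 np; rewrite -/k1 in h1.
have h2 := ln_le_linear s0 ltr01 np; rewrite -/k2 in h2.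
have hn : 0 <= h * n%:R by rewrite mulr_ge0 ?ltW.
have sa : 0 <= s * ln n%:R by rewrite mulr_ge0 // ltW.
have st : 0 <= s * ln T%:R by rewrite mulr_ge0 // ltW.
rewrite /powR gt_eqF // mulNr.
have L x y : expR x * (2 * expR y) = 2 * expR (x + y) by rewrite expRD; ring.
have L' x y : 2 * expR x * expR y = 2 * expR (x + y) by rewrite expRD; ring.
have e1 : (n * T)%:R * (2 * expR (- (c ^+ 2 / 128 * n%:R))) <=
    2 * expR k1 * expR (- (s * ln n%:R)).
  rewrite nTE L L' ler_wpM2l // ler_expR lE.
  have -> : c ^+ 2 / 128 * n%:R = 4 * (h * n%:R) by rewrite /h; field.
  by lra.
have e2 : (n * T)%:R * (2 * expR (- ((s + 2) * l))) <= 2 * expR (- (s * ln n%:R)).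
  by rewrite nTE L ler_wpM2l // ler_expR lE; lra.
have e3 : (n * n)%:R * (2 * expR (2 - (s + 4) * l)) <= 2 * expR 2 * expR (- (s * ln n%:R)).
  rewrite natrM {1 2}nE -expRD L L' ler_wpM2l // ler_expR lE.
  by lra.
have e4 : expR (expR b - (s + 1) * l) <= expR (expR b) * expR (- (s * ln n%:R)).
  by rewrite -expRD ler_expR lE; lra.
have e5 : expR (4 * expR (expR b) - n%:R) <= expR (4 * expR (expR b) + k2) * expR (- (s * ln n%:R)).
  by rewrite -expRD ler_expR; lra.
apply: le_trans (lerD (lerD (lerD e1 e2) e3) (lerD e4 e5)) _.
by rewrite le_eqVlt; apply/orP; left; apply/eqP; ring.
Qed.

Lemma noise_bounds_to_rate (R : realType) (n T : nat) (kap c c1 s lam d rk : R) :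
  (0 < n)%N -> (0 < T)%N -> 0 < kap -> 0 < c -> 0 <= d -> 0 <= rk ->
  lam <= c1 * (Num.sqrt (n * T)%:R * ln (n * T)%:R) ->
  kap / 4 * T%:R * d ^+ 2 <= (3 * lam * rk + n%:R * pooled_bound n T c s) * d +
    32 / kap * T%:R * n%:R ^+ 2 * newton_bound n T c s ^+ 4 ->
  kap / 4 * T%:R * d ^+ 2 <=
    (3 * c1 * rk + 4 * (s + 4) / c) * (Num.sqrt (n * T)%:R * ln (n * T)%:R) * d +
    32 / kap * (2 * (s + 4) / c) ^+ 4 * T%:R * ln (n * T)%:R ^+ 2.
Proof.
move=> n0 T0 kap0 c0 d0 rk0; rewrite /pooled_bound /newton_bound.
have np : 0 < n%:R :> R by rewrite ltr0n.
set l := ln _; set q := Num.sqrt (n * T)%:R => lam_le H.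
have l0 : 0 <= l by rewrite ln_ge0 // ler1n muln_gt0 n0 T0.
apply: le_trans H _; apply: lerD.
  rewrite ler_wpM2r // (mulrDl (3 * c1 * rk)); apply: lerD.
    have := ler_wpM2r rk0 lam_le; lra.
  rewrite le_eqVlt; apply/orP; left; apply/eqP; field.
  by rewrite !gt_eqF.
have -> : (2 * (s + 4) / c * Num.sqrt (l / n%:R)) ^+ 4 =
    (2 * (s + 4) / c) ^+ 4 * (l / n%:R) ^+ 2.
  rewrite exprMn; congr (_ * _).
  by rewrite -[in RHS](sqr_sqrtr (divr_ge0 l0 (ltW np))) -exprM.
rewrite le_eqVlt; apply/orP; left; apply/eqP; field.
by rewrite !gt_eqF.
Qed.

(* The threshold "n / log T >= N" is written without division, so that T = 1
   (where log T = 0) counts as n / log T = +oo. *)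
Theorem theorem5 (R : realType) (k : nat) (MZ1 MZ2 Ma MTh1 c1 c2 : R)
  (k_gt0 : (0 < k)%N)
  (MZ1_gt0 : 0 < MZ1) (MZ2_gt0 : 0 < MZ2) (Ma_gt0 : 0 < Ma)
  (MTh1_gt0 : 0 < MTh1) (c1_gt0 : 0 < c1) (c2_gt0 : 0 < c2)
  (s : R) (s_gt0 : 0 < s) :
  exists Cs N K : R, 0 < Cs /\
  forall (n T : nat) (Z : 'M[R]_(n, k)) (alpha : 'M[R]_(n, T)) (lam : R)
    (d : measure_display) (Omega : measurableType d) (P : probability Omega R)
    (A : 'I_T -> 'I_n -> 'I_n -> {RV P >-> nat})
    (hG : counts n T -> 'M[R]_n) (halpha : counts n T -> 'M[R]_(n, T)),
    (0 < n)%N -> (0 < T)%N ->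
    centered_full_rank Z ->
    conditionA MZ1 MZ2 Ma MTh1 Z alpha ->
    poisson_model Z alpha A ->
    c2 * (Num.sqrt (n * T)%:R * ln (n * T)%:R) <= lam
      <= c1 * (Num.sqrt (n * T)%:R * ln (n * T)%:R) ->
    is_estimator MZ1 lam hG halpha ->
    N * ln T%:R <= n%:R ->
    (P [set w | (frobenius_norm (hG (observed A w) - Z *m Z^T) ^+ 2 / n%:R
                 > T%:R^-1 * (Cs * rate' R n T))%R]
      <= (K * n%:R `^ (- s))%:E)%E.
Proof.
pose c := expR (- (2 * Ma + MZ1)).
have c_gt0 : 0 < c by exact: expR_gt0.
have c_le1 : c <= 1 by rewrite -expR0 ler_expR; lra.
pose kap := curvature MZ1 Ma c.
have kap_gt0 : 0 < kap.
  rewrite divr_gt0 ?expR_gt0 // mulr_gt0 // /theta_bound.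
  have : 0 <= alpha_bound MZ1 c by rewrite addr_ge0.
  by lra.
pose C1 := 2 * (s + 4) / c; pose C2 := 4 * (s + 4) / c.
have C1_gt0 : 0 < C1 by rewrite divr_gt0 // mulr_gt0 //; lra.
have C2_gt0 : 0 < C2 by rewrite divr_gt0 // mulr_gt0 //; lra.
pose K1 := 3 * c1 * Num.sqrt k%:R + C2; pose K2 := 32 / kap * C1 ^+ 4.
have K1_gt0 : 0 < K1 by rewrite ltr_wpDl // !mulr_ge0 ?sqrtr_ge0 // ltW.
have K2_gt0 : 0 < K2 by apply: mulr_gt0; [exact: divr_gt0|exact: exprn_gt0].
pose ka := kap / 4; have ka_gt0 : 0 < ka by rewrite divr_gt0.
(* The largest value of l / n for which [newton_bound] stays below 1/2. *)
pose r := (c / (4 * (s + 4))) ^+ 2.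
have s4 : 0 < 4 * (s + 4) by lra.
have sr_gt0 : 0 < c / (4 * (s + 4)) by rewrite divr_gt0.
have r_gt0 : 0 < r by rewrite exprn_gt0.
have r_le1 : r <= 1.
  by rewrite -(expr1n _ 2) lerXn2r ?nnegrE ?(ltW sr_gt0) // ler_pdivrMr // mul1r; lra.
have r_threshold : 512 / c ^+ 2 <= 2 / r.
  have -> : 2 / r = 32 * (s + 4) ^+ 2 / c ^+ 2 by rewrite /r; field; rewrite !gt_eqF //; lra.
  rewrite ler_wpM2r ?invr_ge0 ?sqr_ge0 //.
  by have := sqr_ge0 s; rewrite !expr2; lra.
have C1_sqrt_r : C1 * (c / (4 * (s + 4))) = 2^-1.
  by rewrite /C1; field; rewrite !gt_eqF //; lra.
(* Above [n0] the first term makes the truncation level eps l at least 1, and the second gives ln n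
   <= r n / 2. *)
pose n0 := expR (120 / c2) + 16 / r ^+ 2.
have n0_gt0 : 0 < n0 by rewrite ltr_pwDl ?expR_gt0 // divr_ge0 ?sqr_ge0.
have [K' [K'0 HK]] := tail_sum_le c2 c_gt0 s_gt0.
(* The threshold 2 / r gives ln T <= r n / 2, so that l <= r n. The summand [expR (s * ln n0)] makes
   the probability bound at least 1 when n <= n0. *)
exists (2 / ka * (K1 ^+ 2 / (2 * ka) + K2)), (2 / r), (K' + expR (s * ln n0)); split.
  apply: mulr_gt0; [exact: divr_gt0|apply: ltr_wpDl => //].
  by apply: divr_ge0; [exact: sqr_ge0|rewrite mulr_ge0 // ltW].
move=> n T Z alpha lam d Omega P A hG halpha n_gt0 T_gt0 [Zc Zdet] condA [_ law ind]
  /andP[lam_ge lam_le] est nN.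
have [ZM alM thM _ _] := condA.
pose X (x : 'I_T * 'I_n * 'I_n) : {RV P >-> nat} := A x.1.1 x.1.2 x.2.
pose Q (g : 'I_T * 'I_n * 'I_n -> nat) : Prop :=
  T%:R^-1 * (2 / ka * (K1 ^+ 2 / (2 * ka) + K2) * rate' R n T) <
  frobenius_norm (hG [ffun t => \matrix_(i, j) g (t, i, j)] - Z *m Z^T) ^+ 2 / n%:R.
have mQ : measurable [set w | Q (fun x => X x w)] by exact: measurable_fin_family.
have np : 0 < n%:R :> R by rewrite ltr0n.
have n1 : 1 <= n%:R :> R by rewrite ler1n.
have Tp : 0 < T%:R :> R by rewrite ltr0n.
have an0 : 0 <= ln n%:R :> R by rewrite ln_ge0.
have at0 : 0 <= ln T%:R :> R by rewrite ln_ge0 // ler1n.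
have pow_ge0 : 0 <= n%:R `^ (- s) :> R by exact: powR_ge0.
change ((P [set w | Q (fun x => X x w)] <= ((K' + expR (s * ln n0)) * n%:R `^ (- s))%:E)%E).
have [n_small|n_large] := leP n%:R n0.
  apply: (@le_trans _ _ 1%E); first exact: probability_le1.
  rewrite lee_fin mulrDl -[leLHS]add0r lerD ?mulr_ge0 // /powR gt_eqF // -expRD -[leLHS]expR0 ler_expR.
  by rewrite mulNr subr_ge0 ler_pM2l // ler_ln ?posrE.
pose l : R := ln (n * T)%:R.
have lE : l = ln n%:R + ln T%:R by rewrite /l natrM lnM ?posrE.
have l_ge0 : 0 <= l by rewrite lE addr_ge0.
have lnn : ln n%:R <= r / 2 * n%:R.
  apply: ln_le_large => //.
  by apply: ltW; apply: le_lt_trans n_large; rewrite lerDr expR_ge0.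
have lnT : ln T%:R <= r / 2 * n%:R.
  have r2 : 0 <= r / 2 by rewrite divr_ge0 // ltW.
  have := ler_wpM2l r2 nN; rewrite mulrA (_ : r / 2 * (2 / r) = 1) ?mul1r //.
  by field; rewrite gt_eqF.
have lr : l <= r * n%:R by rewrite lE; lra.
have ln_n : l <= n%:R by apply: le_trans lr _; rewrite ler_piMl // ltW.
have eps_l : 1 <= c2 / 120 * l.
  have : 120 / c2 <= l.
    rewrite lE; apply: le_trans (_ : _ <= ln n%:R) _; last by rewrite lerDl.
    rewrite -[leLHS]expRK ler_ln ?posrE ?expR_gt0 //.
    by apply: ltW; apply: le_lt_trans n_large; rewrite lerDl divr_ge0 ?sqr_ge0.
  by rewrite ler_pdivrMr // => h; rewrite mulrAC ler_pdivlMr // mul1r mulrC.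
have nN2 : 512 / c ^+ 2 * ln T%:R <= n%:R.
  by apply: le_trans nN; rewrite ler_wpM2r.
have fGs := feasible_gram Zc ZM.
have GsM i j : `|(Z *m Z^T) i j| <= MZ1 by case: fGs.
pose mu (x : 'I_T * 'I_n * 'I_n) := expR (log_mean (Z *m Z^T) alpha x.1.1 x.1.2 x.2).
have mu_gt0 x : 0 < mu x by exact: expR_gt0.
have mu_le1 x : mu x <= 1.
  by rewrite -expR0 ler_expR; apply: le_trans (thM _ _ _) _; rewrite oppr_le0 ltW.
have c_mu x : c <= mu x.
  rewrite ler_expR /log_mean.
  have := norm3_le (alM x.1.2 x.1.1) (alM x.2 x.1.1) (GsM x.1.2 x.2).
  by rewrite ler_norml => /andP[h _]; apply: le_trans h; rewrite lerN2; lra.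
have /choice[W HW] : forall t, exists W : 'M[R]_n,
    (forall g : 'I_n -> R, let delta i := \sum_l W i l * g l in
       forall i, degree (fun p => mu (t, p.1, p.2) * (delta p.1 + delta p.2)) i = g i) /\
    forall i, \sum_l W i l ^+ 2 <= (c * n%:R)^-1 ^+ 2.
  by move=> t; apply: newton_step.
have W_row t i : \sum_j W t i j ^+ 2 <= (c * n%:R)^-1 ^+ 2 by have [_] := HW t; apply.
have lam_ge0 : 0 <= lam.
  by apply: le_trans lam_ge; rewrite !mulr_ge0 ?sqrtr_ge0 ?(ltW c2_gt0).
apply: (@le_trans _ _ (P [set w | bad_event mu W c s lam (fun x => X x w)])); last first.
  apply: le_trans (bad_event_tail (c2 := c2) ind _ mu_gt0 mu_le1 n_gt0 T_gt0 c_gt0 c_le1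
    (ltW s_gt0) ln_n c2_gt0 eps_l lam_ge W_row) _.
    by move=> x; exact: law.
  rewrite lee_fin; apply: le_trans (HK n T n_gt0 T_gt0 nN2) _.
  by rewrite ler_wpM2r // lerDl expR_ge0.
(* It remains to see that a large error implies the bad event; off the bad event all hypotheses of
   [good_event_bound] hold. *)
apply: le_measure; rewrite ?inE //; first exact: (measurable_fin_family X (bad_event mu W c s lam)).
move=> w /= Qw; apply: contrapT => good.
set g := fun x => X x w in good Qw.
have g1 t i : `|degree (noise mu g t) i| < c * n%:R / 2.
  by rewrite ltNge; apply/negP => h; apply: good; apply: Or41; exists t, i.
have g2 t i : `|newton mu W g t i| <= newton_bound n T c s.
  by rewrite leNgt; apply/negP => h; apply: good; apply: Or42; exists t, i; exact: ltW.
have g3 p : `|pooled_newton mu W g p| <= pooled_bound n T c s.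
  by rewrite leNgt; apply/negP => h; apply: good; apply: Or43; exists p; exact: ltW.
have g4 : opnorm_le (noise_mx mu g) lam.
  by apply: contrapT => h; apply: good; exact: Or44.
have nb_le : newton_bound n T c s <= 2^-1.
  rewrite -C1_sqrt_r ler_wpM2l ?(ltW C1_gt0) //.
  have -> : c / (4 * (s + 4)) = Num.sqrt r by rewrite sqrtr_sqr ger0_norm // ltW.
  by rewrite ler_wsqrtr // ler_pdivrMr.
have pb_ge0 : 0 <= pooled_bound n T c s.
  by rewrite /pooled_bound !mulr_ge0 ?invr_ge0 ?sqrtr_ge0 ?(ltW c_gt0) ?addr_ge0 // ltW.
move: Qw; rewrite /Q; set a := [ffun t => _] => Qw.
have eE t p : noise mu g t p = (a t p.1 p.2)%:R - mu (t, p.1, p.2) by rewrite ffunE mxE.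
have nE t i : degree (fun p => mu (t, p.1, p.2) * (newton mu W g t p.1 + newton mu W g t p.2)) i =
    degree (noise mu g t) i by exact: (HW t).1.
have H := @good_event_bound R k n T MZ1 Ma lam (newton_bound n T c s) (pooled_bound n T c s)
  Z alpha a hG halpha (newton mu W g) (fun t p => mu (t, p.1, p.2)) (noise mu g)
  n_gt0 MZ1_gt0 Ma_gt0 lam_ge0 pb_ge0 fGs Zdet alM (fun _ _ => erefl) (fun _ _ => mu_le1 _)
  eE nE g1 g2 nb_le g3 g4 est.
have d0 : 0 <= frobenius_norm (hG a - Z *m Z^T) by exact: sqrtr_ge0.
have H2 := noise_bounds_to_rate n_gt0 T_gt0 kap_gt0 c_gt0 d0 (sqrtr_ge0 _) lam_le H.
have := rate_of_quadratic_bound n_gt0 T_gt0 ka_gt0 (ltW K1_gt0) (ltW K2_gt0) H2.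
by rewrite leNgt Qw.
Qed.
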